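(* For $q\equiv 1\pmod 4$ and $|u|<1/q$, we have the generating functions (1) $$\sum_{n\ge 0}\frac{i(\Omega^{+}(2n,q))}{|\mathrm{O}^{+}(2n,q)|}q^{n^2}u^n=\frac14\left[\frac{\prod_{i\ge 1}(1+u/q^{2(i-1)})^2}{\prod_{i\ge 1}(1-u^2/q^{2(i-2)})}+\frac{2\prod_{i\ge 1}(1+u/q^{i-1})}{\prod_{i\ge 1}(1-u^2/q^{2i-3})}+\frac{\prod_{i\ge 1}(1+u/q^{2i-1})^2}{\prod_{i\ge 1}(1-u^2/q^{2(i-1)})}\right],$$ (2) $$\sum_{n\ge 0}\frac{i(\Omega^{-}(2n,q))}{|\mathrm{O}^{-}(2n,q)|}q^{n^2}u^n=\frac14\left[\frac{\prod_{i\ge 1}(1+u/q^{2(i-1)})^2}{\prod_{i\ge 1}(1-u^2/q^{2(i-2)})}-\frac{\prod_{i\ge 1}(1+u/q^{2i-1})^2}{\prod_{i\ge 1}(1-u^2/q^{2(i-1)})}\right],$$ (3) $$\sum_{n\ge 0}\frac{i(\Omega(2n+1,q))}{|\mathrm{O}(2n+1,q)|}q^{n^2}u^n=\frac14\left[\frac{(1+u)\prod_{i\ge 1}(1+u/q^{2i})^2}{\prod_{i\ge 1}(1-u^2/q^{2(i-1)})}+\frac{\prod_{i\ge 1}(1+u/q^{i})}{\prod_{i\ge 1}(1-u^2/q^{2i-1})}\right].$$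
   Context: For $q$ an odd prime power and $\delta$ a fixed nonsquare in $\mathbb{F}_q^{\times}$: $\mathrm{O}^{+}(2n,q)$ is the isometry group on $\mathbb{F}_q^{2n}$ of the quadratic form $x_1x_2+x_3x_4+\cdots+x_{2n-1}x_{2n}$; for $n\ge1$, $\mathrm{O}^{-}(2n,q)$ is that of $x_1x_2+\cdots+x_{2n-3}x_{2n-2}+x_{2n-1}^2-\delta x_{2n}^2$; $\mathrm{O}(2n+1,q)$ is that of $x_1x_2+\cdots+x_{2n-1}x_{2n}+x_{2n+1}^2$ on $\mathbb{F}_q^{2n+1}$ (replacing $x_{2n+1}^2$ by $\delta x_{2n+1}^2$ gives an isomorphic group). $\mathrm{SO}$ denotes the subgroup of determinant $1$ elements. $\Omega^{\pm}(N,q)$ (or $\Omega(N,q)$ for $N$ odd) is the derived subgroup of the corresponding special orthogonal group, which has index $2$ for $N\ge 3$; for $N=2$, $\Omega^{\pm}(2,q)$ denotes the unique index $2$ subgroup of the cyclic group $\mathrm{SO}^{\pm}(2,q)$ of order $q\mp1$; $\Omega(1,q)$ and $\Omega^{+}(0,q)$ are trivial. $i(X)$ denotes the number of $g\in X$ with $g^2=1$ (the identity is counted). Conventions: $|\mathrm{O}^{+}(0,q)|=1$, and $1/|\mathrm{O}^{-}(0,q)|=0$, so the $n=0$ term in (2) is $0$. *)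

(* Defs.v *)
From HB Require Import structures.
From mathcomp Require Import all_boot all_order all_algebra all_fingroup all_solvable.
From mathcomp Require Import all_classical all_reals all_analysis.
From mathcomp Require Import complex.

Set Implicit Arguments.
Unset Strict Implicit.
Unset Printing Implicit Defensive.

Import Order.TTheory GRing.Theory Num.Theory.
Import numFieldNormedType.Exports.

Local Open Scope ring_scope.

Section OrthogonalGroups.
Variable F : finFieldType.

(* Coordinates are numbered from 0, so x_1 x_2 + ... + x_(2n-1) x_(2n) pairs  *)
(* the coordinates 2i and 2i+1.  [inord k] is the index k only for k <= N;    *)
(* every use below is in range.                                               *)
Definition hyperbolic (N n : nat) (v : 'rV[F]_N.+1) : F :=
  \sum_(i < n) v 0 (inord i.*2) * v 0 (inord i.*2.+1).

(* Even-dimensional forms live on F^(2n) with n = m + 1 >= 1.                 *)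
Definition form_plus (m : nat) (v : 'rV[F]_m.*2.+2) : F := hyperbolic m.+1 v.

Definition form_minus (delta : F) (m : nat) (v : 'rV[F]_m.*2.+2) : F :=
  hyperbolic m v + v 0 (inord m.*2) ^+ 2 - delta * v 0 (inord m.*2.+1) ^+ 2.

Definition form_odd (n : nat) (v : 'rV[F]_n.*2.+1) : F :=
  hyperbolic n v + v 0 (inord n.*2) ^+ 2.

Section Group.
Variables (N : nat) (Q : 'rV[F]_N.+1 -> F).

Definition O_set : {set {'GL_N.+1[F]}} :=
  [set g : {'GL_N.+1[F]} | [forall v : 'rV[F]_N.+1, Q (v *m GLval g) == Q v]].

Lemma O_group_set : group_set O_set.
Proof.
apply/group_setP; split.
  by rewrite inE; apply/forallP => v; rewrite GL_1E mulmx1.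
move=> g h; rewrite !inE => /forallP Qg /forallP Qh; apply/forallP => v.
by rewrite GL_ME mulmxA (eqP (Qh _)) (eqP (Qg _)).
Qed.
Canonical O_group := Group O_group_set.

Definition SO_set : {set {'GL_N.+1[F]}} :=
  [set g in O_set | \det (GLval g) == 1].

Lemma SO_group_set : group_set SO_set.
Proof.
apply/group_setP; split.
  by rewrite inE group1 GL_1E det1 eqxx.
move=> g h /setIdP[Og /eqP dg] /setIdP[Oh /eqP dh].
by apply/setIdP; split; [exact: groupM | rewrite GL_ME det_mulmx dg dh mulr1].
Qed.
Canonical SO_group := Group SO_group_set.

(* Dimension N + 1: trivial in dimension 1; in dimension 2, the index 2       *)
(* subgroup of SO (unique for the forms above, where SO is cyclic of even     *)
(* order); the derived subgroup of SO in dimension at least 3.                *)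
Definition Omega : {set {'GL_N.+1[F]}} :=
  if N == 0%N then 1%g
  else if N == 1%N then
    if [pick H : {group {'GL_N.+1[F]}} |
          (H \subset SO_set) && (#|SO_set : H|%g == 2%N)] is Some H
    then H : {set {'GL_N.+1[F]}} else 1%g
  else (SO_set^`(1))%g.

End Group.

Definition num_invol (gT : finGroupType) (X : {set gT}) : nat :=
  #|[set g in X | (g ^+ 2 == 1)%g]|.

(* i(Omega) / |O| in each family.  The dimension 0 values are conventions:    *)
(* i(Omega^+(0,q)) / |O^+(0,q)| = 1 and 1 / |O^-(0,q)| = 0.                   *)
Definition ratio_plus (K : fieldType) (n : nat) : K :=
  if n is m.+1 then
    (num_invol (Omega (@form_plus m)))%:R / #|O_set (@form_plus m)|%:R
  else 1.

Definition ratio_minus (K : fieldType) (delta : F) (n : nat) : K :=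
  if n is m.+1 then
    (num_invol (Omega (@form_minus delta m)))%:R
      / #|O_set (@form_minus delta m)|%:R
  else 0.

Definition ratio_odd (K : fieldType) (n : nat) : K :=
  (num_invol (Omega (@form_odd n)))%:R / #|O_set (@form_odd n)|%:R.

End OrthogonalGroups.

Local Open Scope classical_set_scope.

(* Stated over an abstract numFieldType because the complex numbers R[i] have *)
(* no topology attached to their bare carrier.                                *)
Definition series_sums_to (K : numFieldType) (a : nat -> K) (s : K) : Prop :=
  series a @ \oo --> s.

Definition infprod (K : numFieldType) (f : nat -> K) : K :=
  limn (fun n => \prod_(1 <= i < n.+1) f i).

(* Main.v *)
Require Import Defs.
From HB Require Import structures.
From mathcomp Require Import all_boot all_order all_algebra all_fingroup all_solvable.
From mathcomp Require Import all_classical all_reals all_analysis.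
From mathcomp Require Import complex finfield zify ring.

Set Implicit Arguments.
Unset Strict Implicit.
Unset Printing Implicit Defensive.

Import Order.TTheory GRing.Theory Num.Theory.
Import numFieldNormedType.Exports.

Local Open Scope ring_scope.

(* As q = 1 mod 4, -1 is a square, so every nondegenerate quadratic space whose
   discriminant is a square has an orthonormal basis. An involution in SO is
   determined by its (-1)-eigenspace, which is nondegenerate of even dimension;
   it lies in Omega exactly when this eigenspace has square discriminant.  One
   direction: the sign of the permutation induced on the unit vectors is a
   homomorphism to Z/2, trivial on the derived subgroup, which detects the
   discriminant; the other: -1 on an orthonormal plane is a commutator.
   Counting subspaces with an orthonormal basis by Witt's theorem gives
     i(Omega) / |O(N)| = sum_k 1 / (|O^+(2k)| |O(N - 2k)|).
   With x = 1/q, the resulting generating functions are combinations of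
     sum_(j,k) u1^j u2^k x^((j-k)^2) / ((x^2;x^2)_j (x^2;x^2)_k)
       = (-u1 x; x^2)_oo (-u2 x; x^2)_oo / (u1 u2; x^2)_oo
   for u1, u2 in {u q, u, u / q}.  This identity follows from q-Vandermonde and
   Euler's series for (z;x^2)_oo and its inverse. *)

(** * Squares and conics over F_q *)

(** [Omega] is not uniformly a derived subgroup: in dimension 2 it is whatever index 2 subgroup
    [pick] returns. The criterion for involutions is therefore checked separately in dimension 1, 2
    and at least 3, in dimension 2 by arguments valid for every subgroup of index 2. The sign on
    unit vectors detects discriminants because powers of q are 1 mod 4: the number of unit vectors
    is 0 or 2 mod 4 according to dimension and discriminant, and an involution moves a difference of
    two such numbers. Witt's theorem enters only as the fact that the number of frames depends on
    dimension and discriminant class alone. The constant 1/4 comes from a factor 2 in each of two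
    group orders. In even dimension the factors q^k + 1 and q^j + 1 or q^j - 1 that remain over
    (x^2;x^2)_k and (x^2;x^2)_j expand into the choices of u1 and u2; the cross terms double in (1)
    and cancel in (2). Finally q > 4 yields (x^2;x^2)_n > 1/2, which bounds the coefficients of both
    Euler series. *)

Section Squares.
Variable F : finFieldType.
Local Notation q := #|F|.
Hypothesis hq : (q %% 4 = 1)%N.

Definition is_sqr (a : F) : bool := [exists x, x ^+ 2 == a].

Lemma is_sqrP a : reflect (exists x, x ^+ 2 = a) (is_sqr a).
Proof. by apply: (iffP existsP) => -[x]; [move/eqP|move=> <-]; exists x. Qed.

Lemma card_field_gt4 : (4 < q)%N.
Proof.
have q1 : (1 < q)%N := card_finNzRing_gt1 F.
by move: (divn_eq q 4); rewrite hq; case: (q %/ 4)%N => [|k] E; lia.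
Qed.

Lemma primitive_element : exists w : F,
  [/\ w != 0, forall x : F, x != 0 -> exists k, x = w ^+ k
    & forall j, w ^+ j = 1 -> (q.-1 %| j)%N].
Proof.
have /cyclicP[g gP] := field_unit_group_cyclic [set: {unit F}]%G.
exists (FinRing.uval g); split.
- by rewrite -unitfE; exact: valP.
- move=> x x0; have ux : x \is a GRing.unit by rewrite unitfE.
  have /cycleP[k kP] : FinRing.Unit ux \in <[g]>%g by rewrite -gP inE.
  by exists k; rewrite -FinRing.val_unitX -kP.
- move=> j; rewrite -FinRing.val_unitX => gj.
  rewrite -card_finField_unit gP -/(#[g]%g) order_dvdn.
  by apply/eqP; apply: val_inj; rewrite [LHS]gj.
Qed.

(** In characteristic 2 the power [w ^+ (q.-1./2)], whose square is 1, would itself be 1, against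
    the order of [w]. *)
Lemma two_neq0 : 2 != 0 :> F.
Proof.
apply/eqP => h2; have [w [w0 gen ord]] := primitive_element.
have /ord : w ^+ (q.-1./2) = 1.
  have: (w ^+ (q.-1./2)) ^+ 2 = 1.
    rewrite -exprM muln2 halfK; have -> : odd q.-1 = false.
      by move: (divn_eq q 4); rewrite hq; lia.
    rewrite subn0; apply: (mulfI w0); rewrite -exprS prednK ?mulr1 ?expf_card//.
    exact: (ltnW (card_finNzRing_gt1 F : (1 < q)%N)).
  move/eqP; rewrite -subr_eq0 subr_sqr_1 mulf_eq0 subr_eq0 => /orP[/eqP//|].
  rewrite addr_eq0 => /eqP->; apply/eqP.
  by rewrite eq_sym -subr_eq0 opprK -mulr2n h2.
have := card_field_gt4; move: (divn_eq q 4); rewrite hq => E q4 /dvdn_leq; lia.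
Qed.

Lemma sqrtN1 : exists i : F, i ^+ 2 = -1.
Proof.
have [w [w0 gen ord]] := primitive_element.
have E := divn_eq q 4; rewrite hq in E.
(* Since [q %/ 4] is (q - 1) / 4, this element has order 4, and its square is the element -1 of
   order 2. *)
exists (w ^+ (q %/ 4)%N).
have : (w ^+ (q %/ 4)%N ^+ 2) ^+ 2 = 1.
  rewrite -!exprM; apply: (mulfI w0); rewrite -exprS mulr1.
  by rewrite (_ : _.+1 = q) ?expf_card //; lia.
move/eqP; rewrite -subr_eq0 subr_sqr_1 mulf_eq0 subr_eq0 => /orP[/eqP|].
  rewrite -exprM => /ord /dvdn_leq; have := card_field_gt4; lia.
by rewrite addr_eq0 => /eqP.
Qed.

Lemma is_sqr1 : is_sqr 1. Proof. by apply/is_sqrP; exists 1; rewrite expr1n. Qed.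

Lemma is_sqrMl c a : c != 0 -> is_sqr (c ^+ 2 * a) = is_sqr a.
Proof.
move=> c0; apply/is_sqrP/is_sqrP => -[x].
  by move=> E; exists (x / c); rewrite expr_div_n E mulrC mulKf // expf_eq0.
by move=> <-; exists (c * x); rewrite exprMn.
Qed.

Lemma is_sqrN a : is_sqr (- a) = is_sqr a.
Proof.
have [i i2] := sqrtN1; rewrite -mulN1r -i2 is_sqrMl //.
by apply: contra_eqN i2 => /eqP->; rewrite expr0n eq_sym oppr_eq0 oner_eq0.
Qed.

Lemma is_sqrM a b : a != 0 -> b != 0 ->
  is_sqr (a * b) = (is_sqr a == is_sqr b).
Proof.
have [w [w0 gen ord]] := primitive_element.
have sq k : is_sqr (w ^+ k) = ~~ odd k.
  apply/is_sqrP/idP => [[x xk]|ek]; last first.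
    by exists (w ^+ k./2); rewrite -exprM muln2 halfK (negbTE ek) subn0.
  have x0 : x != 0.
    by apply: contra_eqN xk => /eqP->; rewrite expr0n eq_sym expf_neq0.
  have [j ej] := gen _ x0; move: xk; rewrite ej -exprM.
  have E := divn_eq q 4; rewrite hq in E.
  (* The parity of the exponent is well defined: exponents of equal powers differ by a multiple of
     the even number q - 1. *)
  have aux m n : (m <= n)%N -> w ^+ m = w ^+ n -> odd m = odd n.
    move=> mn; rewrite -(subnK mn) exprD -{1}[w ^+ m]mul1r.
    move/(mulIf (expf_neq0 _ w0))/esym/ord => /dvdnP[l ->].
    by rewrite oddD oddM (_ : odd q.-1 = false) ?andbF //; lia.
  by case/orP: (leq_total (j * 2) k) => /aux h;
    [move/h => <-|move/esym/h => ->]; rewrite oddM andbF.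
move=> /gen[k ->] /gen[l ->]; rewrite -exprD !sq oddD.
by case: odd; case: odd.
Qed.

Lemma card_sqrt c : #|[set x : F | x ^+ 2 == c]| =
  (if c == 0%R then 1 else if is_sqr c then 2 else 0)%N.
Proof.
have [->|c0] := eqVneq.
  rewrite (_ : [set _ | _] = [set 0]) ?cards1 //.
  by apply/setP => x; rewrite !inE sqrf_eq0.
case: ifPn => [/is_sqrP[y yc]|nc].
  rewrite (_ : [set _ | _] = [set y; -y]); last first.
    by apply/setP => x; rewrite !inE -yc eqf_sqr.
  rewrite cards2 -addr_eq0 -mulr2n -mulr_natl mulf_eq0 (negbTE two_neq0) /=.
  by rewrite (_ : y == 0 = false) //; apply: contraNF c0 => /eqP y0; rewrite -yc y0 expr0n.
apply/eqP; rewrite cards_eq0; apply/eqP/setP => x; rewrite !inE.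
by apply: contraNF nc => /eqP <-; apply/is_sqrP; exists x.
Qed.

Lemma card_hyperbola c : #|[set z : F * F | z.1 * z.2 == c]| =
  (if c == 0%R then 2 * q - 1 else q - 1)%N.
Proof.
have -> : #|[set z : F * F | z.1 * z.2 == c]| =
    (\sum_(x : F) #|[set y | (x * y)%R == c]|)%N.
  rewrite -sum1_card (eq_bigl (fun z : F * F => z.1 * z.2 == c)); last first.
    by move=> z; rewrite inE.
  rewrite (eq_bigl (fun z : F * F => xpredT z.1 && (z.1 * z.2 == c))) //.
  rewrite -(pair_big_dep xpredT (fun x y => x * y == c) (fun _ _ => 1%N)) /=.
  by apply: eq_bigr => x _; rewrite -sum1_card; apply: eq_bigl => y; rewrite inE.
have h x : x != 0 -> #|[set y | x * y == c]| = 1%N.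
  move=> x0; rewrite (_ : [set _ | _] = [set c / x]) ?cards1 //.
  by apply/setP => y; rewrite !inE mulrC -(can2_eq (mulfK x0) (divfK x0)).
rewrite (bigD1 0) //= (eq_bigr (fun=> 1%N)) // sum1_card.
have -> : #|(fun x : F => x != 0)| = q.-1.
  by rewrite -(cardC1 (0 : F)); apply: eq_card.
have q1 : (1 < q)%N := card_finNzRing_gt1 F.
have [->|c0] := eqVneq.
  have -> : #|[set y : F | 0 * y == 0]| = q.
    by apply: eq_card => y; rewrite !inE mul0r eqxx.
  by rewrite mul2n -addnn -subn1 addnBA // ltnW.
rewrite (_ : [set y | _] = finset.set0) ?cards0 ?add0n ?subn1 //.
by apply/setP => y; rewrite !inE mul0r eq_sym (negbTE c0).
Qed.

(** A square root i of -1 factors x^2 + y^2 as (x + i y)(x - i y), so the circle is a hyperbola in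
    other coordinates. *)
Lemma card_circle c : #|[set z : F * F | z.1 ^+ 2 + z.2 ^+ 2 == c]| =
  (if c == 0%R then 2 * q - 1 else q - 1)%N.
Proof.
have [i i2] := sqrtN1.
have h2 := two_neq0.
have i0 : i != 0.
  by apply: contra_eqN i2 => /eqP->; rewrite expr0n eq_sym oppr_eq0 oner_eq0.
rewrite -card_hyperbola.
pose f (z : F * F) := (z.1 + i * z.2, z.1 - i * z.2).
have fI : injective f.
  move=> [a b] [a' b'] [/= E1 E2].
  have /(mulfI h2) -> : 2 * a = 2 * a'.
    transitivity ((a + i * b) + (a - i * b)); first by ring.
    by rewrite E1 E2; ring.
  have : 2 * i * b = 2 * i * b'.
    transitivity ((a + i * b) - (a - i * b)); first by ring.
    by rewrite E1 E2; ring.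
  by move/(mulfI (mulf_neq0 h2 i0)) ->.
rewrite -(card_imset _ fI); apply: eq_card => -[u v].
rewrite !inE /=; apply/imsetP/eqP => [[[a b]]|E].
  rewrite inE /= => /eqP <- [-> ->].
  by transitivity (a ^+ 2 - i ^+ 2 * b ^+ 2); [ring|rewrite i2; ring].
exists ((u + v) / 2, (u - v) / (2 * i)).
  rewrite inE /= -E; apply/eqP.
  rewrite !expr_div_n exprMn i2 mulrN1 invrN mulrN; field.
  by rewrite -[4]/((2 * 2)%:R : F) natrM mulf_neq0.
by rewrite /f /=; congr pair; field; rewrite ?h2 ?i0.
Qed.

(* Adding the counts for [d] and for a square: as [x] varies, [1 - x^2] is
   hit twice by the union of the values [y^2] and [d y^2]. *)
Lemma card_ellipse d : ~~ is_sqr d ->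
  #|[set z : F * F | z.1 ^+ 2 + d * z.2 ^+ 2 == 1]| = q.+1.
Proof.
move=> nd.
have d0 : d != 0.
  by apply: contraNneq nd => ->; apply/is_sqrP; exists 0; rewrite expr0n.
have sumE e : #|[set z : F * F | z.1 ^+ 2 + e * z.2 ^+ 2 == 1]| =
    (\sum_(x : F) #|[set y | (e * y ^+ 2 == 1 - x ^+ 2)%R]|)%N.
  rewrite -sum1_card (eq_bigl (fun z : F * F => xpredT z.1 &&
     (e * z.2 ^+ 2 == 1 - z.1 ^+ 2))); last first.
    by move=> z; rewrite inE /= addrC -subr_eq opprK eq_sym -subr_eq eq_sym.
  rewrite -(pair_big_dep xpredT (fun x y => e * y ^+ 2 == 1 - x ^+ 2) (fun _ _ => 1%N)) /=.
  by apply: eq_bigr => x _; rewrite -sum1_card; apply: eq_bigl => y; rewrite inE.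
have c1 : #|[set z : F * F | z.1 ^+ 2 + 1 * z.2 ^+ 2 == 1]| = q.-1.
  rewrite -subn1; have := card_circle 1; rewrite oner_eq0 => <-.
  by apply: eq_card => z; rewrite !inE mul1r.
suff : (#|[set z : F * F | (z.1 ^+ 2 + d * z.2 ^+ 2 == 1)%R]| +
       #|[set z : F * F | (z.1 ^+ 2 + 1 * z.2 ^+ 2 == 1)%R]|)%N = (2 * q)%N.
  by rewrite c1; have : (1 < q)%N := card_finNzRing_gt1 F; lia.
rewrite !sumE -big_split /= (eq_bigr (fun=> 2%N)) ?sum_nat_const ?cardT 1?mulnC //.
move=> x _; set c := 1 - _.
have -> : [set y | d * y ^+ 2 == c] = [set y | y ^+ 2 == d * (c / d ^+ 2)].
  apply/setP => y; rewrite !inE mulrC (can2_eq (mulfK d0) (divfK d0)).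
  by congr (_ == _); field.
have -> : [set y | 1 * y ^+ 2 == c] = [set y | y ^+ 2 == c].
  by apply/setP => y; rewrite !inE mul1r.
rewrite !card_sqrt.
have [->|c0] := eqVneq c 0; first by rewrite mul0r mulr0 eqxx.
have e0 : c / d ^+ 2 != 0 by rewrite mulf_neq0 ?invr_eq0 ?expf_neq0.
have -> : is_sqr (d * (c / d ^+ 2)) = ~~ is_sqr c.
  rewrite is_sqrM // mulrC -exprVn is_sqrMl ?invr_eq0 // (negbTE nd).
  by case: is_sqr.
by rewrite mulf_eq0 (negbTE d0) (negbTE e0) /=; case: is_sqr.
Qed.

End Squares.

(** * Orthonormal frames and involutions *)

Section Forms.
Variable F : finFieldType.
Local Notation q := #|F|.
Hypothesis hq : (q %% 4 = 1)%N.

(** Isometric embeddings, as matrices acting on row vectors: the rows of [A] have Gram matrix [M] in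
    the space with Gram matrix [S]. One notion covers isometry groups ([M = S]) and orthonormal
    frames ([M = 1%:M]), so the same fibre counts serve both. *)
Definition isoms k N (M : 'M[F]_k) (S : 'M[F]_N) : {set 'M[F]_(k, N)} :=
  [set A | A *m S *m A^T == M].

Definition frames k N (S : 'M[F]_N) : {set 'M[F]_(k, N)} := isoms 1%:M S.

Definition bf N (S : 'M[F]_N) (u v : 'rV[F]_N) : F := (u *m S *m v^T) 0 0.

Definition qf N (S : 'M[F]_N) (v : 'rV[F]_N) : F := bf S v v.

Lemma bfC N (S : 'M[F]_N) u v : S^T = S -> bf S u v = bf S v u.
Proof.
move=> symS; transitivity ((u *m S *m v^T)^T 0 0); first by rewrite mxE.
by rewrite !trmx_mul trmxK symS mulmxA.
Qed.

Lemma bfDl N (S : 'M[F]_N) u v w : bf S (u + v) w = bf S u w + bf S v w.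
Proof. by rewrite /bf !mulmxDl mxE. Qed.

Lemma bfDr N (S : 'M[F]_N) u v w : bf S u (v + w) = bf S u v + bf S u w.
Proof. by rewrite /bf linearD /= mulmxDr mxE. Qed.

Lemma bfZl N (S : 'M[F]_N) a u v : bf S (a *: u) v = a * bf S u v.
Proof. by rewrite /bf -!scalemxAl mxE. Qed.

Lemma bfZr N (S : 'M[F]_N) a u v : bf S u (a *: v) = a * bf S u v.
Proof. by rewrite /bf linearZ /= -scalemxAr mxE. Qed.

Lemma frames1E N (S : 'M[F]_N) v : (v \in frames 1 S) = (qf S v == 1).
Proof.
rewrite inE /qf /bf /=; apply/eqP/eqP => [->|E]; first by rewrite mxE eqxx.
by rewrite [LHS]mx11_scalar E.
Qed.

Lemma isomsP k N (M : 'M[F]_k) (S : 'M[F]_N) A :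
  reflect (A *m S *m A^T = M) (A \in isoms M S).
Proof. by rewrite inE; exact: eqP. Qed.

Lemma gram_col_mx r s N (S : 'M[F]_N) (A : 'M[F]_(r, N)) (C : 'M[F]_(s, N)) :
  col_mx A C *m S *m (col_mx A C)^T =
  block_mx (A *m S *m A^T) (A *m S *m C^T) (C *m S *m A^T) (C *m S *m C^T).
Proof. by rewrite tr_col_mx mul_col_mx mul_col_row. Qed.

Lemma orthogonal_complement r s (S : 'M[F]_(r + s)) (A : 'M[F]_(r, r + s)) :
  S^T = S -> A *m S *m A^T \in unitmx ->
  exists C : 'M[F]_(s, r + s),
    [/\ col_mx A C \in unitmx, C *m S *m A^T = 0 & A *m S *m C^T = 0].
Proof.
move=> symS uG; set B := S *m A^T.
(* The invertible [A *m S *m A^T] factors through [B], so [B] has full rank [r] and its kernel has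
   dimension [s]. *)
have rkB : \rank B = r.
  apply/eqP; rewrite eqn_leq rank_leq_col /=.
  by rewrite -{1}(mxrank_unit uG) -mulmxA mxrankM_maxr.
have [C [freeC KC]] : exists C : 'M[F]_(s, r + s), row_free C /\ (C <= kermx B)%MS.
  have gen t (K : 'M[F]_(r + s)) : \rank K = t ->
      exists C : 'M[F]_(t, r + s), row_free C /\ (C <= K)%MS.
    by move=> <-; exists (row_base K); rewrite row_base_free eq_row_base.
  by apply: gen; rewrite mxrank_ker rkB addKn.
have CB : C *m B = 0 by apply/eqP; rewrite -sub_kermx.
have CA : C *m S *m A^T = 0 by rewrite -mulmxA.
exists C; split => //; last first.
  by apply: trmx_inj; rewrite !trmx_mul trmxK symS mulmxA CA trmx0.
rewrite -row_free_unit; apply/inj_row_free => v.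
rewrite -[v]hsubmxK mul_row_col => E.
have : (lsubmx v *m A + rsubmx v *m C) *m B = 0 by rewrite E mul0mx.
rewrite mulmxDl -[_ *m C *m B]mulmxA CB mulmx0 addr0 -mulmxA mulmxA.
rewrite -mulmxA /B (mulmxA A) => lG0.
have l0 : lsubmx v = 0 by rewrite -(mulmxK uG (lsubmx v)) lG0 mul0mx.
rewrite l0 mul0mx add0r in E.
by rewrite l0 (row_free_inj freeC (etrans E (esym (mul0mx _ C)))) row_mx0.
Qed.

Lemma det_gram N (T S : 'M[F]_N) : \det (T *m S *m T^T) = \det T ^+ 2 * \det S.
Proof. by rewrite !det_mulmx det_tr mulrAC. Qed.

Lemma gram_unit N (T S : 'M[F]_N) : T \in unitmx ->
  (T *m S *m T^T \in unitmx) = (S \in unitmx).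
Proof.
move=> uT; rewrite !unitmxE det_gram !unitfE mulf_eq0 expf_eq0 /=.
by move: uT; rewrite unitmxE unitfE => /negbTE->.
Qed.

Lemma is_sqr_gram N (T S : 'M[F]_N) : T \in unitmx ->
  is_sqr (\det (T *m S *m T^T)) = is_sqr (\det S).
Proof. by rewrite det_gram unitmxE unitfE => uT; rewrite is_sqrMl. Qed.

Lemma sym_gram k N (T : 'M[F]_(k, N)) (S : 'M[F]_N) :
  S^T = S -> (T *m S *m T^T)^T = T *m S *m T^T.
Proof. by move=> symS; rewrite !trmx_mul trmxK symS mulmxA. Qed.

Lemma orthogonal_split r s (S : 'M[F]_(r + s)) (A : 'M[F]_(r, r + s)) :
  S^T = S -> S \in unitmx -> A *m S *m A^T \in unitmx ->
  exists C : 'M[F]_(s, r + s), let S' := C *m S *m C^T in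
    [/\ col_mx A C \in unitmx,
        col_mx A C *m S *m (col_mx A C)^T = block_mx (A *m S *m A^T) 0 0 S',
        S'^T = S', S' \in unitmx
      & is_sqr (\det S) = (is_sqr (\det (A *m S *m A^T)) == is_sqr (\det S'))].
Proof.
move=> symS uS uG; have [C [uT CA AC]] := orthogonal_complement symS uG.
exists C; have E := gram_col_mx S A C; rewrite CA AC in E.
have uS' : C *m S *m C^T \in unitmx.
  have := uS; rewrite -(gram_unit _ uT) E !unitmxE det_ublock !unitfE mulf_eq0.
  by rewrite negb_or => /andP[].
split=> //; first exact: sym_gram.
rewrite -(is_sqr_gram S uT) E det_ublock is_sqrM // -unitfE -unitmxE //.
Qed.

Lemma isoms_congr k N (M : 'M[F]_k) (T S : 'M[F]_N) : T \in unitmx ->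
  #|isoms M (T *m S *m T^T)| = #|isoms M S|.
Proof.
move=> uT; rewrite -(card_imset _ (can_inj (mulmxK uT : cancel (mulmx^~ T) _))).
apply: eq_card => A; rewrite inE; apply/imsetP/eqP => [[B]|E].
  by rewrite inE => /eqP BB ->; rewrite trmx_mul !mulmxA in BB *.
exists (A *m invmx T); last by rewrite mulmxKV.
rewrite inE -E; apply/eqP.
by rewrite !mulmxA mulmxKV // -!mulmxA -trmx_mul mulmxKV.
Qed.

Lemma isoms_congl k N (M T : 'M[F]_k) (S : 'M[F]_N) : T \in unitmx ->
  #|isoms (T *m M *m T^T) S| = #|isoms M S|.
Proof.
move=> uT; rewrite -[RHS](card_imset _ (can_inj (mulKmx uT : cancel (mulmx T) _))).
apply: eq_card => A; rewrite inE; apply/eqP/imsetP => [E|[B]].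
  exists (invmx T *m A); last by rewrite mulKVmx.
  rewrite inE trmx_mul !mulmxA -(mulmxA _ A) -(mulmxA _ (A *m S)) E.
  rewrite !mulmxA mulVmx // mul1mx -mulmxA -trmx_mul mulVmx //.
  by rewrite trmx1 mulmx1.
by rewrite inE => /eqP BB ->; rewrite trmx_mul -BB !mulmxA.
Qed.

(** [C] is a basis of the orthogonal complement of the rows of [A], so an embedding orthogonal to
    [A] factors uniquely through [C]. *)
Lemma card_isoms_orthogonal k r s (M : 'M[F]_k) (S : 'M[F]_(r + s))
    (A : 'M[F]_(r, r + s)) (C : 'M[F]_(s, r + s)) :
  A *m S *m A^T \in unitmx -> col_mx A C \in unitmx -> C *m S *m A^T = 0 ->
  #|[set B in isoms M S | B *m S *m A^T == 0]| = #|isoms M (C *m S *m C^T)|.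
Proof.
move=> uG uT CA; have freeC : row_free C.
  apply/inj_row_free => v vC; have := mulmxK uT (row_mx 0 v).
  by rewrite mul_row_col mul0mx vC addr0 mul0mx -row_mx0 => /eq_row_mx[].
rewrite -[RHS](card_imset _ (row_free_inj freeC)).
apply: eq_card => B; rewrite !inE; apply/andP/imsetP => [[/eqP BM /eqP BA]|[X]].
  pose Y := B *m invmx (col_mx A C).
  have BE : B = lsubmx Y *m A + rsubmx Y *m C.
    by rewrite -mul_row_col hsubmxK mulmxKV.
  have l0 : lsubmx Y = 0.
    move: BA; rewrite BE !mulmxDl -(mulmxA _ C) -(mulmxA _ (C *m S)) CA mulmx0 addr0.
    rewrite -!mulmxA (mulmxA A) => lG0.
    by rewrite -(mulmxK uG (lsubmx Y)) lG0 mul0mx.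
  rewrite l0 mul0mx add0r in BE; exists (rsubmx Y) => //.
  by rewrite inE -BM [in X in _ == X]BE trmx_mul !mulmxA.
rewrite inE => /eqP XM ->; rewrite trmx_mul -XM !mulmxA; split=> //.
by rewrite -(mulmxA X) -mulmxA CA mulmx0.
Qed.

(** Fibring over the first [k] rows. The counts of frames and of isometries apply this and then
    count each fibre inside an orthogonal complement. *)
Lemma card_isoms_block k l N (M1 : 'M[F]_k) (M2 : 'M[F]_l) (S : 'M[F]_N) :
  S^T = S -> #|isoms (block_mx M1 0 0 M2) S| =
  (\sum_(A in isoms M1 S) #|[set B in isoms M2 S | (B *m S *m A^T)%R == 0%R]|)%N.
Proof.
move=> symS; have split A B : (col_mx A B \in isoms (block_mx M1 0 0 M2) S) =
    (A \in isoms M1 S) && ((B \in isoms M2 S) && (B *m S *m A^T == 0)).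
  rewrite !inE gram_col_mx; apply/eqP/and3P => [/eq_block_mx[-> _ -> ->]|].
    by rewrite !eqxx.
  case=> /eqP-> /eqP-> /eqP BA; rewrite BA.
  by rewrite (_ : A *m S *m B^T = 0) //; apply: trmx_inj; rewrite !trmx_mul trmxK symS mulmxA BA trmx0.
rewrite -sum1_card (partition_big usubmx (mem (isoms M1 S))) /=; last first.
  by move=> X; rewrite -{1}(vsubmxK X) split => /andP[].
apply: eq_bigr => A AM; rewrite -sum1_card.
rewrite (reindex_onto (fun B => col_mx A B) (@dsubmx F k l N)) /=; last first.
  by move=> X /andP[_ /eqP <-]; rewrite vsubmxK.
by apply: eq_bigl => B; rewrite col_mxKu col_mxKd !eqxx !andbT split AM [in RHS]inE.
Qed.

(** * Unit vectors and the number of orthonormal frames *)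

Lemma exists_anisotropic N (S : 'M[F]_N) : S^T = S -> S != 0 ->
  exists v, qf S v != 0.
Proof.
move=> symS S0; apply/existsP; apply: contraNT S0.
rewrite negb_exists => /forallP h; apply/eqP/matrixP => i j; rewrite [RHS]mxE.
have q0 v : qf S v = 0 by apply/eqP; move: (h v); rewrite negbK.
have bE : bf S (delta_mx 0 i) (delta_mx 0 j) = S i j.
  by rewrite /bf -rowE trmx_delta -colE !mxE.
have := q0 (delta_mx 0 i + delta_mx 0 j).
rewrite /qf !(bfDl, bfDr) -!/(qf S _) !q0 addr0 add0r (bfC (delta_mx 0 j) _ symS) bE.
rewrite -mulr2n -mulr_natl => /eqP.
by rewrite mulf_eq0 (negbTE (two_neq0 hq)) => /eqP.
Qed.

Lemma binary_represents_1 (a b : F) : a != 0 -> b != 0 ->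
  exists x y, a * x ^+ 2 + b * y ^+ 2 = 1.
Proof.
move=> a0 b0; have h2 := two_neq0 hq.
have [/is_sqrP[c ac]|na] := boolP (is_sqr a).
  have c0 : c != 0 by apply: contraNneq a0 => c0; rewrite -ac c0 expr0n.
  by exists c^-1, 0; rewrite -ac; field.
have [/is_sqrP[c bc]|nb] := boolP (is_sqr b).
  have c0 : c != 0 by apply: contraNneq b0 => c0; rewrite -bc c0 expr0n.
  by exists 0, c^-1; rewrite -bc; field.
have /is_sqrP[c abc] : is_sqr (a * b).
  by rewrite is_sqrM // (negbTE na) (negbTE nb).
have c0 : c != 0 by apply: contraNneq (mulf_neq0 a0 b0) => c0; rewrite -abc c0 expr0n.
have [i i2] := sqrtN1 hq.
(* With b = c^2 / a the form is ((a x)^2 + (c y)^2) / a, and (a x)^2 + (c y)^2 = a is solved by a x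
   = (a + 1) / 2 and c y = i (1 - a) / 2. *)
exists ((1 + a^-1) / 2), (a * (i * (a^-1 - 1)) / (2 * c)).
have -> : b = c ^+ 2 / a by rewrite abc mulrC mulKf.
rewrite !exprMn i2; field.
by rewrite c0 a0 h2.
Qed.

Lemma exists_unit_vector n (S : 'M[F]_n.+2) : S^T = S -> S \in unitmx ->
  exists v, v \in frames 1 S.
Proof.
move=> symS uS.
have unz m (M : 'M[F]_m.+1) : M \in unitmx -> M != 0.
  by move=> uM; apply: contraTneq uM => ->; rewrite unitmxE det0 unitr0.
have [v av] := exists_anisotropic symS (unz _ _ uS).
have uG : v *m S *m v^T \in unitmx.
  by rewrite unitmxE [_ *m _]mx11_scalar det_scalar1 unitfE.
have [C /= [_ E symS' uS' _]] := @orthogonal_split 1 n.+1 S v symS uS uG.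
have [w bw] := exists_anisotropic symS' (unz _ _ uS').
have [x [y xy]] := binary_represents_1 av bw.
move: E; rewrite gram_col_mx => /eq_block_mx[_ AC CA _].
have vw : bf S v (w *m C) = 0.
  by rewrite /bf trmx_mul mulmxA AC mul0mx mxE.
exists (x *: v + y *: (w *m C)); rewrite frames1E /qf !(bfDl, bfDr, bfZl, bfZr).
rewrite (bfC _ v symS) vw -xy -/(qf S v).
have -> : bf S (w *m C) (w *m C) = qf (C *m S *m C^T) w.
  by rewrite /qf /bf trmx_mul !mulmxA.
by apply/eqP; ring.
Qed.

(* Number of unit vectors in dimension [N > 0]; [b] tells whether the determinant
   is a square. *)
Definition nframe1 N (b : bool) : nat :=
  if odd N == b then (q ^ N.-1 + q ^ (N.-1)./2)%N else (q ^ N.-1 - q ^ (N.-1)./2)%N.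

(** The recursion of [card_frames1_step]. In dimension 0 the determinant is 1, so only [b = true]
    has a meaning there; the value [nframe1 0 false = 2] is spurious and breaks the recursion. *)
Lemma nframe1SS n b : ~~ ((n == 0%N) && ~~ b) ->
  nframe1 n.+2 b = (q * nframe1 n b + (q - 1) * q ^ n)%N.
Proof.
have q4 := card_field_gt4 hq.
rewrite /nframe1 /= negbK; case: n => [|n] /=.
  by case: b => //=; rewrite !expn0 !expn1; lia.
have h : (q ^ n./2 <= q ^ n)%N by rewrite leq_exp2l ?(ltnW (ltnW (ltnW q4))) //; lia.
move=> _; rewrite !expnS -(subnK h); move: (q ^ n - q ^ n./2)%N (q ^ n./2)%N => X Y.
by rewrite -(subnK q4); case: ifP => _; nia.
Qed.

Lemma qf_block n (S : 'M[F]_n) (x : F) (w : 'rV_n) :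
  qf (block_mx 1%:M 0 0 S : 'M[F]_(1 + n)) (row_mx x%:M w) = x ^+ 2 + qf S w.
Proof.
rewrite /qf /bf mul_row_block !mulmx0 addr0 add0r mulmx1 tr_row_mx mul_row_col mxE.
by rewrite tr_scalar_mx -scalar_mxM mxE eqxx expr2.
Qed.

(** For fixed [w] the first two coordinates lie on a circle of value [1 - qf S w]; it has [q - 1]
    points, and [q] more when [w] is itself a unit vector. *)
Lemma card_frames1_step n (S : 'M[F]_n) :
  #|frames 1 (block_mx 1%:M 0 0 (block_mx 1%:M 0 0 S) : 'M[F]_(1 + (1 + n)))| =
  (q * #|frames 1 S| + (q - 1) * q ^ n)%N.
Proof.
pose f (p : F * F * 'rV[F]_n) : 'rV[F]_(1 + (1 + n)) :=
  row_mx (p.1.1)%:M (row_mx (p.1.2)%:M p.2).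
pose g (v : 'rV[F]_(1 + (1 + n))) : F * F * 'rV[F]_n :=
  (lsubmx v 0 0, lsubmx (rsubmx v) 0 0, rsubmx (rsubmx v)).
have fK : cancel f g.
  by move=> [[x y] w]; rewrite /f /g /= !row_mxKl !row_mxKr row_mxKl !mxE.
have gK : cancel g f.
  by move=> v; rewrite /f /g /= -!mx11_scalar !hsubmxK.
transitivity #|[set p : F * F * 'rV[F]_n |
    p.1.1 ^+ 2 + p.1.2 ^+ 2 == 1 - qf S p.2]|.
  rewrite -(card_imset _ (can_inj fK)); apply: eq_card => v.
  apply/idP/imsetP => [|[p]].
    rewrite -{1}(gK v) frames1E /f !qf_block addrA => /eqP h.
    by exists (g v); [rewrite inE -h addrK|exact/esym/gK].
  by rewrite inE => /eqP h ->; rewrite frames1E !qf_block addrA h subrK.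
rewrite -sum1_card (eq_bigl (fun p : F * F * 'rV[F]_n =>
   xpredT p.1 && (p.1.1 ^+ 2 + p.1.2 ^+ 2 == 1 - qf S p.2))); last first.
  by move=> p; rewrite inE.
rewrite -(pair_big_dep xpredT (fun (z : F * F) w => z.1 ^+ 2 + z.2 ^+ 2 == 1 - qf S w)
  (fun _ _ => 1%N)) /= (exchange_big_dep xpredT) //=.
transitivity (\sum_(w : 'rV[F]_n) ((q - 1) + q * (w \in frames 1 S)))%N.
  apply: eq_bigr => w _; transitivity #|[set z : F * F | z.1 ^+ 2 + z.2 ^+ 2 == 1 - qf S w]|.
    by rewrite -sum1_card; apply: eq_bigl => z; rewrite inE.
  rewrite (card_circle hq) frames1E [_ == 1]eq_sym -[1 == _]subr_eq0.
  by have := card_field_gt4 hq; case: eqP => _; rewrite /=; lia.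
rewrite big_split /= sum_nat_const -big_distrr /= card_mx mul1n.
rewrite addnC [(_ * (q - 1))%N]mulnC; congr (_ * _ + _)%N.
by rewrite -sum1_card [RHS]big_mkcond /=; apply: eq_bigr => w _; case: (_ \in _).
Qed.

Lemma nframe1_gt0 N b : (1 < N)%N || (N == 1%N) && b -> (0 < nframe1 N b)%N.
Proof.
have q4 := card_field_gt4 hq.
case/orP=> [|/andP[/eqP-> ->]]; last by rewrite /nframe1 /= !expn0.
case: N => [|[|n]] // _; rewrite /nframe1 /=; case: ifP => _.
  by rewrite addn_gt0 expn_gt0 (ltn_trans _ q4).
by rewrite subn_gt0 ltn_exp2l ?(ltn_trans _ q4) // ltnS; lia.
Qed.

Lemma block_gram k N (T S : 'M[F]_N) :
  block_mx (1%:M : 'M[F]_k) 0 0 T *m block_mx 1%:M 0 0 S *m (block_mx 1%:M 0 0 T)^T =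
  block_mx 1%:M 0 0 (T *m S *m T^T).
Proof.
by rewrite tr_block_mx !mulmx_block !(mulmx0, mul0mx, mulmx1, addr0, add0r, trmx0, trmx1).
Qed.

(** Splitting off two unit vectors lowers the dimension by 2 and keeps the discriminant class, so
    the recursion applies. A second unit vector is missing only when a line of nonsquare value is
    left; the original plane then has an ellipse as its set of unit vectors. *)
Lemma card_frames1 N (S : 'M[F]_N) : S^T = S -> S \in unitmx ->
  #|frames 1 S| = nframe1 N (is_sqr (\det S)).
Proof.
elim/ltn_ind: N S => -[|[|n]] IH S symS uS.
- rewrite det_mx00 is_sqr1 /nframe1 /= subnn; apply/eqP; rewrite cards_eq0.
  apply/eqP/setP => v; rewrite !inE thinmx0 !mul0mx.
  by apply/eqP => /matrixP/(_ 0 0); rewrite !mxE => /eqP; rewrite eq_sym oner_eq0.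
- move: (uS); rewrite unitmxE det_mx11 unitfE; set s := S 0 0 => s0.
  transitivity #|[set x : F | x ^+ 2 == s^-1]|.
    have inj : injective (fun x : F => x%:M : 'M[F]_1).
      by move=> x y /matrixP/(_ 0 0); rewrite !mxE eqxx.
    rewrite -[RHS](card_imset _ inj); apply: eq_card => v; rewrite frames1E.
    have E x : qf S x%:M = x ^+ 2 * s.
      by rewrite /qf /bf tr_scalar_mx mul_scalar_mx mul_mx_scalar !mxE mulrCA mulrA mulrC.
    apply/eqP/imsetP => [|[x]].
      rewrite [v]mx11_scalar E => Ev; exists (v 0 0) => //.
      by rewrite inE -[X in _ == X]mul1r -Ev mulfK.
    by rewrite inE => /eqP xs ->; rewrite E xs mulVf.
  rewrite card_sqrt // invr_eq0 (negbTE s0).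
  have -> : s^-1 = s^-1 ^+ 2 * s by rewrite expr2 mulfVK.
  by rewrite is_sqrMl ?invr_eq0 // /nframe1 /=; case: is_sqr.
- have [v vS] := exists_unit_vector symS uS.
  have vE : v *m S *m v^T = 1%:M by apply/isomsP.
  have uG : v *m S *m v^T \in unitmx by rewrite vE unitmx1.
  have [C /= [uT E symS' uS' ->]] := @orthogonal_split 1 n.+1 S v symS uS uG.
  rewrite -(isoms_congr _ S uT) E vE det1 is_sqr1 {uT E uG vE vS v} eq_sym eqb_id.
  move: (C *m S *m C^T) symS' uS' => {symS uS C}S symS uS.
  have [v0|[v vS]] := set_0Vmem (frames 1 S).
    case: n IH S symS uS v0 => [|n] IH S symS uS v0; last first.
      by have [v] := exists_unit_vector symS uS; rewrite v0 inE.
    have := IH 1%N isT S symS uS; rewrite v0 cards0 det_mx11 /nframe1 /=.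
    rewrite !expn0 expn1 [true == _]eq_sym eqb_id.
    case: (boolP (is_sqr (S 0 0))) => //= nsq _.
    rewrite addn1 -(card_ellipse hq nsq).
    have fI : injective (fun z : F * F => row_mx z.1%:M z.2%:M : 'rV[F]_(1 + 1)).
      move=> [a b] [a' b'] /= /eq_row_mx[/matrixP/(_ 0 0) + /matrixP/(_ 0 0)].
      by rewrite !mxE eqxx /= !mulr1n => -> ->.
    rewrite -[RHS](card_imset _ fI); apply: eq_card => w.
    have E x : qf S x%:M = S 0 0 * x ^+ 2.
      by rewrite /qf /bf tr_scalar_mx mul_scalar_mx mul_mx_scalar !mxE mulrCA mulrA mulrC.
    rewrite frames1E; apply/eqP/imsetP => [|[z]].
      rewrite -(@hsubmxK _ 1 1 1 w); move: (lsubmx _) (rsubmx _) => a b.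
      rewrite [a]mx11_scalar [b]mx11_scalar qf_block E => Ew.
      by exists (a 0 0, b 0 0); rewrite // inE /= Ew.
    by rewrite inE => /eqP zz ->; rewrite qf_block E.
  have vE : v *m S *m v^T = 1%:M by apply/isomsP.
  have uG : v *m S *m v^T \in unitmx by rewrite vE unitmx1.
  have [C /= [uT E symS' uS' ->]] := @orthogonal_split 1 n S v symS uS uG.
  have uT' : block_mx (1%:M : 'M[F]_1) 0 0 (col_mx v C) \in unitmx.
    by rewrite unitmxE det_ublock det1 mul1r -unitmxE.
  rewrite /frames -(isoms_congr _ _ uT') (block_gram 1) E vE det1 is_sqr1 eq_sym eqb_id.
  have /= -> := card_frames1_step (C *m S *m C^T).
  rewrite IH //.
  rewrite nframe1SS //; apply/negP => /andP[/eqP n0].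
  subst n; by rewrite det_mx00 is_sqr1.
Qed.

(** The complement of a unit vector has the same discriminant class in one dimension less, so all
    fibres over the first vector have the same size. *)
Lemma card_frames k N (S : 'M[F]_N) : S^T = S -> S \in unitmx ->
  #|frames k S| = (\prod_(j < k) nframe1 (N - j) (is_sqr (\det S)))%N.
Proof.
elim: k N S => [|k IH] N S symS uS.
  rewrite big_ord0 -(cards1 (0 : 'M[F]_(0, N))); apply: eq_card => A.
  by rewrite [A]flatmx0 !inE eqxx; apply/eqP/matrixP => -[].
rewrite big_ord_recl subn0 -card_frames1 //.
have -> : frames k.+1 S = isoms (block_mx (1%:M : 'M[F]_1) 0 0 (1%:M : 'M[F]_k)) S.
  by rewrite -scalar_mx_block.
rewrite (card_isoms_block (1%:M : 'M[F]_1)) //.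
case: N S symS uS => [|n] S symS uS.
  rewrite card_frames1 // det_mx00 is_sqr1 /nframe1 subnn mul0n.
  rewrite big_pred0 // => A; apply/negbTE; rewrite inE thinmx0 !mul0mx.
  by apply/eqP => /matrixP/(_ 0 0); rewrite !mxE => /eqP; rewrite eq_sym oner_eq0.
rewrite -sum_nat_const; apply: eq_bigr => v vS.
have vE : v *m S *m v^T = 1%:M by apply/isomsP.
have uG : v *m S *m v^T \in unitmx by rewrite vE unitmx1.
have [C /= [uT E symS' uS' dS]] := @orthogonal_split 1 n S v symS uS uG.
move: E; rewrite (gram_col_mx S v C) => /eq_block_mx[_ _ CA _].
rewrite (card_isoms_orthogonal _ uG uT CA) -/(frames k _) IH // dS vE det1 is_sqr1.
by rewrite [true == _]eq_sym eqb_id; apply: eq_bigr => j _; congr (nframe1 _ _); rewrite /bump; lia.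
Qed.

Lemma frames_gt0 k N (S : 'M[F]_N) : S^T = S -> S \in unitmx ->
  (k < N)%N || (k == N) && is_sqr (\det S) -> (0 < #|frames k S|)%N.
Proof.
move=> symS uS kN; rewrite card_frames // prodn_cond_gt0 // => j _.
apply: nframe1_gt0; case/orP: kN => [kN|/andP[/eqP kN ->]].
  by apply/orP; left; have := ltn_ord j; lia.
by rewrite andbT; have := ltn_ord j; lia.
Qed.

(** One vector fewer than the dimension, so that frames exist for either discriminant class. An
    isometry is given by the image of such a frame and of a vector spanning its complement; the
    latter must solve x^2 = b / a, where the complements have values a and b in the same square
    class, and so has two choices. *)
Lemma card_isometry_group N n (S : 'M[F]_N) : N = (n + 1)%N ->
  S^T = S -> S \in unitmx -> #|isoms S S| = (2 * #|frames n S|)%N.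
Proof.
move=> En; subst N => symS uS.
have /card_gt0P[A0 A0S] : (0 < #|frames n S|)%N.
  by apply: frames_gt0 => //; apply/orP; left; lia.
have AE A : A \in frames n S -> A *m S *m A^T = 1%:M.
  by move/isomsP.
have uG A : A \in frames n S -> A *m S *m A^T \in unitmx.
  by move/AE->; rewrite unitmx1.
have [C0 /= [uT0 E0 symS0 uS0 dS0]] := orthogonal_split symS uS (uG _ A0S).
rewrite -(isoms_congl _ _ uT0) E0 AE // card_isoms_block // mulnC -sum_nat_const.
apply: eq_bigr => A AS.
have [C /= [uT E symS' uS' dS]] := orthogonal_split symS uS (uG _ AS).
move: E; rewrite (gram_col_mx S A C) => /eq_block_mx[_ _ CA _].
rewrite (card_isoms_orthogonal _ (uG _ AS) uT CA).
move: dS; rewrite dS0 !AE // det1 is_sqr1.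
move: (C *m S *m C^T) (C0 *m S *m C0^T) uS' uS0 => S1 S2.
rewrite !unitmxE !unitfE !det_mx11; set a := S1 0 0; set b := S2 0 0 => a0 b0 ab.
transitivity #|[set x : F | x ^+ 2 == b / a]|.
  have inj : injective (fun x : F => x%:M : 'M[F]_1).
    by move=> x y /matrixP/(_ 0 0); rewrite !mxE eqxx.
  rewrite -[RHS](card_imset _ inj); apply: eq_card => v; rewrite inE.
  have E x : (x%:M *m S1 *m (x%:M)^T == S2) = (x ^+ 2 == b / a).
    rewrite tr_scalar_mx mul_scalar_mx mul_mx_scalar scalerA -expr2.
    rewrite -(can2_eq (mulfK a0) (divfK a0)); apply/eqP/eqP => [/matrixP/(_ 0 0)|h].
      by rewrite mxE.
    by apply/matrixP => i j; rewrite mxE !ord1.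
  apply/idP/imsetP => [|[x]].
    by rewrite [v]mx11_scalar E => Ev; exists (v 0 0); rewrite ?inE.
  by rewrite inE => xs ->; rewrite E.
rewrite card_sqrt // mulf_eq0 invr_eq0 (negbTE a0) (negbTE b0) /=.
have -> : b / a = a^-1 ^+ 2 * (a * b) by field.
by rewrite is_sqrMl ?invr_eq0 // is_sqrM //; case: is_sqr ab; case: is_sqr.
Qed.

(** On row vectors this is v - 2 (v S A^T) A: for an orthonormal frame [A] it is -1 on the span of
    [A] and 1 on the orthogonal complement. *)
Definition invol k N (S : 'M[F]_N) (A : 'M[F]_(k, N)) : 'M[F]_N :=
  1%:M - (S *m A^T *m A) *+ 2.

Lemma mulmx_invol k N (S : 'M[F]_N) (A : 'M[F]_(k, N)) : A \in frames k S ->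
  A *m invol S A = - A.
Proof.
move=> /isomsP AS; rewrite mulmxBr mulmx1 mulr2n mulmxDr.
by rewrite !mulmxA AS mul1mx opprD addrA subrr add0r.
Qed.

Lemma mulmx_invol_orth k l N (S : 'M[F]_N) (A : 'M[F]_(k, N)) (C : 'M[F]_(l, N)) :
  C *m S *m A^T = 0 -> C *m invol S A = C.
Proof.
by move=> CA; rewrite mulmxBr mulmx1 mulr2n mulmxDr !mulmxA CA mul0mx addr0 subr0.
Qed.

Lemma invol_involutive k N (S : 'M[F]_N) (A : 'M[F]_(k, N)) :
  A \in frames k S -> invol S A *m invol S A = 1%:M.
Proof.
move=> AS; rewrite {1}/invol mulmxBl mul1mx mulr2n mulmxDl -!mulmxA mulmx_invol //.
by rewrite !mulmxN mulmxA -opprD opprK /invol mulr2n subrK.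
Qed.

Lemma invol_isom k N (S : 'M[F]_N) (A : 'M[F]_(k, N)) :
  S^T = S -> A \in frames k S -> invol S A \in isoms S S.
Proof.
move=> symS AS; apply/isomsP; rewrite -[RHS]mul1mx -(invol_involutive AS) -!mulmxA.
congr (_ *m _).
have -> : (invol S A)^T = 1%:M - (A^T *m A *m S + A^T *m A *m S).
  by rewrite /invol mulr2n [LHS]linearB [in LHS]linearD /= trmx1 !trmx_mul trmxK symS mulmxA.
by rewrite /invol mulr2n mulmxBr mulmxBl mulmx1 mul1mx mulmxDr mulmxDl !mulmxA.
Qed.

Lemma rank_frames k N (S : 'M[F]_N) (A : 'M[F]_(k, N)) : A \in frames k S -> \rank A = k.
Proof.
move=> /isomsP AS; apply/eqP; rewrite eqn_leq rank_leq_row.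
by rewrite -{1}(mxrank1 F k) -AS -mulmxA mxrankM_maxl.
Qed.

(** The rank of [1 - g] is the dimension of the (-1)-eigenspace, so [k] can be read off the
    involution and different frame sizes give different involutions. *)
Lemma rank_invol k N (S : 'M[F]_N) (A : 'M[F]_(k, N)) :
  A \in frames k S -> \rank (1%:M - invol S A) = k.
Proof.
move=> AS; rewrite /invol subKr -scaler_nat mxrank_scale_nz ?(two_neq0 hq) //.
apply/eqP; rewrite eqn_leq (leq_trans (mxrankM_maxr _ _)) ?rank_leq_row //=.
have : (\rank A <= \rank (S *m A^T *m A)%R)%N.
  have {1}-> : A = A *m (S *m A^T *m A) by rewrite !mulmxA (isomsP _ _ _ AS) mul1mx.
  exact: mxrankM_maxr.
by rewrite (rank_frames AS).
Qed.

(* Two orthonormal frames give the same involution exactly when they span the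
   same space, i.e. differ by an orthogonal matrix. *)
Lemma card_invol k N (S : 'M[F]_N) : S^T = S ->
  (#|[set invol S A | A in frames k S]| * #|isoms (1%:M : 'M[F]_k) (1%:M : 'M[F]_k)| = #|frames k S|)%N.
Proof.
move=> symS; rewrite -[RHS]sum1_card (partition_big_imset (invol S)) /= -sum_nat_const.
apply: eq_bigr => _ /imsetP[A AS ->].
rewrite sum1dep_card.
have freeA : row_free A by rewrite -row_leq_rank (rank_frames AS).
rewrite -(card_imset _ (row_free_inj freeA)); apply: eq_card => B.
apply/imsetP/idP => [[X /isomsP XX ->]|].
  rewrite mulmx1 in XX; rewrite !inE; apply/andP; split; apply/eqP.
    rewrite trmx_mul !mulmxA -(mulmxA X) -(mulmxA X) (isomsP _ _ _ AS) mulmx1 //.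
  rewrite /invol trmx_mul !mulmxA -(mulmxA _ X^T) (mulmx1C XX) mulmx1 //.
rewrite 2!inE => /andP[BS /eqP BA].
have PE : S *m B^T *m B = S *m A^T *m A.
  move: BA => /(congr1 (fun M => 1%:M - M)); rewrite /invol !subKr => /eqP.
  by rewrite -!scaler_nat (inj_eq (scalerI (two_neq0 hq))) => /eqP.
have BB : B *m S *m B^T = 1%:M by apply/isomsP; rewrite inE.
have BE : B = B *m S *m A^T *m A by rewrite -!mulmxA (mulmxA S) -PE !mulmxA BB mul1mx.
exists (B *m S *m A^T) => //; apply/isomsP.
by rewrite mulmx1 !trmx_mul trmxK symS !mulmxA -(mulmxA (B *m S *m A^T)) -!mulmxA (mulmxA A) (mulmxA A^T)
  (mulmxA S) !mulmxA -BE BB.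
Qed.

(** Since 2 is invertible, the image of [1 - g] is the (-1)-eigenspace. As an isometric involution
    [g] is self-adjoint for [S], which makes this eigenspace nondegenerate and its orthogonal
    complement pointwise fixed. *)
Lemma involution_split r s (S g : 'M[F]_(r + s)) :
  S^T = S -> S \in unitmx -> g \in isoms S S -> g *m g = 1%:M ->
  \rank (1%:M - g) = r ->
  exists (A : 'M[F]_(r, r + s)) (C : 'M[F]_(s, r + s)),
    [/\ A *m S *m A^T \in unitmx, col_mx A C \in unitmx, C *m S *m A^T = 0,
        A *m g = - A & C *m g = C].
Proof.
move=> symS uS /isomsP gS gg; set K := 1%:M - g => rK.
have h2 := two_neq0 hq.
have gSt : g *m S = S *m g^T.
  by rewrite -[LHS]mulmx1 -trmx1 -gg trmx_mul !mulmxA gS.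
have KS : K *m S = S *m K^T by rewrite mulmxBl mul1mx gSt linearB /= trmx1 mulmxBr mulmx1.
have [A [freeA AK]] : exists A : 'M[F]_(r, r + s), row_free A /\ (A :=: K)%MS.
  have gen t (M : 'M[F]_(r + s)) : \rank M = t ->
      exists A : 'M[F]_(t, r + s), row_free A /\ (A :=: M)%MS.
    by move=> <-; exists (row_base M); split; [exact: row_base_free|exact: eq_row_base].
  exact: gen.
have /submxP[X XK] : (A <= K)%MS by rewrite AK.
have /submxP[Y YA] : (K <= A)%MS by rewrite AK.
have Ag : A *m g = - A.
  by rewrite XK -mulmxA mulmxBl mul1mx gg -opprB mulmxN.
have AK2 : A *m K = A *+ 2 by rewrite mulmxBr mulmx1 Ag opprK mulr2n.
have uG : A *m S *m A^T \in unitmx.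
  rewrite -row_free_unit; apply/inj_row_free => v vG.
  have : v *m A *m S *m K^T = 0.
    have vG' : v *m A *m S *m A^T = 0 by rewrite -vG !mulmxA.
    by rewrite YA trmx_mul mulmxA vG' mul0mx.
  rewrite -mulmxA -KS !mulmxA -(mulmxA v) AK2 -scaler_nat -scalemxAr -scalemxAl.
  move/eqP; rewrite scaler_eq0 (negbTE h2) /= => /eqP vAS.
  apply: (row_free_inj freeA); rewrite /= mul0mx.
  by rewrite -(mulmxK uS (v *m A)) vAS mul0mx.
have [C [uT CA _]] := orthogonal_complement symS uG.
exists A, C; split=> //; apply/eqP; rewrite eq_sym -subr_eq0.
have -> : C - C *m g = C *m Y *m A by rewrite -mulmxA -YA mulmxBr mulmx1.
have CK : C *m Y *m A *m S *m A^T = 0.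
  rewrite -(mulmxA C) -YA -(mulmxA C) KS !mulmxA -mulmxA -trmx_mul AK2.
  by rewrite mulr2n linearD /= mulmxDr CA addr0.
rewrite (_ : C *m Y = 0) ?mul0mx //.
by rewrite -(mulmxK uG (C *m Y)) !mulmxA CK mul0mx.
Qed.

Lemma block_scalar_eigen r s (g : 'M[F]_(r + s)) A C :
  A *m g = - A -> C *m g = C ->
  col_mx A C *m g = block_mx (- 1%:M) 0 0 1%:M *m (col_mx A C : 'M[F]_(r + s)).
Proof.
by move=> Ag Cg; rewrite mul_col_mx mul_block_col !mul0mx addr0 add0r mulNmx !mul1mx Ag Cg.
Qed.

Lemma det_involution N (S g : 'M[F]_N) :
  S^T = S -> S \in unitmx -> g \in isoms S S -> g *m g = 1%:M ->
  \det g = (-1) ^+ \rank (1%:M - g).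
Proof.
move=> symS uS gS gg; have [s Es] : exists s, N = (\rank (1%:M - g)%R + s)%N.
  by exists (N - \rank (1%:M - g)%R)%N; rewrite subnKC // rank_leq_row.
move: (erefl (\rank (1%:M - g))); move: {1 3}(\rank _) Es => r Es; subst N => rK.
have [A [C [_ uT _ Ag Cg]]] := involution_split symS uS gS gg rK.
have := congr1 determinant (block_scalar_eigen Ag Cg).
rewrite !det_mulmx mulrC => /mulIf -> //; last by rewrite -unitfE -unitmxE.
by rewrite det_ublock det1 mulr1 -(scaleN1r (1%:M : 'M[F]_r)) detZ det1 mulr1 rK.
Qed.

Lemma involution_of_frame r s (S g : 'M[F]_(r + s)) A C :
  S^T = S -> A *m S *m A^T \in unitmx -> col_mx A C \in unitmx ->
  C *m S *m A^T = 0 -> A *m g = - A -> C *m g = C ->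
  is_sqr (\det (A *m S *m A^T)) ->
  exists2 B, B \in frames r S & g = invol S B.
Proof.
move=> symS uG uT CA Ag Cg sqG.
(* A space of square discriminant has an orthonormal basis: the case [k = N] of [frames_gt0]. [X]
   gives its coordinates with respect to [A]. *)
have /card_gt0P[X /isomsP XG] : (0 < #|frames r (A *m S *m A^T)|)%N.
  by apply: frames_gt0; rewrite ?sym_gram // sqG eqxx orbT.
exists (X *m A); first by apply/isomsP; rewrite trmx_mul !mulmxA in XG *.
apply: (can_inj (mulKmx uT)); rewrite (block_scalar_eigen Ag Cg).
apply/esym/block_scalar_eigen; last first.
  by apply: mulmx_invol_orth; rewrite trmx_mul mulmxA CA mul0mx.
rewrite mulmxBr mulmx1 mulr2n mulmxDr trmx_mul !mulmxA -(mulmxA _ X).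
have -> : A *m S *m A^T *m X^T *m (X *m A) = A.
  by rewrite mulmxA (mulmx1C (etrans (mulmxA _ _ _) XG)) mul1mx.
by rewrite opprD addrA subrr add0r.
Qed.

(** * The sign of an isometry on the unit vectors *)

Lemma odd_perm_involution (T : finType) (s : {perm T}) : (s * s = 1)%g ->
  odd_perm s = odd (#|[set x | s x != x]|./2).
Proof.
move: {2}_.+1 (ltnSn #|[set x | s x != x]|) => n.
elim: n s => // n IH s sn ss.
have sK x : s (s x) = x by rewrite -permM ss perm1.
have [e|[x]] := set_0Vmem [set x | s x != x].
  rewrite e cards0 (_ : s = 1%g) ?odd_perm1 //; apply/permP => x; rewrite perm1.
  by apply/eqP; rewrite -[_ == _]negbK; move/setP/(_ x): e; rewrite !inE => ->.
rewrite inE => sx.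
pose t := (s * tperm x (s x))%g.
have tE z : t z = if (z == x) || (z == s x) then z else s z.
  rewrite permM; case: eqVneq => [->|zx] /=; first by rewrite tpermR.
  case: eqVneq => [->|zy]; first by rewrite sK tpermL.
  rewrite tpermD // eq_sym; first by rewrite (can2_eq sK sK).
  by rewrite (inj_eq perm_inj).
have mE : [set z | s z != z] = x |: (s x |: [set z | t z != z]).
  apply/setP => z; rewrite !inE tE.
  have [->|zx] := eqVneq z x; first by rewrite sx.
  by have [->|zy] /= := eqVneq z (s x); first by rewrite sK eq_sym sx.
have cE : #|[set z | s z != z]| = #|[set z | t z != z]|.+2.
  rewrite mE !cardsU1 !inE !tE !eqxx orbT /= eqxx orbF.
  by rewrite eq_sym sx.
have tt : (t * t = 1)%g.
  apply/permP => z; rewrite permM perm1 [t z]tE.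
  case: ifP => [h|]; first by rewrite tE h.
  by move/norP=> [zx zy]; rewrite tE (can2_eq sK sK) (inj_eq perm_inj) (negbTE zx) (negbTE zy) /= sK.
have -> : s = (t * tperm x (s x))%g by rewrite -mulgA tperm2 mulg1.
rewrite odd_permM odd_tperm eq_sym sx addbT IH //; last by lia.
by rewrite -/t {1}/t -mulgA tperm2 mulg1 cE /= .
Qed.

(** The default 1 of [insubd] only makes the definition total; it is never taken for an isometry of
    a nondegenerate [S], see [sphere_permE]. Vectors that are not unit vectors are fixed. *)
Definition sphere_perm N (S g : 'M[F]_N) : {perm 'rV[F]_N} :=
  insubd (1%g : {perm _}) [ffun v => if v \in frames 1 S then v *m g else v].

Lemma isom_unit N (S g : 'M[F]_N) : S \in unitmx -> g \in isoms S S -> g \in unitmx.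
Proof.
move=> uS /isomsP gS; have := uS; rewrite -gS !unitmxE !det_mulmx !unitrM.
by case/andP => /andP[].
Qed.

Lemma isoms_comp k l N (M : 'M[F]_k) (S : 'M[F]_l) (R : 'M[F]_N) A B :
  A \in isoms M S -> B \in isoms S R -> A *m B \in isoms M R.
Proof.
move=> /isomsP AS /isomsP BR; apply/isomsP.
by rewrite -AS -BR trmx_mul !mulmxA.
Qed.

Lemma sphere_permE N (S g : 'M[F]_N) v : S \in unitmx -> g \in isoms S S ->
  sphere_perm S g v = if v \in frames 1 S then v *m g else v.
Proof.
move=> uS gS; have ug := isom_unit uS gS.
rewrite -pvalE /sphere_perm /= val_insubd.
have inv w : (w *m g \in frames 1 S) = (w \in frames 1 S).
  by rewrite !inE trmx_mul !mulmxA -(mulmxA w) -(mulmxA w) (isomsP _ _ _ gS).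
case: ifP => [_|/injectivePn]; first by rewrite ffunE.
case=> x [y]; rewrite !ffunE => /eqP xy.
case: ifP => x1; case: ifP => y1 // E; first by rewrite (can_inj (mulmxK ug) E) in xy.
- by rewrite -E inv x1 in y1.
- by rewrite E inv y1 in x1.
Qed.

(* Plays the role of the spinor norm. *)
Definition sphere_sign N (S g : 'M[F]_N) : bool := sphere_perm S g.

Lemma sphere_signM N (S g h : 'M[F]_N) : S \in unitmx ->
  g \in isoms S S -> h \in isoms S S ->
  sphere_sign S (g *m h) = sphere_sign S g (+) sphere_sign S h.
Proof.
move=> uS gS hS; rewrite /sphere_sign -odd_permM; congr odd_perm.
apply/permP => v; rewrite permM !sphere_permE ?(isoms_comp gS) //.
case: ifP => v1; last by rewrite v1.
by rewrite (isoms_comp v1 gS) mulmxA.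
Qed.

(** Powers of [q] are 1 mod 4, so a sum of two is 2 mod 4 and a difference is 0 mod 4. *)
Lemma nframe1_mod4 N b : exists k, nframe1 N b = (4 * k + 2 * (odd N == b))%N.
Proof.
have qk k : exists m, (q ^ k = 4 * m + 1)%N.
  exists (q ^ k %/ 4)%N; rewrite mulnC {1}(divn_eq (q ^ k) 4); congr (_ + _)%N.
  by rewrite -modnXm hq exp1n.
have le k : (q ^ k./2 <= q ^ k)%N.
  by rewrite leq_exp2l ?(ltn_trans _ (card_field_gt4 hq)) //; lia.
rewrite /nframe1; have := le N.-1.
have [k ->] := qk N.-1; have [l ->] := qk (N.-1)./2.
by case: ifP => _ kl; [exists (k + l)%N|exists (k - l)%N]; lia.
Qed.

(** The unit vectors moved by [g] are those outside the span of [C]. The sign is the parity of half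
    their number, a difference of two sphere sizes that are known mod 4. *)
Lemma sphere_sign_involution r s (S g : 'M[F]_(r + s)) A C :
  S^T = S -> S \in unitmx -> g \in isoms S S -> g *m g = 1%:M ->
  A *m S *m A^T \in unitmx -> col_mx A C \in unitmx ->
  C *m S *m A^T = 0 -> A *m g = - A -> C *m g = C ->
  sphere_sign S g = (odd (r + s) == is_sqr (\det S)) (+)
                    (odd s == is_sqr (\det (C *m S *m C^T))).
Proof.
move=> symS uS gS gg uG uT CA Ag Cg; have h2 := two_neq0 hq.
have symS' := sym_gram C symS.
have uS' : C *m S *m C^T \in unitmx.
  have := uS; rewrite -(gram_unit _ uT) gram_col_mx CA !unitmxE det_ublock !unitfE mulf_eq0.
  by rewrite negb_or => /andP[].
have fixE v : (v *m g == v) = (v *m S *m A^T == 0).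
  apply/eqP/eqP => [vg|vA].
    have : v *m S *m A^T *+ 2 = 0.
      apply/eqP; rewrite mulr2n addr_eq0; apply/eqP.
      rewrite -[in RHS]vg -[in LHS](isomsP _ _ _ gS).
      rewrite -{1}vg !mulmxA -(mulmxA v g g) gg mulmx1.
      by rewrite -mulmxA -trmx_mul Ag linearN mulmxN vg.
    by move/eqP; rewrite -scaler_nat scaler_eq0 (negbTE h2) => /eqP.
  pose Y := v *m invmx (col_mx A C).
  have vE : v = lsubmx Y *m A + rsubmx Y *m C.
    by rewrite -mul_row_col hsubmxK mulmxKV.
  have l0 : lsubmx Y = 0.
    move: vA; rewrite vE !mulmxDl -(mulmxA _ C) -(mulmxA _ (C *m S)) CA mulmx0 addr0.
    rewrite -!mulmxA (mulmxA A) => lG0.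
    by rewrite -(mulmxK uG (lsubmx Y)) lG0 mul0mx.
  by rewrite vE l0 mul0mx add0r -mulmxA Cg.
rewrite /sphere_sign odd_perm_involution; last first.
  apply/permP => v; rewrite permM perm1 !sphere_permE //.
  case v1: (v \in frames 1 S); rewrite ?v1 //.
  by rewrite (isoms_comp v1 gS) -mulmxA gg mulmx1.
have -> : [set v | sphere_perm S g v != v] =
    frames 1 S :\: [set v in frames 1 S | v *m S *m A^T == 0].
  apply/setP => v; rewrite finset.in_set sphere_permE // finset.in_setD finset.in_set.
  by case: (v \in frames 1 S); rewrite /= ?fixE ?eqxx ?andbT ?andbF.
rewrite cardsD (finset.setIidPr _); last by apply/fintype.subsetP => v; rewrite inE => /andP[].
rewrite (card_isoms_orthogonal _ uG uT CA).
have : (#|isoms (1%:M : 'M[F]_1) (C *m S *m C^T)| <= #|frames 1 S|)%N.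
  rewrite -(card_isoms_orthogonal _ uG uT CA).
  by apply: subset_leq_card; apply/fintype.subsetP => v; rewrite inE => /andP[].
rewrite -/(frames 1 _) !card_frames1 //.
have [k ->] := nframe1_mod4 (r + s) (is_sqr (\det S)).
have [l ->] := nframe1_mod4 s (is_sqr (\det (C *m S *m C^T))).
case: (_ == _); case: (_ == _); rewrite /= ?muln1 ?muln0 => kl.
- by rewrite (_ : (_ - _)./2 = (2 * (k - l))%N) ?oddM //; lia.
- by rewrite (_ : (_ - _)./2 = (2 * (k - l - 1)).+1) /= ?oddM //; lia.
- by rewrite (_ : (_ - _)./2 = (2 * (k - l)).+1) /= ?oddM //; lia.
- by rewrite (_ : (_ - _)./2 = (2 * (k - l))%N) ?oddM //; lia.
Qed.

(** * Commutators in the special orthogonal group *)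

Definition glue r s (T : 'M[F]_(r + s)) (J : 'M[F]_r) (D : 'M[F]_s) : 'M[F]_(r + s) :=
  invmx T *m block_mx J 0 0 D *m T.

Lemma glue_isom r s (S T : 'M[F]_(r + s)) (G : 'M[F]_r) (S' : 'M[F]_s) J D :
  T \in unitmx -> T *m S *m T^T = block_mx G 0 0 S' ->
  J \in isoms G G -> D \in isoms S' S' -> glue T J D \in isoms S S.
Proof.
move=> uT E /isomsP JG /isomsP DS; apply: (isoms_comp (S := block_mx G 0 0 S')); last exact/isomsP.
apply: (isoms_comp (S := block_mx G 0 0 S')); apply/isomsP.
  rewrite -E !mulmxA mulVmx // mul1mx -mulmxA -trmx_mul mulVmx //.
  by rewrite trmx1 mulmx1.
by rewrite tr_block_mx !mulmx_block !trmx0 !(mulmx0, mul0mx, addr0, add0r) JG DS.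
Qed.

Lemma glue_mul r s (T : 'M[F]_(r + s)) J D J' D' : T \in unitmx ->
  glue T J D *m glue T J' D' = glue T (J *m J') (D *m D').
Proof.
move=> uT; rewrite /glue -!mulmxA mulKVmx // !mulmxA.
by rewrite -(mulmxA (invmx T) (block_mx J 0 0 D)) mulmx_block !(mulmx0, mul0mx, addr0, add0r).
Qed.

Lemma det_glue r s (T : 'M[F]_(r + s)) J D : T \in unitmx ->
  \det (glue T J D) = \det J * \det D.
Proof.
move=> uT; rewrite !det_mulmx det_inv mulrAC mulVf ?mul1r ?det_ublock //.
by rewrite -unitfE -unitmxE.
Qed.

Lemma mulmx_glue r s (T : 'M[F]_(r + s)) J D : T \in unitmx ->
  T *m glue T J D = block_mx J 0 0 D *m T.
Proof. by move=> uT; rewrite /glue -mulmxA mulKVmx. Qed.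

Lemma frames_split k l N (S : 'M[F]_N) (B : 'M[F]_(k, N)) (A : 'M[F]_(l, N)) :
  col_mx B A \in frames (k + l) S ->
  [/\ B \in frames k S, A \in frames l S & B *m S *m A^T = 0].
Proof.
move=> /isomsP; rewrite gram_col_mx scalar_mx_block => /eq_block_mx[BB BA _ AA].
by split=> //; apply/isomsP.
Qed.

Lemma invol_col_mx k l N (S : 'M[F]_N) (B : 'M[F]_(k, N)) (A : 'M[F]_(l, N)) :
  B *m S *m A^T = 0 -> invol S (col_mx B A) = invol S B *m invol S A.
Proof.
move=> BA; have E : invol S B *m S *m A^T = S *m A^T.
  rewrite /invol mulr2n !mulmxBl !mulmxDl mul1mx -!mulmxA !(mulmxA B) BA.
  by rewrite !mulmx0 addr0 subr0.
rewrite [invol S A]/invol mulr2n mulmxBr mulmx1 mulmxDr !mulmxA E.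
rewrite /invol !mulr2n tr_col_mx mul_mx_row mul_row_col -[RHS]addrA -opprD; congr (_ - _).
by rewrite addrACA.
Qed.

(** Allows a commutator to be recognised by comparing the two products, without computing inverses
    of matrices. *)
Lemma der1_swap (gT : finGroupType) (G : {group gT}) (x y : gT) :
  x \in G -> y \in G -> exists2 z, z \in G^`(1)%g & (z * (y * x) = x * y)%g.
Proof.
move=> xG yG; exists [~ x^-1, y^-1]%g; first by rewrite derg1 mem_commg ?groupV.
by rewrite commgEl conjgE !invgK !mulgA !mulgKV.
Qed.

Section Group.
Variables (n : nat) (S : 'M[F]_n.+1) (Q : 'rV[F]_n.+1 -> F).
Hypothesis symS : S^T = S.
Hypothesis uS : S \in unitmx.
Hypothesis QS : forall v, Q v = qf S v.

(** If [g] preserves the quadratic form, the difference of the Gram matrices is symmetric and has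
    zero quadratic form, hence is zero by polarization. *)
Lemma mem_O_set (g : {'GL_n.+1[F]}) : (g \in O_set Q) = (GLval g \in isoms S S).
Proof.
have qfM (h : 'M[F]_n.+1) v : qf S (v *m h) = qf (h *m S *m h^T) v.
  by rewrite /qf /bf trmx_mul !mulmxA.
rewrite inE; apply/forallP/isomsP => [h|h v]; last by rewrite !QS qfM h.
apply/eqP; rewrite -subr_eq0; apply/negPn/negP => /exists_anisotropic[|v].
  by rewrite linearB /= sym_gram // symS.
move: (h v); rewrite !QS qfM => /eqP E.
by rewrite /qf /bf mulmxBr mulmxBl mxE [X in _ + X]mxE -/(bf _ _ _) -/(qf _ _) E subrr eqxx.
Qed.

Lemma isoms_GL M : M \in isoms S S -> exists2 g, g \in O_set Q & GLval g = M.
Proof.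
move=> MS; have uM := isom_unit uS MS.
by exists (FinRing.Unit uM : {'GL_n.+1[F]}); rewrite ?mem_O_set.
Qed.

Lemma GLval_inj : injective (@GLval n.+1 F).
Proof. exact: val_inj. Qed.

Lemma card_O_set : #|O_set Q| = #|isoms S S|.
Proof.
rewrite -(card_imset _ GLval_inj); apply: eq_card => M.
apply/imsetP/idP => [[g + ->]|/isoms_GL[g gO <-]]; first by rewrite mem_O_set.
by exists g.
Qed.

Lemma mem_SO_set (g : {'GL_n.+1[F]}) :
  (g \in SO_set Q) = (GLval g \in isoms S S) && (\det (GLval g) == 1).
Proof. by rewrite inE mem_O_set. Qed.

Definition spin_sign (g : {'GL_n.+1[F]}) := sphere_sign S (GLval g).

Lemma spin_signM : {in SO_set Q &, forall g h,
  spin_sign (g * h)%g = spin_sign g (+) spin_sign h}.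
Proof.
move=> g h; rewrite !mem_SO_set => /andP[gS _] /andP[hS _].
by rewrite /spin_sign GL_MxE sphere_signM.
Qed.

Lemma spin_signV : {in SO_set Q, forall g, spin_sign g^-1%g = spin_sign g}.
Proof.
move=> g gS; have : spin_sign (1 : {'GL_n.+1[F]})%g = false.
  by have := spin_signM (group1 _) (group1 _); rewrite mulg1 addbb.
by rewrite -(mulgV g) spin_signM ?groupV //; do 2!case: spin_sign.
Qed.

Definition spin_kernel := [set g in SO_set Q | ~~ spin_sign g].

Lemma spin_kernel_group_set : group_set spin_kernel.
Proof.
apply/group_setP; split.
  apply/setIdP; split; first exact: group1.
  by have := spin_signM (group1 _) (group1 _); rewrite mulg1 addbb => ->.
move=> g h /setIdP[gS gs] /setIdP[hS hs]; apply/setIdP; split; first exact: groupM.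
by rewrite spin_signM // (negbTE gs).
Qed.
Canonical spin_kernel_group := Group spin_kernel_group_set.

Lemma der_sub_spin_kernel : (SO_set Q)^`(1)%g \subset spin_kernel.
Proof.
rewrite derg1 gen_subG; apply/fintype.subsetP => _ /imset2P[x y xS yS ->].
apply/setIdP; split; first exact: groupR.
rewrite commgEl conjgE !spin_signM ?groupM ?groupV // !spin_signV //.
by do 2!case: spin_sign.
Qed.

Lemma SO_commutator (J1 J2 D : 'M[F]_n.+1) : J1 \in isoms S S -> J2 \in isoms S S ->
  \det J1 = 1 -> \det J2 = 1 -> J1 *m J2 = D *m (J2 *m J1) ->
  exists2 g, g \in (SO_set Q)^`(1)%g & GLval g = D.
Proof.
move=> /isoms_GL[x xO xE] /isoms_GL[y yO yE] d1 d2 E.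
have xS : x \in SO_set Q by rewrite mem_SO_set -mem_O_set xO xE d1 eqxx.
have yS : y \in SO_set Q by rewrite mem_SO_set -mem_O_set yO yE d2 eqxx.
have [z zD zE] := der1_swap xS yS; exists z => //.
have u : GLval (y * x)%g \in unitmx := GL_unitmx _.
by apply: (can_inj (mulmxK u)); rewrite -GL_MxE zE !GL_MxE xE yE E.
Qed.

End Group.

Lemma reflection_exists s (S : 'M[F]_s.+1) : S^T = S -> S \in unitmx ->
  exists2 D, D \in isoms S S & \det D = -1.
Proof.
move=> symS uS; have S0 : S != 0 by apply: contraTneq uS => ->; rewrite unitmxE det0 unitr0.
have [c c0] := exists_anisotropic symS S0.
have uG : c *m S *m c^T \in unitmx by rewrite unitmxE [_ *m _]mx11_scalar det_scalar1 unitfE.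
have [C /= [uT E _ _ _]] := @orthogonal_split 1 s S c symS uS uG.
exists (glue (col_mx c C) (- 1%:M) 1%:M).
  apply: (glue_isom uT E); apply/isomsP; last by rewrite trmx1 mulmx1 mul1mx.
  by rewrite linearN /= trmx1 mulmxN mulmx1 mulNmx mul1mx opprK.
by rewrite (@det_glue 1 s) // det1 mulr1 det_mx11 !mxE eqxx.
Qed.

Let J1 : 'M[F]_(1 + 1) := block_mx 1%:M 0 0 (- 1%:M).
Let J2 : 'M[F]_(1 + 1) := block_mx 0 1%:M 1%:M 0.

(** Two anticommuting reflections of an orthonormal plane, diag(1, -1) and the swap of coordinates.
    Their commutator is -1 and their product squares to -1; the former serves dimension at least 3,
    the latter dimension 2. *)
Lemma plane_reflections : [/\ J1 \in isoms 1%:M 1%:M, J2 \in isoms 1%:M 1%:M,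
  \det J1 = -1, \det J2 = -1 & [/\ J1 *m J1 = 1%:M, J2 *m J2 = 1%:M & J1 *m J2 = - (J2 *m J1)]].
Proof.
have e1 : \det (- 1%:M : 'M[F]_1) = -1 by rewrite det_mx11 !mxE eqxx.
have J2J2 : J2 *m J2 = 1%:M.
  by rewrite mulmx_block !(mulmx0, mul0mx, addr0, add0r, mulmx1) -scalar_mx_block.
have dJ1 : \det J1 = -1 by rewrite det_ublock det1 mul1r e1.
have J1J1 : J1 *m J1 = 1%:M.
  by rewrite mulmx_block !(mulmx0, mul0mx, addr0, add0r, mulmx1) mulmxN mulmx1 opprK -scalar_mx_block.
split=> //.
- by apply/isomsP; rewrite mulmx1 tr_block_mx !trmx0 linearN /= trmx1 -/J1 J1J1.
- by apply/isomsP; rewrite mulmx1 tr_block_mx !trmx0 trmx1 -/J2 J2J2.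
(* The swap as a product of shears and [J1]: the diagonal blocks of [J2] vanish, so the
   block-triangular determinant formulas do not apply to it directly. *)
- have -> : J2 = block_mx 1%:M (- 1%:M) 0 1%:M *m block_mx 1%:M 0 1%:M 1%:M
      *m J1 *m block_mx 1%:M 1%:M 0 1%:M.
    by rewrite /J1 /J2; do 3!rewrite mulmx_block
      !(mulmx0, mul0mx, addr0, add0r, mulmx1, mul1mx, mulmxN, mulNmx, opprK, subrr).
  by rewrite !det_mulmx dJ1 !det_ublock det_lblock !det1 !mulr1 mul1r.
split=> //.
rewrite !mulmx_block !(mulmx0, mul0mx, addr0, add0r, mulmx1, mul1mx, mulmxN, mulNmx).
by rewrite opp_block_mx !oppr0 opprK.
Qed.

(** -1 is the commutator of the two plane reflections. These have determinant -1, so both are glued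
    to the same reflection [D] of the orthogonal complement, which is nonzero in dimension at least
    3; [D] cancels in the commutator. *)
Lemma invol_plane_der s (S : 'M[F]_s.+3) Q (B : 'M[F]_(2, s.+3)) :
  S^T = S -> S \in unitmx -> (forall v, Q v = qf S v) -> B \in frames 2 S ->
  exists2 g, g \in (SO_set Q)^`(1)%g & GLval g = invol S B.
Proof.
move=> symS uS QS BS; have [J1S J2S d1 d2 [_ _ J12]] := plane_reflections.
have BE := isomsP _ _ _ BS.
have uG : B *m S *m B^T \in unitmx by rewrite BE unitmx1.
have [C /= [uT E symS' uS' _]] := @orthogonal_split 2 s.+1 S B symS uS uG.
have [D DS dD] := reflection_exists symS' uS'.
have E' := E; rewrite BE in E'.
apply: (SO_commutator symS uS QS (glue_isom uT E' J1S DS) (glue_isom uT E' J2S DS)).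
- by rewrite (@det_glue 2 s.+1) // d1 dD mulrNN mulr1.
- by rewrite (@det_glue 2 s.+1) // d2 dD mulrNN mulr1.
rewrite !(@glue_mul 2 s.+1) // J12; move: (J2 *m J1) => J; apply: (can_inj (mulKmx uT)).
rewrite [RHS]mulmxA [_ *m invol _ _](_ : _ = block_mx (- 1%:M) 0 0 1%:M *m col_mx B C).
  rewrite -[RHS]mulmxA !(@mulmx_glue 2 s.+1) // [RHS]mulmxA mulmx_block.
  by rewrite !(mulmx0, mul0mx, addr0, add0r, mul1mx, mulNmx).
apply: block_scalar_eigen; first exact: mulmx_invol.
apply: mulmx_invol_orth.
by move: E; rewrite (gram_col_mx S B C) => /eq_block_mx[_ _ -> _].
Qed.

Lemma invol_even_der s (S : 'M[F]_s.+3) Q k (A : 'M[F]_(k.*2, s.+3)) :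
  S^T = S -> S \in unitmx -> (forall v, Q v = qf S v) -> A \in frames k.*2 S ->
  exists2 g, g \in (SO_set Q)^`(1)%g & GLval g = invol S A.
Proof.
move=> symS uS QS; elim: k A => [|k IH] A.
  move=> _; exists 1%g; first exact: group1.
  by rewrite GL_1E [A]flatmx0 /invol mulmx0 mul0rn subr0.
rewrite -[A](@vsubmxK _ 2 k.*2) => /(@frames_split 2 k.*2)[BS AS BA].
have [g gS gE] := invol_plane_der symS uS QS BS.
have [h hS hE] := IH _ AS.
exists (g * h)%g; first exact: groupM.
by rewrite GL_MxE gE hE (@invol_col_mx 2 k.*2).
Qed.

Lemma isoms_inv N (M S A : 'M[F]_N) : A \in unitmx -> A \in isoms M S ->
  invmx A \in isoms S M.
Proof.
move=> uA /isomsP <-; apply/isomsP; rewrite !mulmxA mulVmx // mul1mx -mulmxA -trmx_mul.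
by rewrite mulVmx // trmx1 mulmx1.
Qed.

(** For even [r] the two parities in [sphere_sign_involution] agree, so a trivial sign says that the
    whole space and the fixed space have the same discriminant class. The eigenspace then has square
    discriminant, hence an orthonormal basis. *)
Lemma even_involution_frame N r s (S g : 'M[F]_N) : N = (r + s)%N ->
  S^T = S -> S \in unitmx -> g \in isoms S S -> g *m g = 1%:M ->
  \rank (1%:M - g) = r -> ~~ odd r -> ~~ sphere_sign S g ->
  exists2 A, A \in frames r S & g = invol S A.
Proof.
move=> EN; subst N => symS uS gS gg rg even_r sg.
have [A [C [uG uT CA Ag Cg]]] := involution_split symS uS gS gg rg.
apply: (involution_of_frame symS uG uT CA Ag Cg).
move: sg; rewrite (sphere_sign_involution symS uS gS gg uG uT CA Ag Cg).
rewrite oddD (negbTE even_r) /= -(is_sqr_gram S uT) gram_col_mx CA det_ublock.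
rewrite is_sqrM //; last first.
- have := uS; rewrite -(gram_unit _ uT) gram_col_mx CA unitmxE det_ublock unitfE mulf_eq0.
  by rewrite negb_or => /andP[].
- by rewrite -unitfE -unitmxE.
by case: is_sqr; case: is_sqr; case: odd.
Qed.

(** * Involutions of [Omega], dimension by dimension *)

Lemma invol_rank0 N (g : 'M[F]_N) : \rank (1%:M - g) = 0%N -> g = 1%:M.
Proof. by move/eqP; rewrite mxrank_eq0 subr_eq0 => /eqP. Qed.

Lemma frames0 N (S : 'M[F]_N) : (0 : 'M[F]_(0, N)) \in frames 0 S.
Proof. by apply/isomsP/matrixP => -[]. Qed.

Lemma invol0 N (S : 'M[F]_N) (A : 'M[F]_(0, N)) : invol S A = 1%:M.
Proof. by rewrite [A]flatmx0 /invol mulmx0 mul0rn subr0. Qed.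

Lemma card_kernel2 (gT : finGroupType) (G : {group gT}) (f : gT -> bool) h :
  {in G &, forall x y, f (x * y)%g = f x (+) f y} -> h \in G -> f h ->
  #|G| = (2 * #|[set x in G | ~~ f x]|)%N.
Proof.
move=> fM hG fh; rewrite -(cardsID [set x | f x] G) addnC mul2n -addnn.
have -> : G :\: [set x | f x] = [set x in G | ~~ f x].
  by apply/setP => x; rewrite finset.in_setD !finset.in_set andbC.
congr (_ + _)%N; rewrite -[RHS](card_imset _ (mulIg h)); apply: eq_card => x.
rewrite finset.in_setI finset.in_set; apply/andP/imsetP => [[xG fx]|[y /setIdP[yG fy] ->]].
  exists (x * h^-1)%g; last by rewrite mulgKV.
  apply/setIdP; split; first by rewrite groupM ?groupV.
  have := fM (x * h^-1)%g h; rewrite mulgKV fx fh => E.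
  by have := E (groupM xG (groupVr hG)) hG; case: (f _).
by rewrite groupM // fM // (negbTE fy) fh.
Qed.

Lemma index2_square (gT : finGroupType) (G H : {group gT}) x :
  H \subset G -> #|G : H|%g = 2%N -> x \in G -> (x ^+ 2)%g \in H.
Proof.
move=> sHG iH xG; have nHG := index2_normal sHG iH.
have xN : x \in 'N(H)%g by apply: (fintype.subsetP (normal_norm nHG)).
apply: coset_idr; first exact: groupX.
rewrite morphX //= -iH -card_quotient ?normal_norm //.
by apply: expg_cardG; apply: mem_quotient.
Qed.

Section Omega.
Variables (n : nat) (S : 'M[F]_n.+1) (Q : 'rV[F]_n.+1 -> F).
Hypothesis symS : S^T = S.
Hypothesis uS : S \in unitmx.
Hypothesis QS : forall v, Q v = qf S v.

Local Notation even_invol g :=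
  (exists k, g \in [set invol S A | A in frames k.*2 S]).

Lemma even_invol1 : even_invol (1%:M : 'M[F]_n.+1).
Proof. by exists 0%N; apply/imsetP; exists 0; rewrite ?frames0 ?invol0. Qed.

Lemma even_invol_sqr (g : {'GL_n.+1[F]}) : even_invol (GLval g) -> (g ^+ 2)%g = 1%g.
Proof.
case=> k /imsetP[A AS gE]; apply: GLval_inj.
by rewrite expg2 GL_MxE gE invol_involutive.
Qed.

Lemma even_rank (g : {'GL_n.+1[F]}) : g \in SO_set Q -> (g ^+ 2)%g = 1%g ->
  [/\ GLval g \in isoms S S, GLval g *m GLval g = 1%:M &
      ~~ odd (\rank (1%:M - GLval g))].
Proof.
rewrite (mem_SO_set symS QS) => /andP[gS /eqP dg] g2.
have gg : GLval g *m GLval g = 1%:M by rewrite -GL_MxE -expg2 g2.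
split=> //; apply/negP => odd_r.
have := det_involution symS uS gS gg; rewrite dg -signr_odd odd_r expr1 => /eqP.
by rewrite -subr_eq0 opprK -mulr2n (negbTE (two_neq0 hq)).
Qed.

Lemma spin_kernel_invol (g : {'GL_n.+1[F]}) : g \in spin_kernel S Q ->
  (g ^+ 2)%g = 1%g -> even_invol (GLval g).
Proof.
move=> /setIdP[gSO sg] g2; have [gS gg even_r] := even_rank gSO g2.
set r := \rank _ in even_r; have Er : r = r./2.*2 by rewrite halfK (negbTE even_r) subn0.
have Es : n.+1 = (r + (n.+1 - r))%N by rewrite subnKC // rank_leq_row.
have [A AS gE] := even_involution_frame Es symS uS gS gg erefl even_r sg.
by exists r./2; rewrite -Er; apply/imsetP; exists A.
Qed.

(** The sets for different [k] are disjoint because [k] is half the rank of [1 - g]; once the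
    criterion is known, the count is a sum over this rank. *)
Lemma num_invol_sum :
  (forall g : {'GL_n.+1[F]}, g \in Omega Q /\ (g ^+ 2)%g = 1%g <-> even_invol (GLval g)) ->
  num_invol (Omega Q) =
  (\sum_(k < n.+1./2.+1) #|[set invol S A | A in frames k.*2 S]|)%N.
Proof.
move=> crit; rewrite /num_invol -(card_imset _ (@GLval_inj n)).
set J := [set GLval g | g in _].
have JP h : reflect (even_invol h) (h \in J).
  apply: (iffP imsetP) => [[g /setIdP[gO /eqP g2] ->]|[k hk]].
    exact/crit.
  have /imsetP[A AS hE] := hk.
  have [g _ gE] := isoms_GL symS uS QS (invol_isom symS AS); rewrite hE -gE in hk *.
  exists g => //; have /crit[gO g2] : even_invol (GLval g) by exists k.
  by apply/setIdP; rewrite gO g2.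
have rk k h : h \in [set invol S A | A in frames k.*2 S] -> \rank (1%:M - h) = k.*2.
  by case/imsetP => A AS ->; apply: rank_invol.
have le_half k h : h \in [set invol S A | A in frames k.*2 S] -> (k < n.+1./2.+1)%N.
  by move/rk => hk; rewrite ltnS -[k]doubleK half_leq // -hk rank_leq_row.
rewrite -sum1_card (partition_big (fun h => inord (\rank (1%:M - h)%R)./2 : 'I_(n.+1./2.+1)) xpredT) //=.
apply: eq_bigr => k _; rewrite sum1dep_card; apply: eq_card => h; rewrite inE.
apply/andP/idP => [[/JP[l hl] /eqP E]|hk].
  rewrite -E inordK (rk _ _ hl) doubleK //.
  exact: le_half hl.
split; first by apply/JP; exists k.
by rewrite (rk _ _ hk) doubleK inord_val.
Qed.

End Omega.

Lemma num_invol_Omega1 (S : 'M[F]_1) Q : S^T = S -> S \in unitmx ->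
  (forall v, Q v = qf S v) -> num_invol (Omega Q) =
  (\sum_(k < 1./2.+1) #|[set invol S A | A in frames k.*2 S]|)%N.
Proof.
move=> symS uS QS; apply: num_invol_sum => // g; split=> [[]|g1].
  rewrite /Omega /= => /set1P-> _; rewrite GL_1E; exact: even_invol1.
split; last exact: even_invol_sqr g1.
case: g1 => k /imsetP[A AS gE]; apply/set1P/GLval_inj.
have := rank_invol AS; rewrite -gE => rg.
have k0 : k = 0%N by have := rank_leq_row (1%:M - GLval g); rewrite rg; lia.
by subst k; rewrite gE invol0 GL_1E.
Qed.

Lemma num_invol_Omega3 s (S : 'M[F]_s.+3) Q : S^T = S -> S \in unitmx ->
  (forall v, Q v = qf S v) -> num_invol (Omega Q) =
  (\sum_(k < s.+3./2.+1) #|[set invol S A | A in frames k.*2 S]|)%N.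
Proof.
move=> symS uS QS; apply: num_invol_sum => // g; split=> [[gO g2]|g1].
  apply: (spin_kernel_invol symS uS QS) => //.
  by apply: (fintype.subsetP (der_sub_spin_kernel symS uS QS)).
split; last exact: even_invol_sqr g1.
case: g1 => k /imsetP[A AS gE].
have [h hO hE] := invol_even_der symS uS QS AS.
by rewrite (_ : g = h) //; apply: GLval_inj; rewrite gE hE.
Qed.

Lemma exists_nonsquare : exists d : F, ~~ is_sqr d.
Proof.
have [w [w0 gen ord]] := primitive_element F.
exists w; apply/negP => /is_sqrP[x xw].
have [k xk] : exists k, x = w ^+ k.
  by apply: gen; apply: contraNneq w0 => x0; rewrite -xw x0 expr0n.
have q4 := card_field_gt4 hq; have E := divn_eq q 4; rewrite hq in E.
(* If w = w^(2k), multiplying by w^(q-2) gives w^(2k+q-2) = 1, an odd exponent that the even number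
   q - 1 would have to divide. *)
have /ord /dvdnP[l lE] : w ^+ (k * 2 + q.-1.-1) = 1.
  rewrite exprD exprM -xk xw -exprS; apply: (mulfI w0).
  by rewrite -exprS mulr1 (_ : _.+1 = q) ?expf_card //; lia.
move: q4 E lE; move: (q) (q %/ 4)%N => m t q4 E.
rewrite {}E addn1 /= in q4 *; case: t q4 => // t _.
by move/(congr1 odd); rewrite oddD !oddM /= !oddM /= !andbF.
Qed.

Lemma odd_order_square1 (gT : finGroupType) (H : {group gT}) g :
  g \in H -> odd #|H| -> (g ^+ 2)%g = 1%g -> g = 1%g.
Proof.
move=> gH oH g2; have := expg_cardG gH.
by rewrite -(odd_double_half #|H|) oH -mul2n expgS expgM g2 expg1n mulg1.
Qed.

Lemma card_SO_set n (S : 'M[F]_n.+1) Q : S^T = S -> S \in unitmx ->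
  (forall v, Q v = qf S v) -> (2 * #|SO_set Q| = #|isoms S S|)%N.
Proof.
move=> symS uS QS; rewrite -(card_O_set symS uS QS).
have [D DS dD] := reflection_exists symS uS.
have [h hO hD] := isoms_GL symS uS QS DS.
have n1 : (-1 : F) != 1.
  by rewrite eq_sym -subr_eq0 opprK -mulr2n (two_neq0 hq).
have det1V g : g \in O_set Q -> \det (GLval g) = 1 \/ \det (GLval g) = -1.
  rewrite (mem_O_set symS QS) => /isomsP/(congr1 determinant).
  rewrite det_gram -[RHS]mul1r => /(mulIf _) E; have /eqP : \det (GLval g) ^+ 2 = 1.
    by apply: E; rewrite -unitfE -unitmxE.
  by rewrite -subr_eq0 subr_sqr_1 mulf_eq0 subr_eq0 addr_eq0 => /orP[]/eqP; [left|right].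
rewrite (@card_kernel2 _ (O_group Q) (fun g => \det (GLval g) != 1) h) //; last by rewrite hD dD.
  congr (2 * _)%N; apply: eq_card => g; rewrite !finset.in_set negbK //.
move=> x y /det1V xd /det1V yd; rewrite GL_MxE det_mulmx.
by case: xd => ->; case: yd => ->; rewrite ?mul1r ?mulr1 ?mulrNN ?mulr1 ?eqxx ?n1.
Qed.

(* Here [SO] has order [q + 1 = 2 mod 4], so that its subgroup of index 2 has odd
   order and contains no involution. *)
Lemma num_invol_Omega2_minus (S : 'M[F]_2) Q : S^T = S -> S \in unitmx ->
  (forall v, Q v = qf S v) -> ~~ is_sqr (\det S) -> num_invol (Omega Q) =
  (\sum_(k < 2./2.+1) #|[set invol S A | A in frames k.*2 S]|)%N.
Proof.
move=> symS uS QS nsq.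
have cSO : #|SO_set Q| = q.+1.
  have := card_SO_set symS uS QS.
  rewrite (@card_isometry_group 2 1 S) // card_frames1 // (negbTE nsq) /nframe1 /=.
  by rewrite expn0 expn1 addn1 => /eqP; rewrite eqn_pmul2l // => /eqP.
apply: num_invol_sum => // g; split=> [[gO g2]|g1].
  suff -> : g = 1%g by rewrite GL_1E; exact: even_invol1.
  (* Either outcome of the choice leaves only the identity: the default is the trivial group, and a
     subgroup of index 2 has odd order (q + 1) / 2. *)
  move: gO; rewrite /Omega /=; case: pickP => [H /andP[sH /eqP iH]|_ /set1P //] gH.
  have cH := Lagrange sH; rewrite iH cSO in cH.
  apply: (odd_order_square1 gH _ g2).
  have -> : #|H| = (2 * (q %/ 4)).+1 by have := divn_eq q 4; rewrite hq; lia.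
  by rewrite /= oddM.
split; last exact: even_invol_sqr g1.
case: g1 => k /imsetP[A AS gE].
suff k0 : k = 0%N.
  subst k; rewrite (_ : g = 1%g); last by apply: GLval_inj; rewrite gE invol0 GL_1E.
  by rewrite /Omega /=; case: pickP => [H _|_]; [exact: group1|exact: set11].
case: k A AS gE => [|[|k]] A AS gE //.
  have : (0 < #|frames 2 S|)%N by apply/card_gt0P; exists A.
  by rewrite card_frames // !big_ord_recr big_ord0 /= (negbTE nsq) /nframe1 /= !expn0 subnn !muln0.
have := rank_leq_row (1%:M - invol S A); rewrite rank_invol //; lia.
Qed.

(** Guarantees that the choice in [Omega] succeeds. The reflection in a vector [a] has sign
    [is_sqr (qf S a)], and an orthonormal plane represents both 1 and a nonsquare; the product of
    two such reflections lies in SO and has nontrivial sign. *)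
Lemma spin_kernel_index2 (S : 'M[F]_2) Q : S^T = S -> S \in unitmx ->
  (forall v, Q v = qf S v) -> is_sqr (\det S) -> #|SO_set Q : spin_kernel S Q|%g = 2%N.
Proof.
move=> symS uS QS sq.
have refl (a : 'rV[F]_2) : qf S a != 0 -> exists r : 'M[F]_2, [/\ r \in isoms S S,
    \det r = -1 & sphere_sign S r = is_sqr (qf S a)].
  move=> a0.
  have uG : a *m S *m a^T \in unitmx by rewrite unitmxE [_ *m _]mx11_scalar det_scalar1 unitfE.
  have [C /= [uT E _ _ dS]] := @orthogonal_split 1 1 S a symS uS uG.
  have CA : C *m S *m a^T = 0.
    by move: E; rewrite (gram_col_mx S a C) => /eq_block_mx[].
  have NS : (- 1%:M : 'M[F]_1) \in isoms (a *m S *m a^T) (a *m S *m a^T).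
    by apply/isomsP; rewrite linearN /= trmx1 mulmxN mulmx1 mulNmx mul1mx opprK.
  have IS : (1%:M : 'M[F]_1) \in isoms (C *m S *m C^T) (C *m S *m C^T).
    by apply/isomsP; rewrite trmx1 mulmx1 mul1mx.
  pose r : 'M[F]_2 := @glue 1 1 (col_mx a C) (- 1%:M) 1%:M; exists r.
  have rS : r \in isoms S S := glue_isom uT E NS IS.
  have rr : r *m r = 1%:M.
    rewrite /r (@glue_mul 1 1) // mulmxN mulNmx !mulmx1 opprK.
    by rewrite /glue -scalar_mx_block mulmx1 mulVmx.
  have := mulmx_glue (- 1%:M : 'M[F]_1) (1%:M : 'M[F]_1) uT.
  rewrite -/r mul_col_mx mul_block_col !mul0mx addr0 add0r mulNmx !mul1mx => /eq_col_mx[ar Cr].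
  split=> //; first by rewrite (@det_glue 1 1) // det1 mulr1 det_mx11 !mxE eqxx.
  rewrite (@sphere_sign_involution 1 1 S r a C) //.
  move: dS; rewrite sq det_mx11 -/(bf S a a) -/(qf S a) /=.
  by case: is_sqr; case: is_sqr.
have /card_gt0P[T TS] : (0 < #|frames 2 S|)%N by apply: frames_gt0; rewrite // sq.
have qT (x y : F) : qf S ((row_mx x%:M y%:M : 'rV[F]_(1 + 1)) *m T) = x ^+ 2 + y ^+ 2.
  rewrite /qf /bf trmx_mul !mulmxA -(mulmxA _ T) -(mulmxA _ (T *m S)) (isomsP _ _ _ TS).
  by rewrite mulmx1 tr_row_mx mul_row_col !tr_scalar_mx -!scalar_mxM !mxE !eqxx -!expr2.
have [d nd] := exists_nonsquare.
have d0 : d != 0 by apply: contraNneq nd => ->; apply/is_sqrP; exists 0; rewrite expr0n.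
have /card_gt0P[[x y]] : (0 < #|[set z : F * F | (z.1 ^+ 2 + z.2 ^+ 2 == d)%R]|)%N.
  by rewrite (card_circle hq) (negbTE d0) subn_gt0; apply: ltn_trans (card_field_gt4 hq).
rewrite inE /= => /eqP xy.
have q10 := qT 1 0; rewrite expr1n expr0n addr0 in q10.
have qxy := qT x y; rewrite xy in qxy.
have [r1 [r1S d1 s1]] : exists r : 'M[F]_2, [/\ r \in isoms S S, \det r = -1 & sphere_sign S r = true].
  have [|r [rS dr sr]] := refl ((row_mx 1%:M 0%:M : 'rV[F]_(1 + 1)) *m T); first by rewrite q10 oner_eq0.
  by exists r; split=> //; rewrite sr q10 is_sqr1.
have [r2 [r2S d2 s2]] : exists r : 'M[F]_2, [/\ r \in isoms S S, \det r = -1 & sphere_sign S r = false].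
  have [|r [rS dr sr]] := refl ((row_mx x%:M y%:M : 'rV[F]_(1 + 1)) *m T); first by rewrite qxy.
  by exists r; split=> //; rewrite sr qxy (negbTE nd).
have [h hO hE] := isoms_GL symS uS QS (isoms_comp r1S r2S).
have hS : h \in SO_set Q.
  by rewrite (mem_SO_set symS QS) -(mem_O_set symS QS) hO hE det_mulmx d1 d2 mulrNN mulr1 eqxx.
have fh : spin_sign S h by rewrite /spin_sign hE sphere_signM // s1 s2.
have cK := @card_kernel2 _ (SO_group Q) (spin_sign S) h (spin_signM symS uS QS) hS fh.
have sK : spin_kernel S Q \subset SO_set Q by apply/fintype.subsetP => g /setIdP[].
have := Lagrange (sK : spin_kernel_group symS uS QS \subset SO_group Q).
rewrite /= cK mulnC => /eqP; rewrite eqn_pmul2r; first by move/eqP.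
exact: (cardG_gt0 (spin_kernel_group symS uS QS)).
Qed.

(** The argument fits every subgroup of index 2: the only elements of SO with square 1 are 1 and -1,
    and -1 is the square of an element of SO, so it lies in each such subgroup. *)
Lemma num_invol_Omega2_plus (S : 'M[F]_2) Q : S^T = S -> S \in unitmx ->
  (forall v, Q v = qf S v) -> is_sqr (\det S) -> num_invol (Omega Q) =
  (\sum_(k < 2./2.+1) #|[set invol S A | A in frames k.*2 S]|)%N.
Proof.
move=> symS uS QS sq.
have /card_gt0P[T TS] : (0 < #|frames 2 S|)%N by apply: frames_gt0; rewrite // sq.
have minus1 (A : 'M[F]_2) : A \in frames 2 S -> invol S A = - 1%:M.
  move=> AS; have uA : A \in unitmx by rewrite -row_free_unit -row_leq_rank (rank_frames AS).
  by apply: (can_inj (mulKmx uA)); rewrite mulmx_invol // mulmxN mulmx1.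
have [H [HE sH iH]] : exists H : {group {'GL_2[F]}}, [/\ Omega Q = H :> {set _},
    H \subset SO_set Q & #|SO_set Q : H|%g = 2%N].
  rewrite /Omega /=; case: pickP => [H /andP[sH /eqP iH]|]; first by exists H.
  move/(_ (spin_kernel_group symS uS QS))/negbT/negP; case.
  rewrite (spin_kernel_index2 symS uS QS sq) eqxx andbT.
  by apply/fintype.subsetP => g /setIdP[].
apply: num_invol_sum => // g; rewrite HE; split=> [[gH g2]|g1].
  have gSO := fintype.subsetP sH _ gH.
  have [gS gg even_r] := even_rank symS uS QS gSO g2.
  have := rank_leq_row (1%:M - GLval g).
  case rE: (\rank _) even_r => [|[|[|r]]] // _ _.
    by rewrite (invol_rank0 rE); exact: even_invol1.
  (* Rank 2 makes [1 - g] invertible, and (1 - g)(1 + g) = 0 then forces g = -1. *)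
  have u1 : 1%:M - GLval g \in unitmx by rewrite -row_free_unit -row_leq_rank rE.
  exists 1%N; apply/imsetP; exists T => //; rewrite minus1 //.
  apply/eqP; rewrite -addr_eq0 addrC; apply/eqP/(can_inj (mulKmx u1)).
  by rewrite mulmx0 mulmxBl mul1mx mulmxDr mulmx1 gg [GLval g + _]addrC subrr.
split; last exact: even_invol_sqr g1.
case: g1 => k /imsetP[A AS gE]; case: k A AS gE => [|[|k]] A AS gE.
- by rewrite (_ : g = 1%g) ?group1 //; apply: GLval_inj; rewrite gE invol0 GL_1E.
- have [J1S J2S d1 d2 [J11 J22 J12]] := plane_reflections.
  have uA : A \in unitmx by rewrite -row_free_unit -row_leq_rank (rank_frames AS).
  have hS : invmx A *m (J1 *m J2) *m A \in isoms S S.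
    apply: (isoms_comp (S := 1%:M) _ AS); apply: (isoms_comp (S := 1%:M)); last exact: isoms_comp J1S J2S.
    exact: isoms_inv AS.
  have [h hO hE] := isoms_GL symS uS QS hS.
  have hSO : h \in SO_set Q.
    rewrite (mem_SO_set symS QS) -(mem_O_set symS QS) hO hE !det_mulmx d1 d2 det_inv.
    by rewrite mulrNN !mulr1 mulVf ?eqxx // -unitfE -unitmxE.
  have -> : g = (h ^+ 2)%g.
    have JJ : (J1 *m J2) *m (J1 *m J2) = - 1%:M.
      by rewrite {1}J12 mulNmx -mulmxA (mulmxA J1 J1) J11 mul1mx J22.
    apply: GLval_inj; rewrite expg2 GL_MxE gE minus1 // hE.
    move: (J1 *m J2) JJ => J JJ; rewrite -!mulmxA mulKVmx //.
    by rewrite [J *m (J *m A)]mulmxA JJ mulNmx mul1mx mulmxN mulVmx.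
  exact: index2_square (sH : H \subset SO_group Q) iH hSO.
- have := rank_leq_row (1%:M - invol S A); rewrite rank_invol //; lia.
Qed.

Lemma num_invol_Omega n (S : 'M[F]_n.+1) Q : S^T = S -> S \in unitmx ->
  (forall v, Q v = qf S v) -> num_invol (Omega Q) =
  (\sum_(k < n.+1./2.+1) #|[set invol S A | A in frames k.*2 S]|)%N.
Proof.
case: n S Q => [|[|s]] S Q symS uS QS.
- exact: num_invol_Omega1.
- have [sq|nsq] := boolP (is_sqr (\det S)).
    exact: num_invol_Omega2_plus.
  exact: num_invol_Omega2_minus.
- exact: num_invol_Omega3.
Qed.

(* Orders of the orthogonal groups, the second one for a nonsquare determinant. *)
Definition orderT N : nat := \prod_(1 <= i < N.+1) nframe1 i true.
Definition orderF N : nat := 2 * \prod_(2 <= i < N.+1) nframe1 i false.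

(** With [f] the number of unit vectors by dimension, this says that [k]-frames times the order of
    the group of the complement give the order of the whole group. The lower limit is 1 for [orderT]
    and 2 for [orderF], which leaves out the vanishing [nframe1 1 false]. *)
Lemma prod_frames_split k N m (f : nat -> nat) : (k <= N)%N -> (m <= (N - k).+1)%N ->
  (\prod_(j < k) f (N - j) * \prod_(m <= i < (N - k).+1) f i =
   \prod_(m <= i < N.+1) f i)%N.
Proof.
elim: k => [|k IH] kN mN; first by rewrite big_ord0 subn0 mul1n.
rewrite -IH; [|lia|lia]; rewrite big_ord_recr /= -mulnA; congr (_ * _)%N.
have E : (N - k = (N - k.+1).+1)%N by lia.
by rewrite {2}E [RHS]big_nat_recr //= -E mulnC.
Qed.

Lemma orderT_gt0 N : (0 < orderT N)%N.
Proof.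
rewrite /orderT big_nat prodn_cond_gt0 // => i /andP[i0 _].
by apply: nframe1_gt0; rewrite andbT; lia.
Qed.

Lemma orderF_gt0 N : (0 < orderF N)%N.
Proof.
rewrite /orderF muln_gt0 big_nat prodn_cond_gt0 // => i /andP[i0 _].
by apply: nframe1_gt0; rewrite i0.
Qed.

Lemma card_O_orderT n (S : 'M[F]_n.+1) Q : S^T = S -> S \in unitmx ->
  (forall v, Q v = qf S v) -> is_sqr (\det S) -> #|O_set Q| = orderT n.+1.
Proof.
move=> symS uS QS sq; rewrite (card_O_set symS uS QS).
rewrite (@card_isometry_group n.+1 n) ?addn1 // card_frames // sq.
rewrite /orderT -(@prod_frames_split n n.+1 1) //.
by rewrite mulnC (_ : (n.+1 - n = 1)%N) ?big_nat1 //; lia.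
Qed.

Lemma card_O_orderF n (S : 'M[F]_n.+1) Q : S^T = S -> S \in unitmx ->
  (forall v, Q v = qf S v) -> ~~ is_sqr (\det S) -> #|O_set Q| = orderF n.+1.
Proof.
move=> symS uS QS nsq; rewrite (card_O_set symS uS QS).
rewrite (@card_isometry_group n.+1 n) ?addn1 // card_frames // (negbTE nsq).
rewrite /orderF -(@prod_frames_split n n.+1 2) //; last by lia.
by rewrite (_ : (n.+1 - n = 1)%N) ?big_geq ?muln1 //; lia.
Qed.

Lemma card_isoms1 k : #|isoms (1%:M : 'M[F]_k) (1%:M : 'M[F]_k)| = orderT k.
Proof.
rewrite -/(frames k _) card_frames ?trmx1 ?unitmx1 // det1 is_sqr1.
by rewrite /orderT -(@prod_frames_split k k 1) ?subnn ?big_geq ?muln1 //.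
Qed.

Lemma ratio_squareE (K : numFieldType) n (S : 'M[F]_n.+1) Q : S^T = S -> S \in unitmx ->
  (forall v, Q v = qf S v) -> is_sqr (\det S) ->
  (num_invol (Omega Q))%:R / #|O_set Q|%:R =
  \sum_(k < n.+1./2.+1) (orderT k.*2)%:R^-1 * (orderT (n.+1 - k.*2))%:R^-1 :> K.
Proof.
move=> symS uS QS sq; rewrite (num_invol_Omega symS uS QS) (card_O_orderT symS uS QS sq).
rewrite natr_sum mulr_suml; apply: eq_bigr => k _.
have kn : (k.*2 <= n.+1)%N by have := ltn_ord k; lia.
have nz N : (orderT N)%:R != 0 :> K by rewrite pnatr_eq0 -lt0n orderT_gt0.
apply: (mulIf (nz k.*2)); apply: (mulIf (nz n.+1)).
rewrite mulrAC divfK // -natrM -card_isoms1 card_invol // card_frames // sq card_isoms1.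
rewrite [X in _ = X * _ * _]mulrC divfK //.
have -> : orderT n.+1 = (\prod_(j < k.*2) nframe1 (n.+1 - j) true * orderT (n.+1 - k.*2))%N.
  by rewrite /orderT (prod_frames_split (nframe1^~ true)).
by rewrite natrM mulrCA mulVf // mulr1.
Qed.

(** The summand with 2k = n + 1 vanishes, as a space of nonsquare discriminant has no orthonormal
    basis; numerically [nframe1 1 false = 0]. This is the convention 1/|O^-(0)| = 0. *)
Lemma ratio_nonsquareE (K : numFieldType) n (S : 'M[F]_n.+1) Q : S^T = S -> S \in unitmx ->
  (forall v, Q v = qf S v) -> ~~ is_sqr (\det S) ->
  (num_invol (Omega Q))%:R / #|O_set Q|%:R =
  \sum_(k < n.+1./2.+1) (orderT k.*2)%:R^-1 *
     (if n.+1 == k.*2 then 0 else (orderF (n.+1 - k.*2))%:R^-1) :> K.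
Proof.
move=> symS uS QS nsq; rewrite (num_invol_Omega symS uS QS) (card_O_orderF symS uS QS nsq).
rewrite natr_sum mulr_suml; apply: eq_bigr => k _.
have kn : (k.*2 <= n.+1)%N by have := ltn_ord k; lia.
have nz N : (orderT N)%:R != 0 :> K by rewrite pnatr_eq0 -lt0n orderT_gt0.
have nzF N : (orderF N)%:R != 0 :> K by rewrite pnatr_eq0 -lt0n orderF_gt0.
apply: (mulIf (nz k.*2)); apply: (mulIf (nzF n.+1)).
rewrite mulrAC divfK // -natrM -card_isoms1 card_invol // card_frames // (negbTE nsq) card_isoms1.
rewrite [X in _ = X * _ * _]mulrC divfK //.
case: eqP => [En|/eqP En].
  rewrite mul0r -En (bigD1 (Ordinal (ltnSn n))) //= (_ : (n.+1 - n = 1)%N); last by lia.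
  by rewrite /nframe1 /= expn0 subnn mul0n.
have -> : orderF n.+1 = (\prod_(j < k.*2) nframe1 (n.+1 - j) false * orderF (n.+1 - k.*2))%N.
  rewrite /orderF mulnCA (prod_frames_split (nframe1^~ false)) //; lia.
by rewrite natrM mulrCA mulVf // mulr1.
Qed.

(** * Diagonalisation of the standard forms *)

Lemma sum_pairs m (h : nat -> F) :
  \sum_(i < m) (h i.*2 + h i.*2.+1) = \sum_(j < m.*2) h j.
Proof.
elim: m => [|m IH]; first by rewrite !big_ord0.
by rewrite doubleS !big_ord_recr /= IH addrA.
Qed.

Section HyperbolicChange.
Variables (N m : nat) (i : F).
Hypothesis i2 : i ^+ 2 = -1.
Hypothesis mN : (m.*2 <= N.+1)%N.

(* Turns each hyperbolic pair into a sum of two squares: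
   [(a + i b) (a - i b) = a^2 + b^2]. *)
Definition unhyp (v : 'rV[F]_N.+1) : 'rV[F]_N.+1 :=
  \row_j if (j < m.*2)%N then
     if odd j then v 0 (inord j.-1) - i * v 0 j else v 0 j + i * v 0 (inord j.+1)
   else v 0 j.

Lemma unhyp_linear : linear unhyp.
Proof.
move=> a u v; apply/rowP => j; rewrite !mxE.
by case: ifP => _ //; case: ifP => _; ring.
Qed.

Lemma unhyp_even v k : (k < m)%N ->
  unhyp v 0 (inord k.*2) = v 0 (inord k.*2) + i * v 0 (inord k.*2.+1).
Proof. by move=> km; rewrite mxE inordK ?odd_double; [rewrite ltn_double km|lia]. Qed.

Lemma unhyp_odd v k : (k < m)%N ->
  unhyp v 0 (inord k.*2.+1) = v 0 (inord k.*2) - i * v 0 (inord k.*2.+1).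
Proof. by move=> km; rewrite mxE inordK /= ?odd_double; [rewrite ltn_Sdouble km|lia]. Qed.

Lemma unhyp_id v k : (m.*2 <= k < N.+1)%N -> unhyp v 0 (inord k) = v 0 (inord k).
Proof. by move=> /andP[mk kN]; rewrite mxE inordK // ltnNge mk. Qed.

Lemma hyperbolic_unhyp v : hyperbolic m (unhyp v) = \sum_(j < m.*2) v 0 (inord j) ^+ 2.
Proof.
rewrite -(sum_pairs m (fun j => v 0 (inord j) ^+ 2)); apply: eq_bigr => k _.
rewrite unhyp_even // unhyp_odd //; move: (v 0 (inord k.*2)) (v 0 (inord k.*2.+1)) => a b.
by transitivity (a ^+ 2 - i ^+ 2 * b ^+ 2); [ring|rewrite i2; ring].
Qed.

Lemma unhyp_inj v : unhyp v = 0 -> v = 0.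
Proof.
move=> v0; have h2 := two_neq0 hq.
have i0 : i != 0 by apply: contra_eqN i2 => /eqP->; rewrite expr0n eq_sym oppr_eq0 oner_eq0.
have pair k : (k < m)%N -> v 0 (inord k.*2) = 0 /\ v 0 (inord k.*2.+1) = 0.
  move=> km; have := unhyp_even v km; have := unhyp_odd v km.
  rewrite v0 !mxE; move: (v 0 (inord k.*2)) (v 0 (inord k.*2.+1)) => a b E1 E2; split.
    apply: (mulfI h2); transitivity ((a - i * b) + (a + i * b)); first by ring.
    by rewrite -E1 -E2 addr0 mulr0.
  apply: (mulfI (mulf_neq0 h2 i0)); transitivity ((a + i * b) - (a - i * b)); first by ring.
  by rewrite -E1 -E2 subr0 mulr0.
apply/rowP => j; rewrite [RHS]mxE -(inord_val j).
have [jm|mj] := ltnP j m.*2; last first.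
  by rewrite -unhyp_id ?mj ?ltn_ord // v0 mxE.
have jh : (j./2 < m)%N by lia.
by have [e o] := pair _ jh; rewrite -(odd_double_half j); case: (odd j).
Qed.

(** [Q] is diagonal in the coordinates of [unhyp], so a Gram matrix is transported from [diag_mx d],
    and its determinant changes by a square only. *)
Lemma hyperbolic_gram (d : 'rV[F]_N.+1) (Q : 'rV[F]_N.+1 -> F) :
  (forall j, d 0 j != 0) -> (forall v, Q (unhyp v) = \sum_j d 0 j * v 0 j ^+ 2) ->
  exists S : 'M[F]_N.+1, [/\ S^T = S, S \in unitmx, forall v, Q v = qf S v
    & is_sqr (\det S) = is_sqr (\prod_j d 0 j)].
Proof.
move=> d0 Qd.
pose f : {linear 'rV[F]_N.+1 -> 'rV[F]_N.+1} :=
  HB.pack unhyp (GRing.isLinear.Build F _ _ *:%R unhyp unhyp_linear).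
pose A := lin1_mx f; have AE v : v *m A = unhyp v by rewrite mul_rV_lin1.
have uA : A \in unitmx.
  by rewrite -row_free_unit; apply/inj_row_free => v; rewrite AE; exact: unhyp_inj.
exists (invmx A *m diag_mx d *m (invmx A)^T); split.
- by rewrite !trmx_mul trmxK tr_diag_mx mulmxA.
- rewrite gram_unit ?unitmx_inv // unitmxE det_diag unitfE.
  by apply/prodf_neq0 => j _.
- move=> v; have {1}-> : v = unhyp (v *m invmx A) by rewrite -AE mulmxKV.
  rewrite Qd /qf /bf !mulmxA -mulmxA -trmx_mul; move: (v *m _) => w.
  rewrite mxE; apply: eq_bigr => j _.
  by rewrite mul_mx_diag !mxE expr2 mulrCA mulrA.
- by rewrite is_sqr_gram ?unitmx_inv // det_diag.
Qed.

End HyperbolicChange.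

Lemma form_plus_gram m : exists S : 'M[F]_m.*2.+2, [/\ S^T = S, S \in unitmx,
  forall v, form_plus v = qf S v & is_sqr (\det S)].
Proof.
have [i i2] := sqrtN1 hq.
have mN : (m.+1.*2 <= m.*2.+2)%N by rewrite doubleS.
have [||S [symS uS QS dS]] := @hyperbolic_gram _ m.+1 i i2 mN (const_mx 1) (@form_plus F m).
- by move=> j; rewrite mxE oner_eq0.
- move=> v; rewrite /form_plus hyperbolic_unhyp //; apply: eq_bigr => j _.
  by rewrite mxE mul1r inord_val.
exists S; split=> //; rewrite dS big1 ?is_sqr1 // => j _.
by rewrite mxE.
Qed.

Lemma form_odd_gram n : exists S : 'M[F]_n.*2.+1, [/\ S^T = S, S \in unitmx,
  forall v, form_odd v = qf S v & is_sqr (\det S)].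
Proof.
have [i i2] := sqrtN1 hq.
have mN : (n.*2 <= n.*2.+1)%N by [].
have [||S [symS uS QS dS]] := @hyperbolic_gram _ n i i2 mN (const_mx 1) (@form_odd F n).
- by move=> j; rewrite mxE oner_eq0.
- move=> v; rewrite /form_odd hyperbolic_unhyp // unhyp_id ?leqnn ?ltnSn //.
  rewrite -(big_ord_recr _ (fun j : 'I_n.*2.+1 => v 0 (inord j) ^+ 2)) /=.
  by apply: eq_bigr => j _; rewrite mxE mul1r inord_val.
exists S; split=> //; rewrite dS big1 ?is_sqr1 // => j _.
by rewrite mxE.
Qed.

Lemma form_minus_gram delta m : ~~ is_sqr delta ->
  exists S : 'M[F]_m.*2.+2, [/\ S^T = S, S \in unitmx,
  forall v, form_minus delta v = qf S v & ~~ is_sqr (\det S)].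
Proof.
move=> nd; have [i i2] := sqrtN1 hq.
have d0 : delta != 0 by apply: contraNneq nd => ->; apply/is_sqrP; exists 0; rewrite expr0n.
have mN : (m.*2 <= m.*2.+2)%N by lia.
(* With [m] pairs, [unhyp] leaves the last two coordinates alone. The entry [- delta] is a nonsquare
   because -1 is a square. *)
pose d : 'rV[F]_m.*2.+2 := \row_j if j == ord_max then - delta else 1.
have [||S [symS uS QS dS]] := @hyperbolic_gram _ m i i2 mN d (@form_minus F delta m).
- by move=> j; rewrite mxE; case: (j == ord_max); rewrite ?oppr_eq0 ?oner_eq0 ?d0.
- move=> v; rewrite /form_minus hyperbolic_unhyp // !unhyp_id ?leqnn ?leqnSn ?ltnSn //.
  rewrite -(big_ord_recr _ (fun j : 'I_m.*2.+1 => v 0 (inord j) ^+ 2)) /=.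
  rewrite [RHS]big_ord_recr /= mxE eqxx mulNr; congr (_ - delta * v 0 _ ^+ 2).
    apply: eq_bigr => j _; rewrite mxE -val_eqE /= ltn_eqF ?ltn_ord // mul1r.
    by congr (v 0 _ ^+ 2); apply: val_inj; rewrite /= inordK //; have := ltn_ord j; lia.
  by apply: val_inj; rewrite /= inordK.
exists S; split=> //; rewrite dS (bigD1 ord_max) //= big1 ?mulr1 => [|j /negbTE jm].
  by rewrite mxE eqxx is_sqrN.
by rewrite mxE jm.
Qed.

End Forms.
(* The square of the integer [j - k]: one of the truncated differences is 0. *)
Definition dist2 (j k : nat) : nat := ((j - k) ^ 2 + (k - j) ^ 2)%N.

(** The parallelogram identity: it converts the exponents 2j^2 and 2k^2 of the group orders, against
    the normalising q^(n^2) with n = j + k, into (j - k)^2. *)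
Lemma dist2E j k : (2 * j ^ 2 + 2 * k ^ 2 = dist2 j k + (j + k) ^ 2)%N.
Proof.
rewrite /dist2; case: (leqP j k) => [jk|/ltnW kj].
  by rewrite -(subnKC jk) subnDA subnn addKn; lia.
by rewrite -(subnKC kj) subnDA subnn addKn; lia.
Qed.

(** * Explicit group orders and the coefficients of the three series *)

Section Ratios.
Variables (F : finFieldType) (K : numFieldType).
Hypothesis hq : (#|F| %% 4 = 1)%N.
Local Notation Q := (#|F|%:R : K).
Local Notation x := (Q^-1).

Lemma Q_neq0 : Q != 0.
Proof. by rewrite pnatr_eq0 -lt0n; apply: ltn_trans (card_field_gt4 hq). Qed.

(** The q-Pochhammer symbol (p;p)_n. *)
Definition poch (p : K) (n : nat) : K := \prod_(i < n) (1 - p ^+ i.+1).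

Definition theta_term (y u1 u2 : K) (j k : nat) : K :=
  u1 ^+ j * u2 ^+ k * y ^+ dist2 j k / (poch (y ^+ 2) j * poch (y ^+ 2) k).

Definition theta_coef (y u1 u2 : K) (n : nat) : K :=
  \sum_(j < n.+1) theta_term y u1 u2 j (n - j).

Lemma poch_neq0 n : poch (x ^+ 2) n != 0.
Proof.
apply/prodf_neq0 => i _; rewrite -exprM subr_eq0 eq_sym exprVn.
rewrite -natrX invr_eq1 pnatr_eq1 -(expn0 #|F|) eqn_exp2l //.
exact: leq_trans (card_field_gt4 hq).
Qed.

Lemma nframe1_odd k b : (nframe1 F k.*2.+1 b)%:R = Q ^+ k.*2 + (-1) ^+ (~~ b) * Q ^+ k :> K.
Proof.
rewrite /nframe1 /= odd_double doubleK; case: b => /=; first by rewrite mul1r natrD !natrX.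
rewrite mulN1r natrB ?natrX // leq_exp2l; first by lia.
by apply: ltn_trans (card_field_gt4 hq).
Qed.

Lemma nframe1_even k b : (nframe1 F k.*2.+2 b)%:R = Q ^+ k.*2.+1 - (-1) ^+ (~~ b) * Q ^+ k :> K.
Proof.
rewrite /nframe1 /= odd_double uphalf_double; case: b => /=; last first.
  by rewrite mulN1r opprK natrD !natrX.
rewrite mul1r natrB ?natrX // leq_exp2l; first by lia.
by apply: ltn_trans (card_field_gt4 hq).
Qed.

Lemma pochS n : poch (x ^+ 2) n.+1 = poch (x ^+ 2) n * (1 - x ^+ n.*2.+2).
Proof. by rewrite /poch big_ord_recr /= -exprM mul2n doubleS. Qed.

(** [a] stands for |O^e(2k)| with e = 1 or -1. Classically this is 2 q^(k(k-1)) (q^k - e) times the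
    product of q^(2i) - 1 over i < k; the factor q^k + e completes the product, which gives both
    types the same right-hand side. *)
Lemma order_step (a : K) k b :
  a * (Q ^+ k + (-1) ^+ (~~ b)) = 2 * Q ^+ (2 * k ^ 2) * poch (x ^+ 2) k ->
  a * (nframe1 F k.*2.+1 b)%:R * (nframe1 F k.*2.+2 b)%:R * (Q ^+ k.+1 + (-1) ^+ (~~ b)) =
  2 * Q ^+ (2 * k.+1 ^ 2) * poch (x ^+ 2) k.+1.
Proof.
move=> E; rewrite nframe1_odd nframe1_even pochS.
have Q0 := Q_neq0.
have -> : (2 * k.+1 ^ 2 = 2 * k ^ 2 + k.*2 + k.*2.+2)%N by lia.
have xQ : 1 - x ^+ k.*2.+2 = (Q ^+ k.*2.+2 - 1) / Q ^+ k.*2.+2.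
  by rewrite mulrBl divff ?expf_neq0 // div1r exprVn.
rewrite xQ (exprD _ (_ + _)) (exprD _ (2 * k ^ 2)).
move: (poch _ k) (Q ^+ (2 * k ^ 2)) E => P A E.
transitivity ((2 * A * P) * Q ^+ k.*2 * (Q ^+ k.*2.+2 - 1)); last first.
  by field; rewrite expf_neq0.
rewrite -E -addnn !exprS !exprD.
have [->|->] : (-1) ^+ (~~ b) = 1 :> K \/ (-1) ^+ (~~ b) = -1 :> K.
  by case: b {E}; [left|right].
all: by ring.
Qed.

Lemma orderT_doubleS k : orderT F k.+1.*2 =
  (orderT F k.*2 * nframe1 F k.*2.+1 true * nframe1 F k.*2.+2 true)%N.
Proof. by rewrite /orderT doubleS big_nat_recr //= big_nat_recr. Qed.

Lemma orderF_doubleS k : (0 < k)%N -> orderF F k.+1.*2 =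
  (orderF F k.*2 * nframe1 F k.*2.+1 false * nframe1 F k.*2.+2 false)%N.
Proof.
move=> k0; rewrite /orderF doubleS big_nat_recr /=; last by lia.
by rewrite big_nat_recr /= ?mulnA //; lia.
Qed.

Lemma orderT_evenE k : (orderT F k.*2)%:R * (Q ^+ k + 1) =
  2 * Q ^+ (2 * k ^ 2) * poch (x ^+ 2) k.
Proof.
elim: k => [|k IH]; first by rewrite /orderT big_geq // /poch big_ord0 !expr0 !mulr1 mul1r.
by rewrite orderT_doubleS !natrM; exact: (@order_step _ k true IH).
Qed.

Lemma orderF_evenE k : (0 < k)%N -> (orderF F k.*2)%:R * (Q ^+ k - 1) =
  2 * Q ^+ (2 * k ^ 2) * poch (x ^+ 2) k.
Proof.
case: k => // k _; elim: k => [|k IH]; last first.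
  rewrite orderF_doubleS // natrM natrM; have := @order_step (orderF F k.+1.*2)%:R k.+1 false.
  by rewrite /= expr1 => /(_ IH).
have := nframe1_even 0 false; rewrite mulN1r opprK expr0 expr1 => n2.
rewrite /orderF big_nat1 natrM n2 /poch big_ord1 !expr1.
by field; exact: Q_neq0.
Qed.

Lemma inv_orderT_even k : (orderT F k.*2)%:R^-1 =
  (Q ^+ k + 1) * x ^+ (2 * k ^ 2) / (2 * poch (x ^+ 2) k) :> K.
Proof.
have Q0 := Q_neq0; have P0 := poch_neq0 k.
have o0 : (orderT F k.*2)%:R != 0 :> K by rewrite pnatr_eq0 -lt0n orderT_gt0.
apply: (mulfI o0); rewrite mulfV // !mulrA orderT_evenE.
move: (poch _ _) P0 => P P0; rewrite exprVn.
by field; rewrite P0 expf_neq0.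
Qed.

(** At [k = 0] the factor q^k - 1 vanishes, so the convention for dimension 0 needs no separate
    treatment in the series. *)
Lemma inv_orderF_even k : (if k == 0%N then 0 else (orderF F k.*2)%:R^-1) =
  (Q ^+ k - 1) * x ^+ (2 * k ^ 2) / (2 * poch (x ^+ 2) k) :> K.
Proof.
case: k => [|k] /=; first by rewrite expr0 subrr !mul0r.
have Q0 := Q_neq0; have P0 := poch_neq0 k.+1.
have o0 : (orderF F k.+1.*2)%:R != 0 :> K by rewrite pnatr_eq0 -lt0n orderF_gt0.
apply: (mulfI o0); rewrite mulfV // !mulrA orderF_evenE //.
move: (poch _ _) P0 => P P0; rewrite exprVn.
by field; rewrite P0 expf_neq0.
Qed.

(** The last unit vector count q^(2k) + q^k = q^k (q^k + 1) supplies the factor that the even order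
    lacks. *)
Lemma inv_orderT_odd k : (orderT F k.*2.+1)%:R^-1 =
  x ^+ (2 * k ^ 2 + k) / (2 * poch (x ^+ 2) k) :> K.
Proof.
have Q0 := Q_neq0; have P0 := poch_neq0 k.
have o0 : (orderT F k.*2.+1)%:R != 0 :> K by rewrite pnatr_eq0 -lt0n orderT_gt0.
apply: (mulfI o0); rewrite mulfV // /orderT big_nat_recr //= natrM -/(orderT F k.*2).
rewrite nframe1_odd mul1r (_ : Q ^+ k.*2 = Q ^+ k * Q ^+ k) -?exprD ?addnn //.
rewrite -[X in _ + X]mulr1 -addnn exprD -mulrDr addnn.
have := orderT_evenE k; set a := _%:R; set b := _ + 1 => E.
rewrite (_ : a * (Q ^+ k * b) = Q ^+ k * (2 * Q ^+ (2 * k ^ 2) * poch (x ^+ 2) k)); last first.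
  by rewrite -E; ring.
by move: (poch _ _) P0 => P P0; rewrite exprD !exprVn; field; rewrite P0 !expf_neq0.
Qed.

Lemma ratio_plusE n : ratio_plus F K n =
  \sum_(k < n.+1) (orderT F k.*2)%:R^-1 * (orderT F (n - k).*2)%:R^-1.
Proof.
case: n => [|m]; first by rewrite big_ord1 /orderT !big_geq // invr1 mulr1.
have [S [symS uS QS sq]] := form_plus_gram hq m.
rewrite /ratio_plus (ratio_squareE hq K symS uS QS sq) /= doubleK.
by apply: eq_bigr => k _; rewrite doubleB.
Qed.

Lemma ratio_minusE (delta : F) n : ~~ is_sqr delta -> ratio_minus K delta n =
  \sum_(k < n.+1) (orderT F k.*2)%:R^-1 *
    (if (n - k == 0)%N then 0 else (orderF F (n - k).*2)%:R^-1).
Proof.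
move=> nd; case: n => [|m]; first by rewrite big_ord1 mulr0.
have [S [symS uS QS nsq]] := form_minus_gram hq m nd.
rewrite /ratio_minus (ratio_nonsquareE hq K symS uS QS nsq) /= doubleK.
apply: eq_bigr => k _; rewrite doubleB.
by have -> : (m.*2.+2 == k.*2) = ((m.+1 - k)%N == 0%N) by have := ltn_ord k; lia.
Qed.

Lemma ratio_oddE n : ratio_odd F K n =
  \sum_(k < n.+1) (orderT F k.*2)%:R^-1 * (orderT F (n - k).*2.+1)%:R^-1.
Proof.
have [S [symS uS QS sq]] := form_odd_gram hq n.
rewrite /ratio_odd (ratio_squareE hq K symS uS QS sq) /= uphalf_double.
apply: eq_bigr => k _; rewrite doubleB subSn //.
by have := ltn_ord k; lia.
Qed.

Lemma exp_dist2 j k : x ^+ (2 * j ^ 2) * x ^+ (2 * k ^ 2) * Q ^+ ((j + k) ^ 2) = x ^+ dist2 j k.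
Proof.
by rewrite -exprD dist2E exprD -mulrA -exprMn mulVf ?Q_neq0 // expr1n mulr1.
Qed.

(** Each 1/|O^+(2k)| carries (q^k + 1) / 2. The product of two such factors expands into four terms,
    in which q^k u^k is read as (u q)^k. *)
Lemma plus_termE n u : ratio_plus F K n * Q ^+ (n ^ 2) * u ^+ n =
  1 / 4 * (theta_coef x (u * Q) (u * Q) n + theta_coef x (u * Q) u n +
           theta_coef x u (u * Q) n + theta_coef x u u n).
Proof.
rewrite ratio_plusE !mulr_suml -!big_split mulr_sumr; apply: eq_bigr => k _.
case: k => k /=; rewrite ltnS => /subnKC; move: (n - k)%N => j <-.
rewrite !inv_orderT_even /theta_term -exp_dist2 !exprMn (exprD u).
move: (poch_neq0 k) (poch_neq0 j); move: (poch _ k) (poch _ j) => P P' P0 P0'.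
by move: (x ^+ (2 * k ^ 2)) (x ^+ (2 * j ^ 2)) (Q ^+ _) => A B C; field; rewrite P0 P0'.
Qed.

(** The second order contributes q^j - 1 in place of q^j + 1, whence the two minus signs. *)
Lemma minus_termE (delta : F) n u : ~~ is_sqr delta ->
  ratio_minus K delta n * Q ^+ (n ^ 2) * u ^+ n =
  1 / 4 * (theta_coef x (u * Q) (u * Q) n - theta_coef x (u * Q) u n +
           theta_coef x u (u * Q) n - theta_coef x u u n).
Proof.
move=> nd; rewrite ratio_minusE // !mulr_suml -!sumrB -!big_split -sumrB mulr_sumr.
apply: eq_bigr => k _.
case: k => k /=; rewrite ltnS => /subnKC; move: (n - k)%N => j <-.
rewrite inv_orderT_even inv_orderF_even /theta_term -exp_dist2 !exprMn (exprD u).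
move: (poch_neq0 k) (poch_neq0 j); move: (poch _ k) (poch _ j) => P P' P0 P0'.
by move: (x ^+ (2 * k ^ 2)) (x ^+ (2 * j ^ 2)) (Q ^+ _) => A B C; field; rewrite P0 P0'.
Qed.

(** The inverse of the odd order carries only a power x^j, whence the argument [u * x] and two terms
    instead of four. *)
Lemma odd_termE n u : ratio_odd F K n * Q ^+ (n ^ 2) * u ^+ n =
  1 / 4 * (theta_coef x (u * Q) (u * x) n + theta_coef x u (u * x) n).
Proof.
rewrite ratio_oddE !mulr_suml -!big_split mulr_sumr; apply: eq_bigr => k _.
case: k => k /=; rewrite ltnS => /subnKC; move: (n - k)%N => j <-.
rewrite inv_orderT_even inv_orderT_odd /theta_term -exp_dist2 !exprMn (exprD u) (exprD x (2 * j ^ 2)).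
move: (poch_neq0 k) (poch_neq0 j); move: (poch _ k) (poch _ j) => P P' P0 P0'.
by move: (x ^+ (2 * k ^ 2)) (x ^+ (2 * j ^ 2)) (Q ^+ _) => A B C; field; rewrite P0 P0'.
Qed.

Lemma theta_coefC y u1 u2 n : theta_coef y u1 u2 n = theta_coef y u2 u1 n.
Proof.
rewrite /theta_coef (reindex_inj rev_ord_inj) /=; apply: eq_bigr => k _.
have kn : (k <= n)%N by rewrite -ltnS.
rewrite subSS subKn // /theta_term (mulrC (u2 ^+ _)) (mulrC (poch _ k)).
by congr (_ * y ^+ _ / _); exact: addnC.
Qed.

End Ratios.

(** * Series and the q-series identity *)

Local Open Scope classical_set_scope.

Section Series.
Variable K : numFieldType.
Implicit Types (a b u : nat -> K) (l z : K).

Lemma cvgn_epsP u l : (u @ \oo --> l) <->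
  (forall e, 0 < e -> exists N, forall n, (N <= n)%N -> `|l - u n| <= e).
Proof.
rewrite cvgrPdist_le; split=> h e e0; first by have [N _ hN] := h e e0; exists N.
by have [N hN] := h e e0; exists N.
Qed.

(** Absolute convergence expressed by a bound, since [K] is not assumed to have suprema. *)
Definition abs_bounded a := exists M : K, forall n, \sum_(0 <= k < n) `|a k| <= M.

Lemma cvgn_bounded u l M : u @ \oo --> l -> (forall n, `|u n| <= M) -> `|l| <= M + 1.
Proof.
move=> /cvgn_epsP/(_ 1 ltr01)[N hN] uM; rewrite -(subrK (u N) l) addrC.
by apply: le_trans (ler_normD _ _) _; apply: lerD; [exact: uM|exact: hN].
Qed.

Lemma sum_shift (f : nat -> nat -> K) n :
  \sum_(0 <= m < n) \sum_(0 <= k < m.+1) f k (m - k)%N =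
  \sum_(0 <= k < n) \sum_(0 <= j < n - k) f k j.
Proof.
elim: n => [|n IH]; first by rewrite !big_geq.
rewrite big_nat_recr //= IH [RHS]big_nat_recr //= subSnn big_nat1.
rewrite [X in _ + X]big_nat_recr //= subnn addrA -big_split /=; congr (_ + _).
rewrite !big_nat; apply: eq_bigr => k /andP[_ kn].
by rewrite subSn 1?ltnW // [RHS]big_nat_recr.
Qed.

Definition conv a b n := \sum_(0 <= k < n.+1) a k * b (n - k)%N.

Lemma abs_bounded_conv a b : abs_bounded a -> abs_bounded b -> abs_bounded (conv a b).
Proof.
move=> [A hA] [B hB]; exists (A * B) => n.
have A0 : 0 <= A by have := hA 0%N; rewrite big_geq.
apply: (@le_trans _ _ (\sum_(0 <= m < n) \sum_(0 <= k < m.+1) `|a k| * `|b (m - k)%N|)).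
  apply: ler_sum => m _; apply: le_trans (ler_norm_sum _ _ _) _.
  by apply: ler_sum => k _; rewrite normrM.
rewrite (sum_shift (fun k j => `|a k| * `|b j|)).
apply: (@le_trans _ _ (\sum_(0 <= k < n) `|a k| * B)).
  by apply: ler_sum => k _; rewrite -mulr_sumr ler_wpM2l.
rewrite -mulr_suml ler_wpM2r //.
by have := hB 0%N; rewrite big_geq.
Qed.

(* Mertens: S_n - A_n B = sum a_k (B_(n-k) - B); the terms with n - k large are
   small because B_(n-k) is close to B, the others because a_k tends to 0. *)
Lemma cauchy_product a b (A B : K) : abs_bounded a -> abs_bounded b ->
  series a @ \oo --> A -> series b @ \oo --> B -> series (conv a b) @ \oo --> A * B.
Proof.
move=> [M hM] [L hL] cA cB.
have M0 : 0 <= M by have := hM 0%N; rewrite big_geq.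
have a0 : a @ \oo --> 0 by apply: (@cvg_series_cvg_0 K K^o); apply/cvg_ex; exists A.
pose D n := \sum_(0 <= k < n) a k * (series b (n - k)%N - B).
have sB n : `|series b n| <= L.
  by apply: le_trans (ler_norm_sum _ _ _) (hL n).
pose L' := L + (L + 1).
have L'0 : 0 <= L'.
  have L0 : 0 <= L by have := hL 0%N; rewrite big_geq.
  by rewrite !addr_ge0.
have eB n : `|series b n - B| <= L'.
  by apply: le_trans (ler_normB _ _) _; rewrite lerD // (cvgn_bounded cB).
have cD : D @ \oo --> 0.
  apply/cvgn_epsP => e e0.
  pose d := e / (M + L' + 1).
  have pos : 0 < M + L' + 1 by rewrite ltr_wpDl // addr_ge0.
  have d0 : 0 < d by rewrite divr_gt0.
  have /cvgn_epsP/(_ d d0)[N1 h1] := cB.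
  (* At most [N1] indices satisfy [n - k < N1], so bounding each such [a k] by [d / N1.+1%:R] keeps
     their sum below [d]; the successor avoids a zero denominator. *)
  have d10 : 0 < d / N1.+1%:R by rewrite divr_gt0 // ltr0n.
  have /cvgn_epsP/(_ _ d10)[N2 h2] := a0.
  exists (N1 + N2)%N => n hn; rewrite sub0r normrN.
  apply: le_trans (ler_norm_sum _ _ _) _.
  apply: (@le_trans _ _ (\sum_(0 <= k < n) (`|a k| * d + (if (n - k < N1)%N then d / N1.+1%:R * L' else 0)))).
    rewrite !big_nat; apply: ler_sum => k /andP[_ kn]; rewrite normrM.
    case: ltnP => nk; last first.
      by rewrite addr0 ler_wpM2l // distrC h1.
    apply: (@le_trans _ _ (d / N1.+1%:R * L')); last by rewrite lerDr mulr_ge0 // ltW.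
    have := h2 k; rewrite sub0r normrN => h2k.
    apply: (@le_trans _ _ (d / N1.+1%:R * `|series b (n - k)%N - B|)).
      by rewrite ler_wpM2r // h2k //; lia.
    by rewrite ler_wpM2l // ltW.
  rewrite big_split /= -mulr_suml.
  apply: (@le_trans _ _ (M * d + d * L')); last first.
    rewrite [d * L']mulrC -mulrDl /d mulrA ler_pdivrMr // mulrC ler_wpM2l ?ltW //.
    by rewrite ltrDl.
  apply: lerD; first by rewrite ler_wpM2r // ltW.
  rewrite (@big_cat_nat _ _ _ (n - N1)%N) //=; last exact: leq_subr.
  rewrite big_nat big1 ?add0r => [|k /andP[_ kn]]; last by rewrite ifF //; lia.
  apply: (@le_trans _ _ (\sum_(n - N1 <= k < n) d / N1.+1%:R * L')).
    apply: ler_sum => k _; case: ifP => // _.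
    by rewrite mulr_ge0 // ltW.
  rewrite sumr_const_nat (_ : (n - (n - N1) = N1)%N); last by lia.
  have -> : d / N1.+1%:R * L' *+ N1 = d / N1.+1%:R * N1%:R * L'.
    by rewrite -mulr_natr mulrAC.
  apply: ler_wpM2r => //; rewrite mulrAC ler_pdivrMr ?ltr0n //.
  by apply: ler_wpM2l; rewrite ?ler_nat // ltW.
have E n : series (conv a b) n = series a n * B + D n.
  rewrite /series /= /conv (sum_shift (fun k j => a k * b j)) /D mulr_suml -big_split /=.
  by apply: eq_bigr => k _; rewrite -mulr_sumr /series /= mulrBr addrC subrK.
have -> : series (conv a b) = (fun n => series a n * B + D n) by apply/funext => n; exact: E.
rewrite -[A * B]addr0; apply: cvgD => //.
by apply: cvgM => //; exact: cvg_cst.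
Qed.

End Series.

(** * Euler's series and the theta identity *)

Section Theta.
Variables (K : numFieldType) (x : K).
(* A [numFieldType] need not be complete. *)
Hypothesis complete : forall a : nat -> K, abs_bounded a -> cvgn (series a).
Hypothesis x0 : 0 < x.
Hypothesis x1 : 5 * x <= 1.
Local Notation p := (x ^+ 2).

Lemma p_gt0 : 0 < p. Proof. by rewrite exprn_gt0. Qed.

Lemma p_le : 3 * p <= 1.
Proof.
have xl : x <= 1 by apply: le_trans x1; rewrite ler_peMl ?ler1n // ltW.
apply: le_trans x1; rewrite expr2 mulrA ler_pM2r //.
apply: (@le_trans _ _ 3); last by rewrite ler_nat.
by rewrite -[leRHS]mulr1 ler_wpM2l // ler0n.
Qed.

Lemma p_lt1 : p < 1.
Proof.
apply: lt_le_trans p_le; rewrite mulr_natl -[ltLHS]mulr1n.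
by rewrite ltr_pMn2l ?p_gt0.
Qed.

Lemma poch_recr n : poch p n.+1 = poch p n * (1 - p ^+ n.+1).
Proof. by rewrite /poch big_ord_recr. Qed.

(** The bound needed is (p;p)_n >= 1/2; the extra [p ^+ n] makes the induction close, which uses 3p
    <= 1. It bounds the coefficients of both Euler series by 2. *)
Lemma poch_ge n : 1 + p ^+ n <= 2 * poch p n.
Proof.
have p0 := ltW p_gt0; have pl := ltW p_lt1.
elim: n => [|n IH]; first by rewrite expr0 /poch big_ord0 mulr1.
rewrite poch_recr mulrA; apply: (@le_trans _ _ ((1 + p ^+ n) * (1 - p ^+ n.+1))); last first.
  by rewrite ler_wpM2r // subr_ge0 exprn_ile1.
rewrite -subr_ge0.
have -> : (1 + p ^+ n) * (1 - p ^+ n.+1) - (1 + p ^+ n.+1) =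
    p ^+ n * (1 - 3 * p + p * (1 - p ^+ n)) by rewrite (exprS p n); ring.
apply: mulr_ge0; first exact: exprn_ge0.
apply: addr_ge0; first by rewrite subr_ge0 p_le.
by apply: mulr_ge0; rewrite // subr_ge0 exprn_ile1.
Qed.

Lemma poch_gt0 n : 0 < poch p n.
Proof.
rewrite -(pmulr_rgt0 _ (ltr0n K 2)); apply: lt_le_trans (poch_ge n).
by rewrite ltr_wpDr // exprn_ge0 // ltW // p_gt0.
Qed.

Lemma poch_p_neq0 n : poch p n != 0. Proof. by rewrite gt_eqF // poch_gt0. Qed.

Lemma norm_inv_poch n : `|(poch p n)^-1| <= 2.
Proof.
rewrite normfV gtr0_norm ?poch_gt0 // -div1r ler_pdivrMr ?poch_gt0 //.
by apply: le_trans (poch_ge n); rewrite lerDl exprn_ge0 // ltW // p_gt0.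
Qed.

Lemma geometric_bound (z : K) n : `|z| < 1 -> \sum_(0 <= k < n) `|z| ^+ k <= (1 - `|z|)^-1.
Proof.
move=> z1; rewrite -div1r ler_pdivlMr ?subr_gt0 // big_mkord mulrC -opprB mulNr -subrX1.
by rewrite opprB gerBl exprn_ge0.
Qed.

Lemma norm_shrink (z : K) n : `|z| < 1 -> `|z * p ^+ n| <= `|z|.
Proof.
move=> z1; rewrite normrM -[leRHS]mulr1 ler_wpM2l // normrX exprn_ile1 //.
by rewrite gtr0_norm ?p_gt0 // ltW // p_lt1.
Qed.

Section PowerSeries.
Variable c : nat -> K.
Hypothesis c0 : c 0%N = 1.
Hypothesis c2 : forall n, `|c n| <= 2.

Definition pser (z : K) (n : nat) : K := c n * z ^+ n.

Lemma pser_bound z n : `|z| < 1 -> \sum_(0 <= k < n) `|pser z k| <= 2 * (1 - `|z|)^-1.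
Proof.
move=> z1; apply: (@le_trans _ _ (\sum_(0 <= k < n) 2 * `|z| ^+ k)).
  by apply: ler_sum => k _; rewrite normrM normrX ler_wpM2r // exprn_ge0.
by rewrite -mulr_sumr ler_wpM2l ?geometric_bound.
Qed.

Lemma pser_abs z : `|z| < 1 -> abs_bounded (pser z).
Proof. by move=> z1; exists (2 * (1 - `|z|)^-1) => n; exact: pser_bound. Qed.

Definition psum z : K := limn (series (pser z)).

Lemma psum_cvg z : `|z| < 1 -> series (pser z) @ \oo --> psum z.
Proof. by move=> z1; apply: complete; exact: pser_abs. Qed.

(** Continuity at 0 along w = z p^n: the sum differs from its constant term 1 by at most |w| times a
    bound that does not depend on n. This is the limit reached when a functional equation is
    iterated. *)
Lemma psum_shrink_cvg z : `|z| < 1 -> (fun n => psum (z * p ^+ n)) @ \oo --> (1 : K).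
Proof.
move=> z1; apply/cvgn_epsP => e e0.
pose M := 2 * (1 - `|z|)^-1.
have M0 : 0 <= M by rewrite mulr_ge0 // invr_ge0 subr_ge0 ltW.
have e2 : 0 < e / 2 by rewrite divr_gt0.
have d0 : 0 < e / 2 / (M + 1) by rewrite divr_gt0 // ltr_wpDl.
(* [K] is not assumed archimedean; p^n tends to 0 because [complete] makes the geometric series
   converge. *)
have p0 : (fun n => p ^+ n) @ \oo --> (0 : K).
  apply: (@cvg_series_cvg_0 K K^o); apply: complete; exists (1 - `|p|)^-1 => n.
  under eq_bigr do rewrite normrX; apply: geometric_bound.
  by rewrite gtr0_norm ?p_gt0 // p_lt1.
have /cvgn_epsP/(_ _ d0)[N hN] := p0.
exists N => n nN; set w := z * p ^+ n.
have wz : `|w| <= `|z| := norm_shrink n z1.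
have w1 : `|w| < 1 := le_lt_trans wz z1.
have /cvgn_epsP/(_ _ e2)[m hm] := psum_cvg w1.
have {}hm := hm m.+1 (leqnSn m).
have S1 : series (pser w) m.+1 - 1 = w * \sum_(0 <= k < m) c k.+1 * w ^+ k.
  rewrite /series /= big_nat_recl // {1}/pser c0 expr0 mulr1 addrC addKr mulr_sumr.
  by apply: eq_bigr => k _; rewrite /pser exprS mulrCA.
have S2 : `|\sum_(0 <= k < m) c k.+1 * w ^+ k| <= M.
  apply: le_trans (ler_norm_sum _ _ _) _.
  apply: (@le_trans _ _ (\sum_(0 <= k < m) 2 * `|w| ^+ k)).
    by apply: ler_sum => k _; rewrite normrM normrX ler_wpM2r // exprn_ge0.
  rewrite -mulr_sumr ler_wpM2l //; apply: le_trans (geometric_bound m w1) _.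
  by rewrite lef_pV2 ?posrE ?subr_gt0 // lerB.
have -> : 1 - psum w = - ((psum w - series (pser w) m.+1) + (series (pser w) m.+1 - 1)).
  by rewrite addrA subrK opprB.
rewrite normrN; apply: le_trans (ler_normD _ _) _.
rewrite [leRHS](splitr e) lerD // S1 normrM.
apply: (@le_trans _ _ (`|p ^+ n| * M)).
  apply: ler_pM => //; rewrite /w normrM -[leRHS]mul1r ler_wpM2r //.
  exact: ltW.
have := hN n nN; rewrite sub0r normrN => h.
apply: (@le_trans _ _ (e / 2 / (M + 1) * M)); first by rewrite ler_wpM2r.
rewrite mulrAC ler_pdivrMr ?ltr_wpDl //; apply: ler_wpM2l; first exact: ltW.
by rewrite lerDl.
Qed.

End PowerSeries.

(** [E n] is nonzero for large [n], so [P n] eventually equals [L / E n]. *)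
Lemma cvg_of_mul (P E : nat -> K) (L : K) :
  (forall n, P n * E n = L) -> E @ \oo --> (1 : K) -> P @ \oo --> L.
Proof.
move=> PE E1.
have c : (fun n => L * (E n)^-1) @ \oo --> L.
  rewrite -[X in _ --> X]mulr1 -[X in _ * X]invr1.
  by apply: cvgM; [exact: cvg_cst|apply: cvgV => //; exact: oner_neq0].
apply: cvg_trans c; apply: near_eq_cvg.
have h2 : (0 : K) < 2^-1 by rewrite invr_gt0.
have /cvgn_epsP/(_ _ h2)[N hN] := E1.
exists N => // n /= nN; have := hN n nN.
rewrite -(PE n); have [->|En _] := eqVneq (E n) 0; last by rewrite mulfK.
rewrite subr0 normr1 -[leRHS]div1r ler_pdivlMr // mul1r => h.
by have := lt_le_trans (ltr1n K 2) h; rewrite ltxx.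
Qed.

(** Coefficients of Euler's series: [ecoef] for (-z;p)_oo, where x^(n(n-1)) is p^(n(n-1)/2), and
    [hcoef] for 1/(z;p)_oo. *)
Definition ecoef n : K := x ^+ (n * n.-1) / poch p n.
Definition hcoef n : K := (poch p n)^-1.

Lemma ecoef0 : ecoef 0 = 1. Proof. by rewrite /ecoef /poch big_ord0 divr1. Qed.
Lemma hcoef0 : hcoef 0 = 1. Proof. by rewrite /hcoef /poch big_ord0 invr1. Qed.

Lemma hcoef_le n : `|hcoef n| <= 2. Proof. exact: norm_inv_poch. Qed.

Lemma ecoef_le n : `|ecoef n| <= 2.
Proof.
rewrite normrM -[leRHS]mul1r; apply: ler_pM => //; last exact: norm_inv_poch.
rewrite normrX exprn_ile1 // gtr0_norm //.
by apply: le_trans x1; rewrite ler_peMl ?ler1n // ltW.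
Qed.

Definition esum_ z := psum ecoef z.
Definition hsum_ z := psum hcoef z.

Lemma ecoef_step n : ecoef n.+1 * (1 - p ^+ n.+1) = ecoef n * p ^+ n.
Proof.
rewrite /ecoef poch_recr invfM mulrA divfK; last first.
  by have := poch_p_neq0 n.+1; rewrite poch_recr mulf_eq0 negb_or => /andP[].
rewrite mulrAC -exprM -exprD; congr (x ^+ _ / _).
by case: n => //= n; lia.
Qed.

Lemma hcoef_step n : hcoef n.+1 * (1 - p ^+ n.+1) = hcoef n.
Proof.
rewrite /hcoef poch_recr invfM divfK //.
by have := poch_p_neq0 n.+1; rewrite poch_recr mulf_eq0 negb_or => /andP[].
Qed.

Lemma lt1_mulp z : `|z| < 1 -> `|z * p| < 1.
Proof. by move=> z1; have h := norm_shrink 1 z1; rewrite expr1 in h; exact: le_lt_trans z1. Qed.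

Lemma seriesSr (a : nat -> K) n : series a n.+1 = series a n + a n.
Proof. by rewrite /series /= big_nat_recr. Qed.

(** The functional equation of (-z;p)_oo. The recurrence [ecoef_step] makes it exact on partial
    sums, up to a shift of length, and the limit follows. *)
Lemma esum_fun z : `|z| < 1 -> esum_ z = (1 + z) * esum_ (z * p).
Proof.
move=> z1; have zp1 := lt1_mulp z1.
have E n : series (pser ecoef z) n.+1 =
    series (pser ecoef (z * p)) n.+1 + z * series (pser ecoef (z * p)) n.
  elim: n => [|n IH]; first by rewrite /series /= !big_nat1 big_geq // mulr0 addr0 /pser !expr0.
  rewrite (seriesSr (pser ecoef z) n.+1) IH.
  rewrite (seriesSr (pser ecoef (z * p)) n.+1) (seriesSr (pser ecoef (z * p)) n).
  have -> : pser ecoef z n.+1 = pser ecoef (z * p) n.+1 + z * pser ecoef (z * p) n.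
    rewrite /pser ![(z * p) ^+ _]exprMn; have := ecoef_step n.
    rewrite mulrBr mulr1 => /eqP; rewrite subr_eq => /eqP.
    move: (ecoef n.+1) (ecoef n) (p ^+ n.+1) (p ^+ n) => a b P P' E.
    by rewrite {1}E exprS; ring.
  by ring.
have c1 : (fun n => series (pser ecoef z) n.+1) @ \oo --> esum_ z.
  by rewrite (cvg_shiftS (series (pser ecoef z))); exact: psum_cvg ecoef_le _ z1.
have c2 : (fun n => series (pser ecoef z) n.+1) @ \oo --> esum_ (z * p) + z * esum_ (z * p).
  have -> : (fun n => series (pser ecoef z) n.+1) =
    (fun n => series (pser ecoef (z * p)) n.+1 + z * series (pser ecoef (z * p)) n).
    by apply/funext => n; exact: E.
  have c := psum_cvg ecoef_le zp1.
  by apply: cvgD; [rewrite (cvg_shiftS (series _))|apply: cvgM => //; exact: cvg_cst].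
by rewrite mulrDl mul1r; apply: cvg_unique c1 c2; exact: norm_hausdorff.
Qed.

Lemma hsum_fun z : `|z| < 1 -> (1 - z) * hsum_ z = hsum_ (z * p).
Proof.
move=> z1; have zp1 := lt1_mulp z1.
have E n : series (pser hcoef (z * p)) n.+1 =
    series (pser hcoef z) n.+1 - z * series (pser hcoef z) n.
  elim: n => [|n IH]; first by rewrite /series /= !big_nat1 big_geq // mulr0 subr0 /pser !expr0.
  rewrite (seriesSr (pser hcoef (z * p)) n.+1) IH.
  rewrite (seriesSr (pser hcoef z) n.+1) (seriesSr (pser hcoef z) n).
  have -> : pser hcoef (z * p) n.+1 = pser hcoef z n.+1 - z * pser hcoef z n.
    rewrite /pser [(z * p) ^+ _]exprMn -(hcoef_step n).
    move: (hcoef n.+1) (p ^+ n.+1) => a P.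
    by rewrite exprS; ring.
  by ring.
have c := psum_cvg hcoef_le z1.
have c1 : (fun n => series (pser hcoef (z * p)) n.+1) @ \oo --> hsum_ (z * p).
  by rewrite (cvg_shiftS (series (pser hcoef (z * p)))); exact: psum_cvg hcoef_le _ zp1.
have c2 : (fun n => series (pser hcoef (z * p)) n.+1) @ \oo --> hsum_ z - z * hsum_ z.
  have -> : (fun n => series (pser hcoef (z * p)) n.+1) =
    (fun n => series (pser hcoef z) n.+1 - z * series (pser hcoef z) n).
    by apply/funext => n; exact: E.
  by apply: cvgB; [rewrite (cvg_shiftS (series _))|apply: cvgM => //; exact: cvg_cst].
by rewrite mulrBl mul1r; apply: cvg_unique c2 c1; exact: norm_hausdorff.
Qed.

Lemma esum_prod z : `|z| < 1 ->
  (fun n => \prod_(i < n) (1 + z * p ^+ i)) @ \oo --> esum_ z.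
Proof.
move=> z1; apply: (cvg_of_mul (E := fun n => esum_ (z * p ^+ n))); last first.
  exact: psum_shrink_cvg ecoef0 ecoef_le _ z1.
elim=> [|n IH]; first by rewrite big_ord0 mul1r mulr1.
rewrite big_ord_recr /= -[in RHS]IH -mulrA; congr (_ * _).
rewrite (esum_fun (z := z * p ^+ n)); first by rewrite -mulrA -(exprSr p n).
exact: le_lt_trans (norm_shrink n z1) z1.
Qed.

(** Iterating [hsum_fun] gives the identity [E]. It also forces [hsum_ z] to be nonzero, since
    otherwise all values at z p^n would vanish while they tend to 1. *)
Lemma hsum_prod z : `|z| < 1 -> hsum_ z != 0 /\
  (fun n => \prod_(i < n) (1 - z * p ^+ i)) @ \oo --> (hsum_ z)^-1.
Proof.
move=> z1; have E n : (\prod_(i < n) (1 - z * p ^+ i)) * hsum_ z = hsum_ (z * p ^+ n).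
  elim: n => [|n IH]; first by rewrite big_ord0 mul1r mulr1.
  rewrite big_ord_recr /= mulrAC IH (exprSr p n) mulrA -hsum_fun; first by rewrite mulrC.
  exact: le_lt_trans (norm_shrink n z1) z1.
have c : (fun n => hsum_ (z * p ^+ n)) @ \oo --> (1 : K).
  exact: psum_shrink_cvg hcoef0 hcoef_le _ z1.
have h0 : hsum_ z != 0.
  apply/eqP => h0; have /cvgn_epsP/(_ 2^-1)[|N hN] := c; first by rewrite invr_gt0.
  have := hN N (leqnn N); rewrite -E h0 mulr0 subr0 normr1 -[leRHS]div1r ler_pdivlMr // mul1r => h.
  by have := lt_le_trans (ltr1n K 2) h; rewrite ltxx.
split=> //; have -> : (fun n => \prod_(i < n) (1 - z * p ^+ i)) =
    (fun n => hsum_ (z * p ^+ n) * (hsum_ z)^-1).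
  by apply/funext => n; rewrite -E mulfK.
by rewrite -[X in _ --> X]mul1r; apply: cvgM => //; exact: cvg_cst.
Qed.

(* [1/(p;p)_(n-i)], extended by 0 to [i > n]. *)
Let hh n i : K := if (i <= n)%N then hcoef (n - i) else 0.

Lemma hh_recl n i : hh n.+1 i * (1 - p ^+ (n.+1 - i)) = hh n i.
Proof.
rewrite /hh; case: (ltngtP i n.+1) => [ni|ni|->].
- by rewrite -ltnS ni subSn // hcoef_step.
- by rewrite leqNgt ltnW // mul0r.
- by rewrite ltnn subnn expr0 subrr mulr0.
Qed.

Lemma hh_recr n i : hh n i * (1 - p ^+ (n - i)) = hh n i.+1.
Proof.
rewrite /hh; case: (ltngtP i n) => [ni|ni|->].
- by rewrite -[in X in X * _](subnSK ni) -[in X in _ * X](subnSK ni) hcoef_step.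
- by rewrite mul0r.
- by rewrite subnn expr0 subrr mulr0.
Qed.

Let vterm j k i : K := p ^+ ((j - i) * (k - i)) * hcoef i * hh j i * hh k i.

(* q-Vandermonde, by the recurrence in [j]. *)
Lemma vandermonde j k : \sum_(0 <= i < j.+1) vterm j k i = hcoef j * hcoef k.
Proof.
elim: j => [|j IH].
  by rewrite big_nat1 /vterm sub0n mul0n expr0 mul1r /hh !subn0 leqnn hcoef0 !mul1r.
have nz : 1 - p ^+ j.+1 != 0.
  by have := poch_p_neq0 j.+1; rewrite poch_recr mulf_eq0 negb_or => /andP[].
apply: (mulIf nz); rewrite mulrAC hcoef_step -IH mulr_suml.
(* Write 1 - p^(j+1) as (1 - p^(j+1-i)) + p^(j+1-i) (1 - p^i). The first part lowers [j] and leaves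
   a factor p^(k-i); the second, reindexed by i + 1, contributes 1 - p^(k-i) times the same term. *)
have split i : (i < j.+2)%N -> vterm j.+1 k i * (1 - p ^+ j.+1) =
    p ^+ (k - i) * vterm j k i +
    p ^+ (j.+1 - i) * (1 - p ^+ i) * vterm j.+1 k i.
  move=> ij; have -> : p ^+ (k - i) * vterm j k i = (1 - p ^+ (j.+1 - i)) * vterm j.+1 k i.
    rewrite /vterm -(hh_recl j i); move: ij; rewrite ltnS leq_eqVlt => /orP[/eqP->|ij].
      by rewrite subnn expr0 subrr; ring.
    by rewrite subSn // mulSn (exprD p); ring.
  have -> : p ^+ j.+1 = p ^+ (j.+1 - i) * p ^+ i by rewrite -(exprD p) subnK // -ltnS.
  by ring.
rewrite !big_nat (eq_bigr _ (fun i h => split i (andP h).2)) -!big_nat big_split /=.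
have vz : vterm j k j.+1 = 0 by rewrite /vterm /hh ltnn mulr0 mul0r.
rewrite big_nat_recr //= vz mulr0 addr0.
rewrite [X in _ + X]big_nat_recl // expr0 subrr mulr0 mul0r add0r -big_split /=.
rewrite !big_nat; apply: eq_bigr => i /andP[_ ij].
suff -> : p ^+ (j.+1 - i.+1) * (1 - p ^+ i.+1) * vterm j.+1 k i.+1 =
    (1 - p ^+ (k - i)) * vterm j k i by ring.
rewrite /vterm subSS (_ : hh j.+1 i.+1 = hh j i); last by rewrite /hh ltnS subSS.
rewrite -(hcoef_step i) -hh_recr.
case: (ltngtP i k) => ik; last by rewrite ik subnn expr0 subrr; ring.
- rewrite -[in p ^+ ((j - i) * (k - i))](subnSK ik) mulnS (exprD p).
  by move: (p ^+ (j - i)) (p ^+ (_ * _)) => a b; ring.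
have -> : hh k i = 0 by rewrite /hh leqNgt ik.
by ring.
Qed.

(** After [vandermonde], (j-k)^2 + 2(j-i)(k-i) = (j-i)^2 + (k-i)^2 separates the exponents, and each
    summand becomes a product of terms of three Euler series. The free bound [m] lets all [j] share
    one range of summation. *)
Lemma theta_termE u1 u2 j k m : (j < m)%N -> theta_term x u1 u2 j k =
  \sum_(0 <= i < m) (if (i <= j)%N && (i <= k)%N then
     pser hcoef (u1 * u2) i * (pser ecoef (u1 * x) (j - i) * pser ecoef (u2 * x) (k - i)) else 0).
Proof.
move=> jm; rewrite (@big_cat_nat _ _ _ j.+1) //= [X in _ + X]big_nat [X in _ + X]big1 ?addr0; last first.
  by move=> i /andP[ji _]; rewrite leqNgt ji.
rewrite /theta_term invfM -/(hcoef j) -/(hcoef k) -vandermonde mulr_sumr.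
rewrite !big_nat; apply: eq_bigr => i /andP[_]; rewrite ltnS => ij.
rewrite ij /=; case: leqP => ik; last by rewrite /vterm /hh (leqNgt i k) ik !mulr0.
rewrite /vterm /hh ij ik /pser /ecoef -!/(hcoef _).
have -> : x ^+ ((j - i) * (j - i).-1) / poch p (j - i) * (u1 * x) ^+ (j - i) =
   u1 ^+ (j - i) * x ^+ ((j - i) ^ 2) * hcoef (j - i).
  rewrite exprMn /hcoef (_ : ((j - i) ^ 2 = (j - i) * (j - i).-1 + (j - i))%N); last first.
    by case: (j - i)%N => // a; rewrite /=; lia.
  by rewrite (exprD x); ring.
have -> : x ^+ ((k - i) * (k - i).-1) / poch p (k - i) * (u2 * x) ^+ (k - i) =
   u2 ^+ (k - i) * x ^+ ((k - i) ^ 2) * hcoef (k - i).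
  rewrite exprMn /hcoef (_ : ((k - i) ^ 2 = (k - i) * (k - i).-1 + (k - i))%N); last first.
    by case: (k - i)%N => // a; rewrite /=; lia.
  by rewrite (exprD x); ring.
have xE : x ^+ dist2 j k * p ^+ ((j - i) * (k - i)) = x ^+ ((j - i) ^ 2) * x ^+ ((k - i) ^ 2).
  rewrite -(exprM x) -!(exprD x); congr (x ^+ _).
  have := dist2E (j - i)%N (k - i)%N.
  have -> : dist2 (j - i)%N (k - i)%N = dist2 j k.
    by rewrite /dist2 -!subnDA !(addnC i) !subnDA; congr (_ ^ 2 + _ ^ 2)%N; lia.
  by move: (dist2 j k) (j - i)%N (k - i)%N => a b c; lia.
have -> : u1 ^+ j = u1 ^+ i * u1 ^+ (j - i) by rewrite -exprD subnKC.
have -> : u2 ^+ k = u2 ^+ i * u2 ^+ (k - i) by rewrite -exprD subnKC.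
transitivity (u1 ^+ i * u1 ^+ (j - i) * (u2 ^+ i * u2 ^+ (k - i)) *
  (x ^+ dist2 j k * p ^+ ((j - i) * (k - i))) * hcoef i * hcoef (j - i) * hcoef (k - i)).
  by move: (p ^+ _) (x ^+ _) => a b; ring.
by rewrite xE exprMn; move: (x ^+ _) (x ^+ _) => a b; ring.
Qed.

(** The product u1 u2 has degree 2 in u, so the coefficients of its series are placed at the even
    indices. *)
Let spread (a : nat -> K) m : K := if odd m then 0 else a m./2.

Lemma sum_spread (a : nat -> K) N :
  \sum_(0 <= m < N) spread a m = \sum_(0 <= i < uphalf N) a i.
Proof.
elim: N => [|N IH]; first by rewrite !big_geq.
rewrite big_nat_recr //= IH uphalf_half /spread.
by case: (odd N) => /=; rewrite ?addr0 // add0n big_nat_recr.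
Qed.

Lemma theta_coefE u1 u2 n : theta_coef x u1 u2 n =
  conv (spread (pser hcoef (u1 * u2))) (conv (pser ecoef (u1 * x)) (pser ecoef (u2 * x))) n.
Proof.
rewrite /theta_coef -(big_mkord xpredT (fun j => theta_term x u1 u2 j (n - j))) big_nat.
rewrite (eq_bigr _ (fun j h => theta_termE u1 u2 (n - j) (andP h).2)) -big_nat.
rewrite exchange_big_nat /=.
pose c := conv (pser ecoef (u1 * x)) (pser ecoef (u2 * x)).
(* The conditions on [i] leave [j] between [i] and [n - i], a nonempty range exactly for
   [i < uphalf n.+1]; shifting [j] by [i] turns the inner sum into a convolution of degree
   [n - i.*2]. *)
transitivity (\sum_(0 <= i < n.+1) if (i < uphalf n.+1)%N then pser hcoef (u1 * u2) i * c (n - i.*2)%N else 0).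
  rewrite !big_nat; apply: eq_bigr => i /andP[_ iN].
  case: ltnP => hi.
    have i2n : (i.*2 <= n)%N by move: hi; rewrite /=; lia.
    rewrite (@big_cat_nat _ _ _ i) //=; last exact: ltnW.
    rewrite big_nat big1 ?add0r => [|j /andP[_ ji]]; last first.
      by rewrite leqNgt ji.
    rewrite (@big_cat_nat _ _ _ (n - i).+1) //=; [|lia|lia].
    rewrite [X in _ + X]big_nat [X in _ + X]big1 ?addr0 => [|j /andP[ji jn]]; last first.
      by rewrite [X in _ && X](_ : _ = false) ?andbF //; lia.
    rewrite /c /conv mulr_sumr -{1}(add0n i) big_addn (_ : ((n - i).+1 - i = (n - i.*2).+1)%N); last by lia.
    rewrite !big_nat; apply: eq_bigr => j /andP[_ jn].
    rewrite leq_addl (_ : (i <= n - (j + i))%N = true); last by lia.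
    by rewrite addnK (_ : (n - (j + i) - i = n - i.*2 - j)%N) //; lia.
  rewrite big_nat big1 // => j /andP[_ jn]; rewrite ifF //.
  by move: hi; rewrite /=; lia.
rewrite (@big_cat_nat _ _ _ (uphalf n.+1)) //=; last by lia.
rewrite [X in _ + X]big_nat [X in _ + X]big1 ?addr0 => [|i /andP[hi _]]; last by rewrite ifF //; lia.
rewrite big_nat; under eq_bigr => i /andP[_ hi] do rewrite hi.
rewrite -big_nat -[(n./2).+1]/(uphalf n.+1).
rewrite -(sum_spread (fun i => pser hcoef (u1 * u2) i * c (n - i.*2)%N)).
rewrite /conv !big_nat; apply: eq_bigr => m /andP[_ mn]; rewrite /spread.
by case om: (odd m); rewrite ?mul0r // halfK om subn0.
Qed.

Lemma theta_series u1 u2 : `|u1 * x| < 1 -> `|u2 * x| < 1 -> `|u1 * u2| < 1 ->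
  series (theta_coef x u1 u2) @ \oo -->
    hsum_ (u1 * u2) * (esum_ (u1 * x) * esum_ (u2 * x)).
Proof.
move=> h1 h2 h12.
have -> : theta_coef x u1 u2 = conv (spread (pser hcoef (u1 * u2)))
    (conv (pser ecoef (u1 * x)) (pser ecoef (u2 * x))).
  by apply/funext => n; exact: theta_coefE.
have a1 := pser_abs ecoef_le h1; have a2 := pser_abs ecoef_le h2.
have c1 := psum_cvg ecoef_le h1; have c2 := psum_cvg ecoef_le h2.
have c12 := psum_cvg hcoef_le h12.
apply: cauchy_product.
- exists (2 * (1 - `|u1 * u2|)^-1) => n.
  have -> : \sum_(0 <= k < n) `|spread (pser hcoef (u1 * u2)) k| =
      \sum_(0 <= k < n) spread (fun i => `|pser hcoef (u1 * u2) i|) k.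
    by apply: eq_bigr => k _; rewrite /spread; case: odd; rewrite ?normr0.
  by rewrite sum_spread; apply: pser_bound hcoef_le _ _ h12.
- exact: abs_bounded_conv.
- apply/cvgn_epsP => e e0; have /cvgn_epsP/(_ e e0)[N hN] := c12.
  exists N.*2 => n hn; rewrite /series /= sum_spread; apply: hN.
  by rewrite uphalf_half; lia.
exact: cauchy_product.
Qed.

Lemma cvg_halves (f : nat -> nat) (a : nat -> K) (L : K) :
  (forall n, n./2 <= f n)%N -> a @ \oo --> L -> (a \o f) @ \oo --> L.
Proof.
move=> hf /cvgn_epsP h; apply/cvgn_epsP => e e0; have [N hN] := h e e0.
exists N.*2 => n Nn; apply: hN; apply: leq_trans (hf n).
by rewrite -[N]doubleK half_leq.
Qed.

(** Even powers of [x] form (-z;p)_oo and odd ones (-zx;p)_oo; the first [n] factors split into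
    [uphalf n] and [half n] of them. *)
Lemma esum_prod_x z : `|z| < 1 -> `|z * x| < 1 ->
  (fun n => \prod_(i < n) (1 + z * x ^+ i)) @ \oo --> esum_ z * esum_ (z * x).
Proof.
move=> z1 zx1.
pose A n := \prod_(i < n) (1 + z * p ^+ i); pose B n := \prod_(i < n) (1 + z * x * p ^+ i).
have -> : (fun n => \prod_(i < n) (1 + z * x ^+ i)) = (fun n => (A \o uphalf) n * (B \o half) n).
  apply/funext; elim=> [|n IH]; first by rewrite /= /A /B !big_ord0 mulr1.
  have oE : n = (odd n + n./2.*2)%N by rewrite odd_double_half.
  rewrite big_ord_recr /= IH /= /A /B uphalf_half; case on: (odd n) oE => /= oE.
    rewrite add1n [\prod_(i < n./2.+1) (1 + z * x * _)]big_ord_recr /= -mulrA; congr (_ * (_ * _)).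
    by rewrite {1}oE add1n exprS -mul2n (exprM x) mulrA.
  rewrite add0n [\prod_(i < n./2.+1) _]big_ord_recr /= mulrAC; congr (_ * _ * _).
  by rewrite {1}oE add0n -mul2n (exprM x).
apply: cvgM; apply: cvg_halves => //; first by move=> n; rewrite uphalf_half leq_addl.
- exact: esum_prod.
- exact: esum_prod.
Qed.

End Theta.

(** * Evaluation of the infinite products *)

Lemma infprodP (K : numFieldType) (f g : nat -> K) (L : K) :
  (forall j, f j.+1 = g j) -> (fun n => \prod_(i < n) g i) @ \oo --> L -> infprod f = L.
Proof.
move=> fg gL; rewrite /infprod.
have -> : (fun n => \prod_(1 <= i < n.+1) f i) = (fun n => \prod_(i < n) g i).
  apply/funext => n; rewrite big_add1 /= big_mkord.
  by apply: eq_bigr => i _; exact: fg.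
by apply: cvg_lim => //; exact: norm_hausdorff.
Qed.

(** An exponent such as 2(i - 2) is negative at i = 1. As a difference of naturals it can be read as
    a power of q times a power of 1/q. *)
Lemma shifted_exponents (j : nat) : let i := j.+1%:Z in
  [/\ 2 * (i - 1) = (2 * j)%:Z - 0%:Z, 2 * (i - 2) = (2 * j)%:Z - 2%:Z,
      2 * i - 3 = (2 * j)%:Z - 1%:Z, 2 * i - 1 = (2 * j + 1)%:Z - 0%:Z
    & 2 * i = (2 * j + 2)%:Z - 0%:Z].
Proof. by split; lia. Qed.

(** Completeness is isolated as a hypothesis on the abstract field; [complex_complete] discharges it
    for [R[i]]. *)
Lemma generating_functions (K : numFieldType) (F : finFieldType) (delta : F) (u : K)
    (q : K := #|F|%:R)
    (complete : forall a : nat -> K, abs_bounded a -> cvgn (series a))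
    (hq : #|F| = 1 %[mod 4])
    (hdelta : forall x : F, x ^+ 2 != delta)
    (hu : `|u| < 1 / q) :
  [/\ series_sums_to
        (fun n => ratio_plus F K n * q ^+ (n ^ 2) * u ^+ n)
        (1 / 4 *
          (infprod (fun i => (1 + u / q ^ (2 * (i%:Z - 1))) ^+ 2)
             / infprod (fun i => 1 - u ^+ 2 / q ^ (2 * (i%:Z - 2)))
         + 2 * infprod (fun i => 1 + u / q ^ (i%:Z - 1))
             / infprod (fun i => 1 - u ^+ 2 / q ^ (2 * i%:Z - 3))
         + infprod (fun i => (1 + u / q ^ (2 * i%:Z - 1)) ^+ 2)
             / infprod (fun i => 1 - u ^+ 2 / q ^ (2 * (i%:Z - 1))))),
      series_sums_to
        (fun n => ratio_minus K delta n * q ^+ (n ^ 2) * u ^+ n)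
        (1 / 4 *
          (infprod (fun i => (1 + u / q ^ (2 * (i%:Z - 1))) ^+ 2)
             / infprod (fun i => 1 - u ^+ 2 / q ^ (2 * (i%:Z - 2)))
         - infprod (fun i => (1 + u / q ^ (2 * i%:Z - 1)) ^+ 2)
             / infprod (fun i => 1 - u ^+ 2 / q ^ (2 * (i%:Z - 1)))))
    & series_sums_to
        (fun n => ratio_odd F K n * q ^+ (n ^ 2) * u ^+ n)
        (1 / 4 *
          ((1 + u) * infprod (fun i => (1 + u / q ^ (2 * i%:Z)) ^+ 2)
             / infprod (fun i => 1 - u ^+ 2 / q ^ (2 * (i%:Z - 1)))
         + infprod (fun i => 1 + u / q ^ i%:Z)
             / infprod (fun i => 1 - u ^+ 2 / q ^ (2 * i%:Z - 1))))].
Proof.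
have nd : ~~ is_sqr delta by apply/negP => /is_sqrP[y yd]; have := hdelta y; rewrite yd eqxx.
have h4 : (#|F| %% 4 = 1)%N by rewrite hq.
have q0 : q != 0 := Q_neq0 K h4.
have qp : 0 < q by rewrite lt_def q0 ler0n.
set x := q^-1; have x0 : 0 < x by rewrite invr_gt0.
have x1 : 5 * x <= 1.
  by rewrite ler_pdivrMr // mul1r ler_nat; exact: card_field_gt4.
have uq1 : `|u * q| < 1.
  by rewrite normrM [`|q|]gtr0_norm // -ltr_pdivlMr.
have xq : x * q = 1 by rewrite mulVf.
have nx : `|x| <= 1.
  by rewrite gtr0_norm //; apply: le_trans x1; rewrite ler_peMl ?ler1n // ltW.
have nMx (z : K) : `|z| < 1 -> `|z * x| < 1.
  by move=> z1; apply: le_lt_trans z1; rewrite normrM -[leRHS]mulr1 ler_wpM2l.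
have nM (y z : K) : `|y| < 1 -> `|z| < 1 -> `|y * z| < 1.
  by move=> y1 z1; rewrite normrM; apply: mulr_ilt1.
have uE : u = u * q * x by rewrite -mulrA (mulrC q) xq mulr1.
have u1 : `|u| < 1 by rewrite uE; exact: nMx.
have ux1 : `|u * x| < 1 := nMx _ u1.
(* [e v] is (-v;x^2)_oo and [h v] is 1/(v;x^2)_oo; all products and theta sums below are expressed
   in these two functions. *)
pose e := esum_ x; pose h := hsum_ x.
have qz (m k : nat) : q ^ (m%:Z - k%:Z) = q ^+ m * x ^+ k.
  by rewrite expfzDr // -exprnN /x exprVn -exprnP.
have pE j : (x ^+ 2) ^+ j = (q ^+ (2 * j))^-1 by rewrite -exprM exprVn.
have eprod (v : K) f : `|v| < 1 -> (forall j, f j.+1 = (1 + v * (x ^+ 2) ^+ j) ^+ 2) ->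
    infprod f = e v ^+ 2.
  move=> v1 fE; apply: (infprodP fE).
  have c := esum_prod complete x0 x1 v1.
  have -> : (fun n => \prod_(i < n) (1 + v * (x ^+ 2) ^+ i) ^+ 2) =
    (fun n => (\prod_(i < n) (1 + v * (x ^+ 2) ^+ i)) * (\prod_(i < n) (1 + v * (x ^+ 2) ^+ i))).
    by apply/funext => n; rewrite -big_split; apply: eq_bigr => i _; rewrite expr2.
  by rewrite expr2; apply: cvgM.
have hprod (v : K) f : `|v| < 1 -> (forall j, f j.+1 = 1 - v * (x ^+ 2) ^+ j) ->
    (infprod f)^-1 = h v.
  move=> v1 fE; have [_ c] := hsum_prod complete x0 x1 v1.
  by rewrite (infprodP fE c) invrK.
have xprod (v : K) f : `|v| < 1 -> (forall j, f j.+1 = 1 + v * x ^+ j) ->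
    infprod f = e v * e (v * x).
  by move=> v1 fE; apply: (infprodP fE); apply: esum_prod_x => //; exact: nMx.
have T (u1' u2' : K) : `|u1' * x| < 1 -> `|u2' * x| < 1 -> `|u1' * u2'| < 1 ->
  series_sums_to (theta_coef x u1' u2') (h (u1' * u2') * (e (u1' * x) * e (u2' * x))).
  by move=> a b c; exact: theta_series.
have uqx : u * q * x = u by rewrite -uE.
have T1 := T (u * q) (u * q) (nMx _ uq1) (nMx _ uq1) (nM _ _ uq1 uq1).
have T2 := T (u * q) u (nMx _ uq1) ux1 (nM _ _ uq1 u1).
have T3 := T u u ux1 ux1 (nM _ _ u1 u1).
have T4 := T (u * q) (u * x) (nMx _ uq1) (nMx _ ux1) (nM _ _ uq1 ux1).
have T5 := T u (u * x) ux1 (nMx _ ux1) (nM _ _ u1 ux1).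
rewrite uqx in T1 T2 T4.
have I1 : infprod (fun i => (1 + u / q ^ (2 * (i%:Z - 1))) ^+ 2) = e u ^+ 2.
  apply: eprod => // j; have [-> _ _ _ _] := shifted_exponents j.
  by rewrite qz pE expr0 mulr1.
have J1 : (infprod (fun i => 1 - u ^+ 2 / q ^ (2 * (i%:Z - 2))))^-1 = h (u * q * (u * q)).
  apply: hprod => [|j]; first exact: nM.
  have [_ -> _ _ _] := shifted_exponents j.
  by rewrite qz pE /x; field; rewrite q0 expf_neq0.
have I2 : infprod (fun i => 1 + u / q ^ (i%:Z - 1)) = e u * e (u * x).
  apply: xprod => // j; rewrite (_ : j.+1%:Z - 1 = j%:Z - 0%:Z); last by rewrite intS addrC addKr subr0.
  by rewrite qz expr0 mulr1 /x exprVn.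
have J2 : (infprod (fun i => 1 - u ^+ 2 / q ^ (2 * i%:Z - 3)))^-1 = h (u * q * u).
  apply: hprod => [|j]; first exact: nM.
  have [_ _ -> _ _] := shifted_exponents j.
  by rewrite qz pE /x; field; rewrite q0 expf_neq0.
have I3 : infprod (fun i => (1 + u / q ^ (2 * i%:Z - 1)) ^+ 2) = e (u * x) ^+ 2.
  apply: eprod => // j; have [_ _ _ -> _] := shifted_exponents j.
  by rewrite qz pE (exprD q) /x; field; rewrite q0 expf_neq0.
have J3 : (infprod (fun i => 1 - u ^+ 2 / q ^ (2 * (i%:Z - 1))))^-1 = h (u * u).
  apply: hprod => [|j]; first exact: nM.
  have [-> _ _ _ _] := shifted_exponents j.
  by rewrite qz pE expr0 mulr1.
have I4 : infprod (fun i => (1 + u / q ^ (2 * i%:Z)) ^+ 2) = e (u * x ^+ 2) ^+ 2.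
  apply: eprod => [|j]; first by rewrite expr2 mulrA; exact: nMx.
  have [_ _ _ _ ->] := shifted_exponents j.
  by rewrite qz pE (exprD q) /x; field; rewrite q0 expf_neq0.
have I5 : infprod (fun i => 1 + u / q ^ i%:Z) = e (u * x) * e (u * x * x).
  apply: xprod => // j; rewrite -[j.+1%:Z]subr0.
  by rewrite qz expr0 mulr1 /x exprVn exprS invfM mulrA.
have J5 : (infprod (fun i => 1 - u ^+ 2 / q ^ (2 * i%:Z - 1)))^-1 = h (u * (u * x)).
  apply: hprod => [|j]; first exact: nM.
  have [_ _ _ -> _] := shifted_exponents j.
  by rewrite qz pE (exprD q) /x; field; rewrite q0 expf_neq0.
(* The first factor of (-u;x^2)_oo; it is the 1 + u in the third identity. *)
have eu : e u = (1 + u) * e (u * x ^+ 2) by exact: esum_fun.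
have serD (a b : nat -> K) : series (fun n => a n + b n) = (fun n => series a n + series b n).
  by apply/funext => n; rewrite /series /= big_split.
have serZ (a : nat -> K) : series (fun n => 1 / 4 * a n) = (fun n => 1 / 4 * series a n).
  by apply/funext => n; rewrite /series /= -mulr_sumr.
rewrite I1 I2 I3 I4 I5 J1 J2 J3 J5; split.
- rewrite /series_sums_to.
  (* By symmetry in u1 and u2 the two mixed theta sums coincide, whence the coefficient 2 of the
     middle term. *)
  have -> : (fun n => ratio_plus F K n * q ^+ (n ^ 2) * u ^+ n) =
     (fun n => 1 / 4 * (theta_coef x (u * q) (u * q) n + theta_coef x (u * q) u n +
       theta_coef x (u * q) u n + theta_coef x u u n)).
    by apply/funext => n; rewrite (plus_termE h4) (theta_coefC _ u).
  rewrite serZ !serD.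
  have -> : 1 / 4 * (e u ^+ 2 * h (u * q * (u * q)) + 2 * (e u * e (u * x)) * h (u * q * u) +
     e (u * x) ^+ 2 * h (u * u)) =
     1 / 4 * (h (u * q * (u * q)) * (e u * e u) + h (u * q * u) * (e u * e (u * x)) +
     h (u * q * u) * (e u * e (u * x)) + h (u * u) * (e (u * x) * e (u * x))) by ring.
  by apply: cvgM; [exact: cvg_cst|do !apply: cvgD].
- rewrite /series_sums_to.
  (* Here the mixed theta sums occur with opposite signs and cancel. *)
  have -> : (fun n => ratio_minus K delta n * q ^+ (n ^ 2) * u ^+ n) =
     (fun n => 1 / 4 * (theta_coef x (u * q) (u * q) n + - theta_coef x u u n)).
    apply/funext => n; rewrite (minus_termE h4) // (theta_coefC _ u).
    by rewrite subrK.
  rewrite serZ serD.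
  have -> : series (fun n => - theta_coef x u u n) = (fun n => - series (theta_coef x u u) n).
    by apply/funext => n; rewrite /series /= sumrN.
  have -> : 1 / 4 * (e u ^+ 2 * h (u * q * (u * q)) - e (u * x) ^+ 2 * h (u * u)) =
     1 / 4 * (h (u * q * (u * q)) * (e u * e u) + - (h (u * u) * (e (u * x) * e (u * x)))) by ring.
  by apply: cvgM; [exact: cvg_cst|apply: cvgD => //; exact: cvgN].
- rewrite /series_sums_to.
  have -> : (fun n => ratio_odd F K n * q ^+ (n ^ 2) * u ^+ n) =
     (fun n => 1 / 4 * (theta_coef x (u * q) (u * x) n + theta_coef x u (u * x) n)).
    by apply/funext => n; rewrite (odd_termE h4).
  rewrite serZ serD.
  have -> : 1 / 4 * ((1 + u) * e (u * x ^+ 2) ^+ 2 * h (u * u) +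
      e (u * x) * e (u * x * x) * h (u * (u * x))) =
     1 / 4 * (h (u * q * (u * x)) * (e u * e (u * x * x)) +
      h (u * (u * x)) * (e (u * x) * e (u * x * x))).
    have -> : u * q * (u * x) = u * u by rewrite mulrACA (mulrC q) xq mulr1.
    rewrite eu (_ : u * x * x = u * x ^+ 2); last by rewrite expr2 mulrA.
    by ring.
  by apply: cvgM; [exact: cvg_cst|apply: cvgD].
Qed.

(** * Completeness of the complex numbers *)

Section Complex.
Variable R : realType.
Local Notation C := R[i].

Lemma norm_le_ReIm (z : C) : `|z| <= (`|complex.Re z| + `|complex.Im z|)%:C%C.
Proof.
rewrite [z in leLHS]complexE; apply: le_trans (ler_normD _ _) _.
rewrite normrM !normc_def /= expr1n !expr0n /= !(addr0, add0r) sqrtr1 mul1r.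
by rewrite !sqrtr_sqr rmorphD.
Qed.

(** Real and imaginary parts form absolutely convergent real series, bounded through the real part
    of [M]. The binding [K := C] supplies the topology of a [numFieldType]. *)
Lemma complex_complete (K : numFieldType := C) (a : nat -> K) :
  abs_bounded a -> cvgn (series a).
Proof.
case=> M hM.
pose ra k := complex.Re (a k); pose ia k := complex.Im (a k).
have bound (b : nat -> R) : (forall k, (`|b k|)%:C%C <= `|a k|) -> cvgn (series b).
  move=> ba; apply: (@normed_cvg R R^o).
  apply: nondecreasing_is_cvgn.
    by apply: nondecreasing_series => n _ _; exact: normr_ge0.
  exists (complex.Re M) => _ [n _ <-].
  have : (\sum_(0 <= k < n) `|b k|)%:C%C <= M.
    apply: le_trans (hM n); rewrite rmorph_sum; apply: ler_sum => k _; exact: ba.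
  by rewrite lecE => /andP[_].
have /cvg_ex[lr hr] : cvgn (series ra) by apply: bound => k; exact: normc_ge_Re.
have /cvg_ex[li hi] : cvgn (series ia).
  apply: bound => k; rewrite /ia -normrN -ReiNIm; apply: le_trans (normc_ge_Re _) _.
  by rewrite normrM [`|'i%C|]normc_def /= expr1n expr0n /= add0r sqrtr1 mulr1.
have SE n : series a n = (series ra n +i* series ia n)%C.
  elim: n => [|n IH]; first by rewrite /series /= !big_geq.
  by rewrite !seriesSr IH /ra /ia; case: (a n).
apply/cvg_ex; exists (lr +i* li)%C; apply/cvgn_epsP => e.
(* A positive complex number is real, so [e] is handled through its real part. *)
rewrite ltcE /= => /andP[/eqP eI eR].
have e2 : 0 < complex.Re e / 2 by rewrite divr_gt0.
have /cvgn_epsP/(_ _ e2)[N1 h1] := hr; have /cvgn_epsP/(_ _ e2)[N2 h2] := hi.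
exists (maxn N1 N2) => n; rewrite geq_max => /andP[n1 n2].
apply: le_trans (norm_le_ReIm _) _; rewrite SE lecE /= eI eqxx /=.
by rewrite [leRHS]splitr lerD // ?h1 ?h2.
Qed.

End Complex.

Local Open Scope complex_scope.

Theorem theorem6p3 (R : realType) (F : finFieldType) (delta : F) (u : R[i])
    (q : R[i] := #|F|%:R)
    (hq : #|F| = 1 %[mod 4])
    (hdelta : forall x : F, x ^+ 2 != delta)
    (hu : `|u| < 1 / q) :
  [/\ series_sums_to
        (fun n => ratio_plus F R[i] n * q ^+ (n ^ 2) * u ^+ n)
        (1 / 4 *
          (infprod (fun i => (1 + u / q ^ (2 * (i%:Z - 1))) ^+ 2)
             / infprod (fun i => 1 - u ^+ 2 / q ^ (2 * (i%:Z - 2)))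
         + 2 * infprod (fun i => 1 + u / q ^ (i%:Z - 1))
             / infprod (fun i => 1 - u ^+ 2 / q ^ (2 * i%:Z - 3))
         + infprod (fun i => (1 + u / q ^ (2 * i%:Z - 1)) ^+ 2)
             / infprod (fun i => 1 - u ^+ 2 / q ^ (2 * (i%:Z - 1))))),
      series_sums_to
        (fun n => ratio_minus R[i] delta n * q ^+ (n ^ 2) * u ^+ n)
        (1 / 4 *
          (infprod (fun i => (1 + u / q ^ (2 * (i%:Z - 1))) ^+ 2)
             / infprod (fun i => 1 - u ^+ 2 / q ^ (2 * (i%:Z - 2)))
         - infprod (fun i => (1 + u / q ^ (2 * i%:Z - 1)) ^+ 2)
             / infprod (fun i => 1 - u ^+ 2 / q ^ (2 * (i%:Z - 1)))))
    & series_sums_to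
        (fun n => ratio_odd F R[i] n * q ^+ (n ^ 2) * u ^+ n)
        (1 / 4 *
          ((1 + u) * infprod (fun i => (1 + u / q ^ (2 * i%:Z)) ^+ 2)
             / infprod (fun i => 1 - u ^+ 2 / q ^ (2 * (i%:Z - 1)))
         + infprod (fun i => 1 + u / q ^ i%:Z)
             / infprod (fun i => 1 - u ^+ 2 / q ^ (2 * i%:Z - 1))))].
Proof. exact: (generating_functions (@complex_complete R) hq hdelta hu). Qed.
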